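(* Assume [LJ1]–[LJ4] and let $\ell,u_0^{(1)},u_1^{(1)}>0$. Let $k_n=(k_n^1,k_n^2)$ satisfy (K) and let the sets of representative atoms $\mathcal T_n=\{t_n^0,\dots,t_n^{r_n}\}$, $0=t_n^0<\dots<t_n^{r_n}=n$, satisfy: there exists a sequence $(p_n)\subset\mathbb N$ with $\lim_{n\to\infty}\lambda_np_n=0$ and $\max_i(t_n^{i+1}-t_n^i)\le p_n$ for all $n$. Then $\hat H_n^{\ell,k_n,\mathcal T_n}$ $\Gamma$-converges with respect to the strong $L^1(0,1)$-topology to the functional $H^\ell$, where $$H^\ell(u)=\begin{cases}\int_0^1J_0^{**}(u'(x))\,dx & \text{if } u\in BV^\ell(0,1),\ D^su\ge0,\\ +\infty&\text{otherwise on } L^1(0,1).\end{cases}$$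
   Context: Potentials: $J_1,J_2:\mathbb R\to(-\infty,+\infty]$; $J_{CB}:=J_1+J_2$; $J_0(z):=J_2(z)+\frac12\inf\{J_1(z_1)+J_1(z_2):z_1+z_2=2z\}$; $J_0^{**}$ is the convex lower semicontinuous envelope of $J_0$. Hypotheses: [LJ1] $\{z:J_0(z)=J_0^{**}(z)\}\cap\{z:J_0\text{ is affine in a neighbourhood of }z\}=\emptyset$. [LJ2] for every $z$ with $J_0(z)=J_0^{**}(z)$, the set $\{(z_1,z_2):z_1+z_2=2z,\ J_0(z)=J_2(z)+\frac12(J_1(z_1)+J_1(z_2))\}$ has exactly one element. [LJ3] $J_1,J_2$ are $C^{1,\alpha}$ on their domains for some $0<\alpha\le1$, $J_0$ is $C^1$ on its domain, $\operatorname{dom}J_1=\operatorname{dom}J_2\supset(0,+\infty)$, $\lim_{z\to+\infty}J_j(z)=0$ ($j=1,2$) and $\lim_{z\to+\infty}J_0(z)=:J_0(+\infty)\in\mathbb R$. [LJ4] there is a convex $\Psi:\mathbb R\to[0,+\infty]$ with $\lim_{z\to-\infty}\Psi(z)/|z|=+\infty$ and constants $c_1,c_2>0$ with $c_1(\Psi(z)-1)\le J_j(z)\le c_2\max\{\Psi(z),|z|\}$ for all $z\in\mathbb R$, $j=1,2$; there are $\delta_1,\delta_2,\gamma>0$ with $\{\delta_j\}=\operatorname{argmin}J_j$ and $\{\gamma\}=\operatorname{argmin}J_0$; $J_j$ is strictly convex on $(-\infty,\delta_j)\cap\operatorname{dom}J_j$; $J_0(\gamma)<J_0(+\infty)$;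 and $J_0(z)=J_0^{**}(z)$ for all $z\le\gamma$. Discrete setting: $\lambda_n=1/n$; $\mathcal A_n(0,1)$ is the set of continuous $u:[0,1]\to\mathbb R$ affine on each $(i\lambda_n,(i+1)\lambda_n)$, $i=0,\dots,n-1$; $u^i:=u(i\lambda_n)$. Boundary conditions (BC): $u^0=0$, $u^1=\lambda_nu_0^{(1)}$, $u^{n-1}=\ell-\lambda_nu_1^{(1)}$, $u^n=\ell$. Quasicontinuum energy: for integers $0<k_n^1<k_n^2<n-2$ and $u\in\mathcal A_n(0,1)$ satisfying (BC), $\hat H_n^{\ell,k_n}(u)=\sum_{i=0}^{n-1}\lambda_nJ_1(\frac{u^{i+1}-u^i}{\lambda_n})+\sum_{i=0}^{k_n^1-1}\lambda_nJ_2(\frac{u^{i+2}-u^i}{2\lambda_n})+\sum_{i=k_n^1}^{k_n^2-2}\frac{\lambda_n}{2}\{J_2(\frac{u^{i+1}-u^i}{\lambda_n})+J_2(\frac{u^{i+2}-u^{i+1}}{\lambda_n})\}+\sum_{i=k_n^2-1}^{n-2}\lambda_nJ_2(\frac{u^{i+2}-u^i}{2\lambda_n})$, and $+\infty$ otherwise. For $\mathcal T_n=\{t_n^0<\dots<t_n^{r_n}\}\subset\{0,\dots,n\}$ with $t_n^0=0,t_n^{r_n}=n$, $\mathcal A_{\mathcal T_n}(0,1)$ is the set of $u$ affine on each $(t_n^i\lambda_n,t_n^{i+1}\lambda_n)$, and $\hat H_n^{\ell,k_n,\mathcal T_n}(u)=\hat H_n^{\ell,k_n}(u)$ if $u\in\mathcal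 A_{\mathcal T_n}(0,1)$, $+\infty$ otherwise. Assumption (K): $k_n^1\to\infty$, $n-k_n^2\to\infty$, $\lambda_nk_n^1\to0$, $\lambda_n(n-k_n^2)\to0$. $BV^\ell(0,1)$: functions $u$ of bounded variation with $u(0-)=0$ and $u(1+)=\ell$ (jumps at $0$ and $1$ are allowed); $D^su$ is the singular part of $Du$ with respect to Lebesgue measure. *)

(* Defs.v *)
From mathcomp Require Import all_boot all_order all_algebra.
From mathcomp Require Import all_classical all_reals all_analysis.
Import Order.TTheory GRing.Theory Num.Theory numFieldNormedType.Exports.

Set Implicit Arguments.
Unset Strict Implicit.
Unset Printing Implicit Defensive.

Local Open Scope ring_scope.
Local Open Scope classical_set_scope.

Section Defs.
Variable R : realType.
Notation leb := (@lebesgue_measure R).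

Definition edom (J : R -> \bar R) : set R := [set z | (J z < +oo)%E].

(* convexity of an extended-real valued function on R (0 * (+oo) = 0) *)
Definition econvex (g : R -> \bar R) : Prop :=
  forall x y t : R, 0 <= t <= 1 ->
    (g (t * x + (1 - t) * y)%R <= t%:E * g x + (1 - t)%R%:E * g y)%E.

Definition estrictly_convex_on (S : set R) (g : R -> \bar R) : Prop :=
  forall x y t : R, S x -> S y -> x != y -> 0 < t < 1 ->
    (g (t * x + (1 - t) * y)%R < t%:E * g x + (1 - t)%R%:E * g y)%E.

Definition deriv_within (D : set R) (f : R -> R) (x d : R) : Prop :=
  (fun y => (f y - f x) / (y - x)) @ within D x^' --> d.

Definition C1_on (D : set R) (f : R -> R) : Prop :=
  exists f' : R -> R, (forall x, D x -> deriv_within D f x (f' x)) /\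
    {within D, continuous f'}.

Definition C1a_on (alpha : R) (D : set R) (f : R -> R) : Prop :=
  exists f' : R -> R, (forall x, D x -> deriv_within D f x (f' x)) /\
    forall x, D x -> exists e C : R, 0 < e /\
      forall y z, D y -> D z -> `|y - x| < e -> `|z - x| < e ->
        `|f' y - f' z| <= C * (`|y - z| `^ alpha).

Definition J0 (J1 J2 : R -> \bar R) (z : R) : \bar R :=
  (J2 z + (2^-1)%:E *
     ereal_inf [set (J1 p.1 + J1 p.2)%E | p in [set p : R * R | (p.1 + p.2 = 2 * z)%R]])%E.

Definition lsc_convex_envelope (J : R -> \bar R) (z : R) : \bar R :=
  ereal_sup [set g z | g in [set g : R -> \bar R |
     (forall y, -oo < g y)%E /\ econvex g /\ lower_semicontinuous g /\
     (forall y, g y <= J y)%E]].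

Definition J0ss (J1 J2 : R -> \bar R) := lsc_convex_envelope (J0 J1 J2).

Definition LJ1 (J1 J2 : R -> \bar R) : Prop :=
  ~ exists z, J0 J1 J2 z = J0ss J1 J2 z /\
     exists e a b : R, 0 < e /\ forall y, `|y - z| < e -> J0 J1 J2 y = (a * y + b)%:E.

Definition LJ2 (J1 J2 : R -> \bar R) : Prop :=
  forall z, (J0 J1 J2 z < +oo)%E -> J0 J1 J2 z = J0ss J1 J2 z ->
    exists! p : R * R, p.1 + p.2 = 2 * z /\
      J0 J1 J2 z = (J2 z + (2^-1)%:E * (J1 p.1 + J1 p.2))%E.

Definition LJ3 (J1 J2 : R -> \bar R) : Prop :=
  (exists alpha : R, 0 < alpha <= 1 /\
     C1a_on alpha (edom J1) (fine \o J1) /\ C1a_on alpha (edom J2) (fine \o J2)) /\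
  C1_on (edom (J0 J1 J2)) (fine \o J0 J1 J2) /\
  edom J1 = edom J2 /\ `]0, +oo[ `<=` edom J1 /\
  J1 z @[z --> +oo] --> 0%E /\ J2 z @[z --> +oo] --> 0%E /\
  exists L : R, J0 J1 J2 z @[z --> +oo] --> L%:E.

Definition argmin_is (J : R -> \bar R) (d : R) : Prop :=
  forall z, (forall y, (J z <= J y)%E) <-> z = d.

Definition LJ4 (J1 J2 : R -> \bar R) : Prop :=
  (exists (Psi : R -> \bar R) (c1 c2 : R),
     (forall z, (0 <= Psi z)%E) /\ econvex Psi /\
     (forall M : R, \forall z \near -oo, ((M * `|z|)%R%:E <= Psi z)%E) /\
     0 < c1 /\ 0 < c2 /\
     forall z, (c1%:E * (Psi z - 1%E) <= J1 z)%E /\ (J1 z <= c2%:E * maxe (Psi z) `|z|%:E)%E /\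
               (c1%:E * (Psi z - 1%E) <= J2 z)%E /\ (J2 z <= c2%:E * maxe (Psi z) `|z|%:E)%E) /\
  (exists d1 d2 g : R, 0 < d1 /\ 0 < d2 /\ 0 < g /\
     argmin_is J1 d1 /\ argmin_is J2 d2 /\ argmin_is (J0 J1 J2) g /\
     estrictly_convex_on (`]-oo, d1[ `&` edom J1) J1 /\
     estrictly_convex_on (`]-oo, d2[ `&` edom J2) J2 /\
     (exists L : R, J0 J1 J2 z @[z --> +oo] --> L%:E /\ (J0 J1 J2 g < L%:E)%E) /\
     forall z, z <= g -> J0 J1 J2 z = J0ss J1 J2 z).

Definition lam (n : nat) : R := n%:R^-1.

(* u is continuous on [0,1] and affine on each (t_i lam_n, t_{i+1} lam_n),
   i < r : written out as the affine interpolation of the nodal values *)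
Definition in_A_T (n r : nat) (t : nat -> nat) (u : R -> R) : Prop :=
  forall i, (i < r)%N -> forall x : R,
    (t i)%:R * lam n <= x <= (t i.+1)%:R * lam n ->
    u x = u ((t i)%:R * lam n) +
          (x - (t i)%:R * lam n) / (((t i.+1)%:R - (t i)%:R) * lam n) *
          (u ((t i.+1)%:R * lam n) - u ((t i)%:R * lam n)).

Definition BC (n : nat) (l u0 u1 : R) (u : R -> R) : Prop :=
  u 0 = 0 /\ u (lam n) = lam n * u0 /\
  u ((n.-1)%:R * lam n) = l - lam n * u1 /\ u (n%:R * lam n) = l.

Definition QCenergy (J1 J2 : R -> \bar R) (n k1 k2 : nat) (u : R -> R) : \bar R :=
  let U i := u (i%:R * lam n) in
  (\sum_(0 <= i < n) ((lam n)%:E * J1 ((U i.+1 - U i) / lam n)%R)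
   + \sum_(0 <= i < k1) ((lam n)%:E * J2 ((U i.+2 - U i) / (2 * lam n))%R)
   + \sum_(k1 <= i < k2.-1)
       ((lam n / 2)%R%:E * (J2 ((U i.+1 - U i) / lam n)%R + J2 ((U i.+2 - U i.+1) / lam n)%R))
   + \sum_(k2.-1 <= i < n.-1) ((lam n)%:E * J2 ((U i.+2 - U i) / (2 * lam n))%R))%E.

(* \hat H_n^{l,k_n,T_n}, as a functional on (representatives of) L^1(0,1):
   finite only if u agrees a.e. on (0,1) with some v in A_{T_n}(0,1)
   satisfying (BC), in which case it is the energy of that (unique) v. *)
Definition Hhat (J1 J2 : R -> \bar R) (l u0 u1 : R) (n k1 k2 r : nat) (t : nat -> nat)
    (u : R -> R) : \bar R :=
  ereal_inf [set QCenergy J1 J2 n k1 k2 v | v in [set v : R -> R |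
     in_A_T n r t v /\ BC n l u0 u1 v /\
     {ae leb, forall x, `]0, 1[ x -> v x = u x}]].

(* u in BV^l(0,1) with D^s u >= 0, and g is (a representative of) u',
   the density of the absolutely continuous part of Du.  Written out:
   the extension w of (a representative of) u by 0 on (-oo,0) and by l on
   (1,+oo) satisfies w(x) = m(x) + int_{[0,1] cap (-oo,x]} g, with g in
   L^1(0,1) and m nondecreasing with m' = 0 a.e. (so that Dw = g dx + Dm,
   Dm >= 0 singular, i.e. D^a u = g dx and D^s u = Dm >= 0, jumps at 0 and 1
   included). *)
Definition BVl_Dsnonneg (l : R) (u g : R -> R) : Prop :=
  leb.-integrable `[0, 1] (EFin \o g) /\
  exists w m : R -> R,
    {ae leb, forall x, `]0, 1[ x -> w x = u x} /\
    (forall x, x < 0 -> w x = 0) /\ (forall x, 1 < x -> w x = l) /\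
    {homo m : x y / x <= y} /\
    {ae leb, forall x, deriv_within setT m x 0} /\
    (forall x, w x = m x + Rintegral leb (`[0, 1] `&` `]-oo, x]) g).

Definition Hlim (J1 J2 : R -> \bar R) (l : R) (u : R -> R) : \bar R :=
  ereal_inf [set (\int[leb]_(x in `[0%R, 1%R]) J0ss J1 J2 (g x))%E |
             g in [set g : R -> R | BVl_Dsnonneg l u g]].

(* Gamma-convergence in the strong L^1(0,1) topology (sequential form;   *)
(* L^1 is metric).                                                     *)

Definition L1 (u : R -> R) : Prop := leb.-integrable `[0, 1] (EFin \o u).

Definition L1_cvg (us : nat -> R -> R) (u : R -> R) : Prop :=
  (fun n => \int[leb]_(x in `[0%R, 1%R]) (`|us n x - u x|)%R%:E)%E @ \oo --> 0%E.

Definition Gamma_L1 (F : nat -> (R -> R) -> \bar R) (H : (R -> R) -> \bar R) : Prop :=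
  (forall (u : R -> R) (us : nat -> R -> R), L1 u -> (forall n, L1 (us n)) ->
     L1_cvg us u -> (H u <= limn_einf (fun n => F n (us n)))%E) /\
  (forall u : R -> R, L1 u -> exists us : nat -> R -> R,
     (forall n, L1 (us n)) /\ L1_cvg us u /\
     (limn_esup (fun n => F n (us n)) <= H u)%E).

(* Assumption (K); the bound 0 < k1 < k2 < n - 2 is required for all
   large n (it is impossible for n < 5) *)
Definition condK (k1 k2 : nat -> nat) : Prop :=
  (\forall n \near \oo, (0 < k1 n)%N /\ (k1 n < k2 n)%N /\ (k2 n < n - 2)%N) /\
  (forall M : nat, \forall n \near \oo, (M <= k1 n)%N) /\
  (forall M : nat, \forall n \near \oo, (M <= n - k2 n)%N) /\
  (fun n => lam n * (k1 n)%:R) @ \oo --> (0 : R) /\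
  (fun n => lam n * (n - k2 n)%:R) @ \oo --> (0 : R).

Definition atoms (r : nat -> nat) (t : nat -> nat -> nat) : Prop :=
  forall n, t n 0 = 0%N /\ t n (r n) = n /\ forall i, (i < r n)%N -> (t n i < t n i.+1)%N.

End Defs.

(* Main.v *)
(* Shifting the potentials by a constant makes them nonnegative without affecting the limit
   beyond an additive constant. By [LJ2] and the symmetry of the infimum in [J0], the effective
   potential is [J1 + J2] to the left of [gamma], and it is constant to the right of [gamma].

   Lower bound: dropping nonnegative terms, a function of energy at most [B] satisfies
   [sum lam * J0ss (slope) <= B] over the local region, which exhausts [0, 1] in the limit.
   The negative parts of the slopes are equi-integrable by superlinear growth, so the limit is
   the difference of a nondecreasing function and of an absolutely continuous one; almost every
   point is a point of differentiability, the difference quotients are limits of averages of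
   slopes, and Jensen's inequality followed by Fatou's lemma gives the bound.

   Upper bound: on [K] equal intervals replace the limit by an affine function whose slope is
   the mean of the density cut at [gamma], and put the rest of the increment into nonnegative
   jumps at the left ends; by Jensen's inequality the energy does not increase. Interpolating
   this function on the mesh of representative atoms produces large positive slopes at the
   jumps, where both potentials stay bounded, on a set of vanishing length. *)

Require Import Defs.
From HB Require Import structures.
From mathcomp Require Import all_boot all_order all_algebra.
From mathcomp Require Import all_classical all_reals all_analysis.
From mathcomp Require Import measurable_realfun ring lra.
Import Order.TTheory GRing.Theory Num.Theory numFieldNormedType.Exports.
Local Open Scope classical_set_scope.
Local Open Scope ring_scope.

Set Implicit Arguments.
Unset Strict Implicit.
Unset Printing Implicit Defensive.

(** * Primitives on the unit interval *)

Section differentiation.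
Context {R : realType}.
Implicit Types (f g h : R -> R) (x y d : R).
Local Notation leb := (@lebesgue_measure R).

(** The target class asks for an explicit splitting of the limit into an integrable density and a
    nondecreasing function with derivative zero almost everywhere, so both parts have to be
    constructed. Limits are taken along a single ultrafilter, which makes the approximants converge
    at every point at once. The accumulated negative slopes are cut into layers of height one: each
    layer is 1-Lipschitz, remains so in the limit and has a density by Radon-Nikodym, and
    equi-integrability makes the layers add up to the whole. The accumulated positive slopes
    converge to a merely monotone function. Its differentiability is reduced to the Lipschitz case:
    adding the identity makes it expand distances, so it has a Lipschitz left inverse, and this
    inverse maps the points where it has no positive derivative to a null set. In the upper bound
    the obstacle is the pair of prescribed slopes [u0], [u1] at the ends, where the limit may leave
    no room for them; mixing in a profile of smaller total increment frees some room at both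
    ends. *)

Lemma ae_imply (P Q : R -> Prop) : {ae leb, forall x, P x} ->
  (forall x, P x -> Q x) -> {ae leb, forall x, Q x}.
Proof.
by move=> aeP PQ; apply: filterS aeP => //; exact: (ae_filter_ringOfSetsType leb).
Qed.

Lemma ae_imply2 (P Q S : R -> Prop) : {ae leb, forall x, P x} ->
  {ae leb, forall x, Q x} -> (forall x, P x -> Q x -> S x) ->
  {ae leb, forall x, S x}.
Proof.
move=> aeP aeQ PQ; apply: filterS2 aeP aeQ => //.
exact: (ae_filter_ringOfSetsType leb).
Qed.

(** Differentiability at [x] with derivative [d], multiplied out: the case [y = x] is harmless and
    no quotient has to be tracked. *)
Definition ediff f x d := forall e : R, 0 < e ->
  exists2 del : R, 0 < del & forall y, `|y - x| < del ->
    `|f y - f x - d * (y - x)| <= e * `|y - x|.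

Lemma ediffB f g x d d' : ediff f x d -> ediff g x d' ->
  ediff (fun y => f y - g y) x (d - d').
Proof.
move=> df dg e e0.
have e20 : 0 < e / 2 by rewrite divr_gt0.
have [a a0 Ha] := df _ e20; have [b b0 Hb] := dg _ e20.
exists (Num.min a b); first by rewrite lt_min a0.
move=> y; rewrite lt_min => /andP[/Ha{}Ha /Hb{}Hb].
have -> : f y - g y - (f x - g x) - (d - d') * (y - x) =
  (f y - f x - d * (y - x)) - (g y - g x - d' * (y - x)) by ring.
rewrite (le_trans (ler_normB _ _))// (le_trans (lerD Ha Hb))//.
by rewrite -mulrDl -splitr.
Qed.

Lemma ediff_near_cst f x e : 0 < e -> (forall y, `|y - x| < e -> f y = f x) ->
  ediff f x 0.
Proof.
move=> e0 fx e' e'0; exists e => // y /fx ->.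
by rewrite subrr mul0r subr0 normr0 mulr_ge0// ltW.
Qed.

Lemma ediff_deriv_within f x d : ediff f x d -> deriv_within setT f x d.
Proof.
move=> df; apply/cvgrPdist_le => e e0.
have [a a0 Ha] := df _ e0.
exists a => // y; rewrite /ball/= distrC => ya yx _.
have yx0 : y - x != 0 by rewrite subr_eq0.
rewrite distrC -(ler_pM2r (x := `|y - x|)) ?normr_gt0//.
by rewrite -normrM mulrBl mulfVK//; apply: Ha.
Qed.

Lemma derivable_ediff f x : derivable f x 1 -> ediff f x (derive1 f x).
Proof.
move=> df e e0.
have : h^-1 *: (f (h + x) - f x) @[h --> 0^'] --> derive1 f x.
  by rewrite derive1E; have := df; rewrite /derive /derivable /=;
    under eq_fun do rewrite [X in f (X + _)](mulr1).
move/cvgrPdist_le => /(_ _ e0)[/= a a0 Ha].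
exists a => // y yx; have [->|yx0] := eqVneq y x.
  by rewrite !subrr normr0 !mulr0 subrr normr0.
have yx0' : y - x != 0 by rewrite subr_eq0.
have := Ha (y - x); rewrite /= sub0r normrN => /(_ yx yx0').
rewrite subrK distrC => H.
rewrite -(ler_pM2r (x := `|y - x|)) ?normr_gt0// -normrM in H.
by rewrite -[_ *: _]/(_ * _) mulrBl mulrAC mulVf// mul1r in H.
Qed.

(** Has the shape required by [BVl_Dsnonneg]: zero on the left of 0 and constant on the right of 1,
    with no integrability asked of [h] outside the unit interval. *)
Definition prim h x : R := Rintegral leb (`[0, 1] `&` `]-oo, x]) h.

Lemma prim_patch h x : prim h x = Rintegral leb `]-oo, x] (h \_ `[0, 1]).
Proof. by rewrite /prim -Rintegral_mkcondl setIC. Qed.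

Lemma integrable01_patch h : leb.-integrable `[0, 1] (EFin \o h) ->
  leb.-integrable setT (EFin \o (h \_ `[0, 1])).
Proof. by rewrite integrable_mkcond//= restrict_EFin. Qed.

Lemma prim_ediff h : leb.-integrable `[0, 1] (EFin \o h) ->
  {ae leb, forall x, ediff (prim h) x ((h \_ `[0, 1]) x)}.
Proof.
move=> ih.
have H1 y : leb.-integrable `]-oo, y] (EFin \o (h \_ `[0, 1])).
  by apply: integrableS (integrable01_patch ih).
have H2 := integrable_locally (@measurable_itv R _) ih.
have := FTC1Ny H1 H2.
apply: filterS; first exact: (ae_filter_ringOfSetsType leb).
move=> x [/derivable_ediff + e]; rewrite e.
by congr ediff; apply/funext => y; rewrite prim_patch.
Qed.

Lemma primB h x y : x <= y -> leb.-integrable `[0, 1] (EFin \o h) ->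
  prim h y - prim h x = Rintegral leb (`[0, 1] `&` `]x, y]) h.
Proof.
move=> xy ih; rewrite !prim_patch Rintegral_itvB//.
- by rewrite -Rintegral_mkcondl setIC.
- by apply: integrableS (integrable01_patch ih).
Qed.

Lemma prim_homo h : leb.-integrable `[0, 1] (EFin \o h) ->
  (forall x, 0 <= h x) -> {homo prim h : x y / x <= y}.
Proof.
move=> ih h0 x y xy; rewrite -subr_ge0 primB//.
by apply: Rintegral_ge0 => *; exact: h0.
Qed.

Lemma prim_le0 h x : x <= 0 -> prim h x = 0.
Proof.
move=> x0; rewrite /prim.
(* The domain is empty for [x < 0] and the point 0 for [x = 0]; both cases are read as one integral
   over a null singleton. *)
apply: (@eq_trans _ _ (Rintegral leb [set 0] (fun t => h t * (x == 0)%:R))).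
  have [->|nx0] := eqVneq x 0.
    rewrite (_ : _ `&` _ = [set 0]).
      by apply: eq_Rintegral => t _; rewrite mulr1.
    apply/seteqP; split=> t /=; rewrite !in_itv/=.
      by move=> [/andP[t0 _] t0']; apply/eqP; rewrite eq_le t0' t0.
    by move=> ->; rewrite lexx ler01.
  rewrite (_ : _ `&` _ = set0) ?Rintegral_set0 ?Rintegral_set1//.
  rewrite -subset0 => t /=; rewrite !in_itv/= => -[/andP[t0 _] tx].
  by move/eqP: nx0; apply; apply/eqP; rewrite eq_le x0 (le_trans t0 tx).
exact: Rintegral_set1.
Qed.

Lemma prim_ge1 h x : 1 <= x -> prim h x = Rintegral leb `[0, 1] h.
Proof.
move=> x1; rewrite /prim; congr Rintegral.
apply/seteqP; split=> t /=; rewrite !in_itv/=; first by case.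
by move=> /andP[t0 t1]; rewrite t0 t1 (le_trans t1 x1).
Qed.

End differentiation.

(** * Lipschitz functions are primitives *)

Section lipschitz.
Context {R : realType}.
Implicit Types (f g h A : R -> R) (x y d : R).
Local Notation leb := (@lebesgue_measure R).

(** Projection onto the unit interval; [f x = f (clamp x)] expresses that [f] is constant on each
    side of it. *)
Definition clamp (x : R) : R := Num.max 0 (Num.min 1 x).

Variant clamp_spec x : R -> Type :=
  | ClampLe0 of x <= 0 : clamp_spec x 0
  | ClampId of 0 <= x & x <= 1 : clamp_spec x x
  | ClampGe1 of 1 <= x : clamp_spec x 1.

Lemma clampP x : clamp_spec x (clamp x).
Proof.
rewrite /clamp; case: (lerP 1 x) => x1.
  by rewrite maxEle ler01; constructor.
case: (lerP 0 x) => x0; first by apply: ClampId => //; exact: ltW.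
by apply: ClampLe0; exact: ltW.
Qed.

Lemma clamp_homo : {homo clamp : x y / x <= y}.
Proof. by move=> x y; case: (clampP x); case: (clampP y); lra. Qed.

Lemma clamp_le_sub x y : x <= y -> clamp y - clamp x <= y - x.
Proof. by case: (clampP x); case: (clampP y); lra. Qed.

(** The measure is an infimum over countable covers by half-open intervals, so a null set has covers
    of arbitrarily small total [f]-length. *)
Lemma stieltjes_null_cover (f : cumulative R R) (E : set R) (e : R) :
  lebesgue_stieltjes_measure f E = 0%E -> 0 < e ->
  exists I : nat -> set R, [/\ forall k, ocitv (I k), E `<=` \bigcup_k I k &
    (\sum_(k <oo) wlength f (I k) < e%:E)%E].
Proof.
move=> E0 e0.
have : (lebesgue_stieltjes_measure f E < e%:E)%E by rewrite E0 lte_fin.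
rewrite /lebesgue_stieltjes_measure /measure_extension.
move=> /ereal_inf_lt[_ [I [mI EI] <-] Ie].
by exists I; split.
Qed.

Lemma stieltjes_ocitv (f : cumulative R R) (a b : R) : a <= b ->
  lebesgue_stieltjes_measure f `]a, b] = (f b - f a)%:E.
Proof.
move=> ab; rewrite /lebesgue_stieltjes_measure /measure_extension.
by rewrite measurable_mu_extE/= ?wlength_itv_bnd//; exact: is_ocitv.
Qed.

(** Combines monotonicity, the Lipschitz bound [K] on the unit interval and constancy on both sides
    of it. *)
Definition clamp_lipschitz (K : R) (A : R -> R) := forall x y, x <= y ->
  A x <= A y <= A x + K * (clamp y - clamp x).

Lemma clamp_id x : 0 <= x <= 1 -> clamp x = x.
Proof. by move=> /andP[]; case: (clampP x); lra. Qed.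

Lemma clamp_le0 x : x <= 0 -> clamp x = 0.
Proof. by case: (clampP x); lra. Qed.

Lemma clamp_ge1 x : 1 <= x -> clamp x = 1.
Proof. by case: (clampP x); lra. Qed.

Lemma clamp_lipschitz_eq K A x y : clamp_lipschitz K A ->
  clamp x = clamp y -> A x = A y.
Proof.
move=> AK; wlog xy : x y / x <= y.
  move=> H; have [/H//|/ltW /H{}H e] := leP x y.
  by apply/esym/H.
move=> e; have := AK _ _ xy; rewrite e subrr mulr0 addr0 => h.
by apply/eqP; rewrite eq_le.
Qed.

Lemma clamp_lipschitz_cumulative K A : clamp_lipschitz K A -> 0 <= K ->
  exists f : cumulative R R, f = A :> (R -> R).
Proof.
move=> AK K0.
have nd : {homo A : x y / x <= y} by move=> x y /AK /andP[].
have rc : right_continuous A.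
  move=> x; apply/cvgrPdist_le => e e0.
  have K1 : 0 < K + 1 by rewrite ltr_wpDl.
  near=> y.
  have xy : x <= y by [].
  have /andP[h1 h2] := AK _ _ xy.
  rewrite ler0_norm ?subr_le0// opprB lerBlDl (le_trans h2)// lerD2l.
  have cl : clamp y - clamp x <= y - x.
    exact: clamp_le_sub.
  have ye : y - x <= e / (K + 1).
    rewrite lerBlDl; near: y; apply: nbhs_right_le.
    by rewrite ltrDl divr_gt0.
  rewrite (le_trans (ler_wpM2l K0 cl))//.
  have : 0 <= y - x by rewrite subr_ge0.
  move: ye; rewrite ler_pdivlMr//; nra.
by exists (HB.pack_for (cumulative R R) A (isCumulative.Build R _ R A nd rc)).
Unshelve. all: by end_near. Qed.

(* Radon-Nikodym for the Stieltjes measure of [A], which is absolutely continuous. *)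
Lemma clamp_lipschitz_density K A : clamp_lipschitz K A -> 0 <= K ->
  exists h : R -> R, [/\ measurable_fun setT h, (forall x, 0 <= h x),
    leb.-integrable setT (EFin \o h),
    (forall x, A x - A 0 = prim h x) &
    forall E : set R, measurable E -> E `<=` `[0, 1]%classic ->
      (\int[leb]_(x in E) (h x)%:E = 0)%E -> leb.-negligible (A @` E)].
Proof.
move=> AK K0; have [f fA] := clamp_lipschitz_cumulative AK K0.
have nd : {homo A : x y / x <= y} by move=> x y /AK /andP[].
pose mf : {measure set (measurableTypeR R) -> \bar R} :=
  lebesgue_stieltjes_measure f.
have mfI (a b : R) : a <= b -> mf `]a, b]%classic = (A b - A a)%:E.
  by move=> ab; rewrite /mf/= stieltjes_ocitv// fA.
(* The window starts at -1 because a half-open interval omits its left end: the whole unit interval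
   is inside, and [A] does not grow between -1 and 0. *)
pose D : set (measurableTypeR R) := `](-1 : R), (1 : R)]%classic.
have mD : measurable D by exact: measurable_itv.
have DE t : D t = (-1 < t <= 1) by rewrite /D/= in_itv.
have Doo : (mf D < +oo)%E by rewrite mfI ?ltry// (le_trans (lerN10 _)).
pose nu : {finite_measure set (measurableTypeR R) -> \bar R} := mfrestr mD Doo.
have dom : nu `<< leb.
  apply/null_content_dominatesP => E mE E0.
  apply/eqP; rewrite -measure_le0; apply/lee_addgt0Pr => e e0; rewrite add0e.
  have K1 : 0 < K + 1 by rewrite ltr_wpDl.
  (* Lebesgue measure is the Stieltjes measure of the identity, so the cover lemma applies to [E0].
     Dividing by [K + 1] rather than [K] allows [K = 0]. *)
  have [I [oI EI Ie]] := stieltjes_null_cover E0 (divr_gt0 e0 K1).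
  have mI k : measurable (I k : set (measurableTypeR R)).
    by apply: sub_sigma_algebra; exact: oI.
  have le1 k : (mf (I k) <= (K + 1)%:E * wlength idfun (I k))%E.
    have /ocitvP[->|[[a b] /= /ltW ab ->]] := oI k.
      by rewrite measure0 wlength0 mule0.
    rewrite mfI// wlength_itv_bnd//= -EFinM lee_fin.
    have /andP[_ h] := AK _ _ ab; have h2 := clamp_le_sub ab.
    have : 0 <= clamp b - clamp a by rewrite subr_ge0 clamp_homo.
    by move: h h2 K0; set c := clamp b - clamp a; nra.
  rewrite (@le_trans _ _ (mf E))//.
    by rewrite /nu /mfrestr /mrestr; apply: le_measure; rewrite ?inE//; exact: measurableI.
  rewrite (le_trans (measure_sigma_subadditive mf mI mE EI))//.
  rewrite (le_trans (lee_nneseries _ (fun k _ => le1 k)))//.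
  rewrite nneseriesZl//.
  by rewrite -lee_pdivlMl// -EFinM [(_^-1 * _)%R]mulrC ltW.
have [h0 [h0_ge0 h0_fin ih0 h0E]] := radon_nikodym_sigma_finite dom.
have hE x : (fine (h0 x))%:E = h0 x by rewrite fineK.
exists (fine \o h0); split => //.
- apply/measurable_EFinP; have := measurable_int _ ih0.
  by apply: eq_measurable_fun => x _; rewrite /= hE.
- by move=> x /=; rewrite fine_ge0.
- by apply: eq_integrable ih0 => // x _; rewrite /= hE.
- move=> x; rewrite /prim /Rintegral/=.
  under eq_integral do rewrite hE.
  rewrite -h0E; last exact: measurableI.
  have [x0|x0] := ltP x 0.
    rewrite (_ : _ `&` _ = set0) ?measure0/=.
      apply/eqP; rewrite subr_eq0; apply/eqP.
      by apply: (clamp_lipschitz_eq AK); rewrite !clamp_le0// ltW.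
    by rewrite -subset0 => t /=; rewrite !in_itv/=; lra.
  pose c := Num.min x 1.
  have c0 : 0 <= c by rewrite le_min x0 ler01.
  have cE : A c = A x.
    rewrite /c; case: (lerP x 1) => // /ltW x1.
    by apply: (clamp_lipschitz_eq AK); rewrite !clamp_ge1.
  have A1 : A (-1) = A 0.
    by apply: (clamp_lipschitz_eq AK); rewrite !clamp_le0// lerN10.
  apply: EFin_inj; rewrite fineK; last by rewrite fin_num_measure//; exact: measurableI.
  apply/eqP; rewrite eq_le; apply/andP; split.
    rewrite -cE -mfI// /nu/= /mfrestr/mrestr le_measure// ?inE//.
      by apply: measurableI => //; exact: measurableI.
    move=> t /=; rewrite !in_itv/= le_min => /andP[t0 /andP[tx t1]].
    by rewrite tx t1 (ltW t0) DE t1 (lt_trans _ t0)// ltrN10.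
  rewrite -cE -A1 -mfI; last by rewrite (le_trans _ c0)// lerN10.
  rewrite /nu/= /mfrestr/mrestr le_measure// ?inE//.
    by apply: measurableI => //; exact: measurableI.
  move=> t /=; rewrite !in_itv/= le_min => -[[/andP[t0 t1] tx] _].
  by rewrite tx t1 (lt_le_trans _ t0)// ltrN10.
- move=> E mE E01 Eh0.
  have fE0 : mf E = 0%E.
    move: Eh0; under eq_integral do rewrite /= hE.
    rewrite -h0E// /nu/= /mfrestr/mrestr (_ : E `&` _ = E)//.
    apply/setIidPl => t /E01/=; rewrite DE !in_itv/= => /andP[t0 ->].
    by rewrite (lt_le_trans _ t0)// ltrN10.
  (* The monotone [A] sends an interval into one whose length is its [f]-length, so a cover of [E]
     of small [f]-length gives a cover of the image of small measure. *)
  have Aneg e : 0 < e -> exists2 B : set R, measurable B /\ A @` E `<=` B &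
      (leb B <= e%:E)%E.
    move=> e0; have [I [oI EI Ie]] := stieltjes_null_cover fE0 e0.
    have /choice[J JP] : forall k, exists J : set R, [/\ measurable J,
        A @` (I k) `<=` J & (leb J <= wlength f (I k))%E].
      move=> k; have /ocitvP[->|[[a b] /= /ltW ab ->]] := oI k.
        exists set0; split; [exact: measurable0|by rewrite image_set0|].
        by rewrite measure0 wlength0.
      exists `[A a, A b]%classic; split => //.
        move=> _ [t /= + <-]; rewrite !in_itv/= => /andP[at_ tb].
        by rewrite !nd// ltW.
      by rewrite lebesgue_measure_itv/= lte_fin wlength_itv_bnd// fA;
        case: ifPn => // _; rewrite lee_fin subr_ge0 nd.
    exists (\bigcup_k J k).
      split; first by apply: bigcup_measurable => k _; case: (JP k).
      move=> _ [t Et <-]; have [k _ Ikt] := EI _ Et.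
      by exists k => //; case: (JP k) => _ + _; apply; exists t.
    rewrite (le_trans _ (ltW Ie))//.
    have mJ k : measurable (J k) by case: (JP k).
    have mUJ : measurable (\bigcup_k J k) by exact: bigcupT_measurable.
    rewrite (le_trans (measure_sigma_subadditive leb mJ mUJ (@subset_refl _ _)))//.
    by apply: lee_nneseries => // k _; case: (JP k).
  have /choice[B BP] : forall k : nat, exists B : set R, [/\ measurable B,
      A @` E `<=` B & (leb B <= (k.+1%:R^-1)%:E)%E].
    move=> k; have [|B [mB EB] Bk] := Aneg k.+1%:R^-1; first by rewrite invr_gt0.
    by exists B.
  exists (\bigcap_k B k); split.
  - by apply: bigcapT_measurable => k; case: (BP k).
  - apply/eqP; rewrite -measure_le0; apply/lee_addgt0Pr => e e0; rewrite add0e.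
    have [k ke] : exists k : nat, k.+1%:R^-1 <= e.
      have [k _ /(_ k (leqnn k)) ke] := near_infty_natSinv_lt (PosNum e0).
      by exists k; exact: ltW.
    have [mB _ Bk] := BP k.
    rewrite (@le_trans _ _ (leb (B k)))//.
      rewrite le_measure ?inE//; last by move=> t; exact.
      by apply: bigcapT_measurable => j; case: (BP j).
    by rewrite (le_trans Bk)// lee_fin.
  - by move=> t AEt k _; case: (BP k) => _ + _; apply.
Qed.
End lipschitz.

(** * Densities of limits of Lipschitz layers *)

Section series.
Context {R : realType}.
Implicit Types (f g h A : R -> R) (x y d : R).
Local Notation leb := (@lebesgue_measure R).

Lemma primE h x : leb.-integrable `[0, 1] (EFin \o h) ->
  (prim h x)%:E = (\int[leb]_(t in `[0%R, 1%R] `&` `]-oo, x]) (h t)%:E)%E.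
Proof.
move=> ih; rewrite /prim /Rintegral fineK//.
apply: integrable_fin_num; first exact: measurableI.
by apply: integrableS ih => //; exact: measurableI.
Qed.

(** Every layer [A k.+1 - A k] has a nonnegative density, and by monotone convergence the sum of
    these densities integrates to the telescoping limit [Q x - Q 0]. Where the sum is infinite, on a
    null set, [fine] replaces it by 0. *)
Lemma series_density (Q : R -> R) (A : nat -> R -> R) (K : nat -> R) :
  (forall k, 0 <= K k) -> (forall x, A 0%N x = 0) ->
  (forall k, clamp_lipschitz (K k) (fun x => A k.+1 x - A k x)) ->
  (forall x, A k x @[k --> \oo] --> Q x) ->
  exists h : R -> R, [/\ measurable_fun setT h, (forall x, 0 <= h x),
    leb.-integrable `[0, 1] (EFin \o h) &
    (forall x, Q x - Q 0 = prim h x)].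
Proof.
move=> K0 A0 AK AQ.
have /choice[h hP] := fun k => clamp_lipschitz_density (AK k) (K0 k).
have mh k : measurable_fun setT (h k) by case: (hP k).
have h0 k x : 0 <= h k x by case: (hP k).
have ih k : leb.-integrable `[0, 1] (EFin \o h k).
  by case: (hP k) => _ _ + _ _; exact: integrableS.
have primh k x : prim (h k) x = (A k.+1 x - A k x) - (A k.+1 0 - A k 0).
  by case: (hP k).
have mhS D k : measurable_fun D (EFin \o h k).
  by apply/measurable_EFinP; exact: measurable_funS (mh k).
pose S x : set R := `[0, 1] `&` `]-oo, x].
have mS x : measurable (S x) by exact: measurableI.
pose H (x : R) : \bar R := (\sum_(k <oo) (h k x)%:E)%E.
have H0 x : (0 <= H x)%E by apply: nneseries_ge0 => k _ _; rewrite lee_fin.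
have mH D : measurable_fun D H.
  apply: measurable_funTS.
  apply: ge0_emeasurable_sum => [k x _ _|k _]; first by rewrite lee_fin.
  exact/measurable_EFinP.
have intH x : (\int[leb]_(t in S x) H t = (Q x - Q 0)%:E)%E.
  rewrite integral_nneseries; [|exact: mS|exact: mhS|]; last first.
    by move=> k t _; rewrite lee_fin.
  under eq_eseriesr do rewrite -primE//.
  apply: cvg_lim => //.
  have -> : (fun n => \sum_(0 <= k < n) (prim (h k) x)%:E)%E =
      (fun n => (A n x - A n 0)%:E).
    apply/funext; elim=> [|n IH]; first by rewrite big_nil !A0 subrr.
    by rewrite big_nat_recr//= IH primh -EFinD; congr EFin; ring.
  apply: cvg_EFin; first by apply: nearW.
  by apply: cvgB; exact: AQ.
have S01 : S 1 = `[0, 1]%classic.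
  apply/seteqP; split=> t /=; rewrite /S/= !in_itv/=; first by case.
  by move=> /andP[t0 t1]; rewrite t0 t1.
have iH : leb.-integrable `[0, 1] H.
  apply/integrableP; split; first exact: mH.
  under eq_integral do rewrite gee0_abs//.
  by rewrite -S01 intH ltry.
have aeH : {ae leb, forall x, `[0, 1]%classic x -> H x \is a fin_num}.
  by apply: integrable_ae iH; exact: measurable_itv.
have mfH D : measurable_fun D (fine \o H) by apply: measurableT_comp.
have mfH2 D : measurable_fun D (EFin \o (fine \o H)).
  by apply/measurable_EFinP; exact: mfH.
have aeq : {ae leb, forall x, `[0, 1]%classic x -> H x = (fine (H x))%:E}.
  by apply: (ae_imply aeH) => x + x01 => /(_ x01) /fineK.
have ifH : leb.-integrable `[0, 1] (EFin \o (fine \o H)).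
  apply: le_integrable iH => //.
    by apply/measurable_EFinP; exact: mfH.
  move=> x _ /=; rewrite ger0_norm ?fine_ge0// gee0_abs//.
  by have := H0 x; case: (H x) => //= _; rewrite leey.
exists (fine \o H); split => //.
  by move=> x; rewrite /= fine_ge0.
move=> x; apply: EFin_inj; rewrite primE// -intH.
apply: ae_eq_integral; [exact: mS|exact: mH|exact: mfH2|].
by apply: (ae_imply aeq) => t Ht [/Ht].
Qed.

End series.

(** * Lower semicontinuity along difference quotients *)

Section step.
Context {R : realType}.
Implicit Types (f g h A : R -> R) (x y d : R).
Local Notation leb := (@lebesgue_measure R).

Lemma near_limn_esup_le (u : nat -> \bar R) (b : \bar R) :
  (\forall n \near \oo, (u n <= b)%E) -> (limn_esup u <= b)%E.
Proof.
move=> ub; apply: ge_ereal_inf.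
exists (ereal_sup (u @` [set n | (u n <= b)%E])).
  by exists [set n | (u n <= b)%E].
by apply: ge_ereal_sup => _ [n /= un <-].
Qed.

Lemma near_limn_einf_ge (u : nat -> \bar R) (b : \bar R) :
  (\forall n \near \oo, (b <= u n)%E) -> (b <= limn_einf u)%E.
Proof.
move=> ub; rewrite /limn_einf leeNr; apply: near_limn_esup_le.
by apply: filterS ub => n un; rewrite leeN2.
Qed.

Lemma lt_ereal_between (x y : \bar R) : (x < y)%E ->
  exists2 c : R, (x < c%:E)%E & (c%:E < y)%E.
Proof.
case: x => [x||] //; case: y => [y||] // xy.
- by exists ((x + y) / 2); rewrite lte_fin in xy; rewrite lte_fin; lra.
- by exists (x + 1); rewrite ?ltry// lte_fin ltrDl.
- by exists (y - 1); rewrite ?ltNyr// lte_fin gtrBl.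
- by exists 0; rewrite ?ltry ?ltNyr.
Qed.

Lemma ae_neq a : {ae leb, forall x, x != a}.
Proof.
exists [set a]; split; first exact: measurable_set1.
  exact: lebesgue_measure_set1.
by move=> x /= /negP; rewrite negbK => /eqP.
Qed.

(** The straddle lemma: the increment over [[z, y]] is split at [x], and the two errors
    [e * (y - x)] and [e * (x - z)] add up to [e] times the length. *)
Lemma ediff_quotient W x d e : ediff W x d -> 0 < e ->
  exists2 del : R, 0 < del & forall z y, z <= x -> x < y -> y - z < del ->
    `|(W y - W z) / (y - z) - d| <= e.
Proof.
move=> Wx e0; have [a a0 Ha] := Wx _ e0; exists a => // z y zx xy yza.
have yz0 : 0 < y - z by lra.
have Hy : `|W y - W x - d * (y - x)| <= e * (y - x).
  have yx : `|y - x| = y - x by rewrite ger0_norm; lra.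
  by have := Ha y; rewrite yx; apply; lra.
have Hz : `|W z - W x - d * (z - x)| <= e * (x - z).
  have zx' : `|z - x| = x - z by rewrite ler0_norm; lra.
  by have := Ha z; rewrite zx'; apply; lra.
have -> : (W y - W z) / (y - z) - d =
    ((W y - W x - d * (y - x)) - (W z - W x - d * (z - x))) / (y - z).
  by field; rewrite gt_eqF.
rewrite normrM [X in _ * X]gtr0_norm ?invr_gt0// ler_pdivrMr//.
by rewrite (le_trans (ler_normB _ _))//; lra.
Qed.

(** On each cell of length [del], [F n] is [phi] of the difference quotient of [W] over that cell.
    At a point of differentiability the quotients tend to [D x], so lower semicontinuity bounds
    [phi (D x)] by the lower limit, and Fatou's lemma applies. Out of [n.+3] cells the first and the
    last are left out of the sums, since near the ends of the unit interval the discrete energy is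
    not local and yields no such bound. *)
Lemma step_fatou (W D : R -> R) (phi : R -> \bar R) (a b B : R) : a < b ->
  measurable_fun setT D ->
  {ae leb, forall x, a < x < b -> ediff W x (D x)} ->
  lower_semicontinuous phi -> (forall z, (0 <= phi z)%E) ->
  (forall n : nat, let del := (b - a) / n.+3%:R in
     (\sum_(1 <= j < n.+2) (del%:E *
       phi ((W (a + j.+1%:R * del)%R - W (a + j%:R * del)%R) / del)%R)
     <= B%:E)%E) ->
  (\int[leb]_(x in `[a, b]) phi (D x) <= B%:E)%E.
Proof.
move=> ab mD aeW lphi phi0 sumB.
pose del n : R := (b - a) / n.+3%:R.
have del0 n : 0 < del n by rewrite divr_gt0// subr_gt0.
pose c n j := phi ((W (a + j.+1%:R * del n) - W (a + j%:R * del n)) / del n).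
pose I n j : set R := `[(a + j%:R * del n)%R, (a + j.+1%:R * del n)%R[%classic.
have c0 n j : (0 <= c n j)%E by exact: phi0.
pose F n x := (\sum_(1 <= j < n.+2) c n j * (\1_(I n j) x)%:E)%E.
have F0 n x : (0 <= F n x)%E.
  by apply: sume_ge0 => j _; rewrite mule_ge0// lee_fin.
have mI n j (E : set R) : measurable_fun E (fun x => (\1_(I n j) x)%:E : \bar R).
  by apply/measurable_EFinP; apply: measurable_indic; exact: measurable_itv.
have mcI n j (E : set R) : measurable_fun E (fun x => c n j * (\1_(I n j) x)%:E)%E.
  by apply: measurable_funeM; exact: mI.
have mF n (E : set R) : measurable_fun E (F n).
  by apply: emeasurable_sum => j; exact: mcI.
have IF n : (\int[leb]_(x in `[a, b]) F n x <= B%:E)%E.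
  rewrite ge0_integral_sum; [|exact: measurable_itv|by move=> j; exact: mcI|];
    last by move=> j x _; rewrite mule_ge0// lee_fin.
  apply: le_trans (sumB n); apply: lee_sum => j _.
  rewrite ge0_integralZl; [|exact: measurable_itv|exact: mI| |exact: c0];
    last by move=> x _; rewrite lee_fin.
  rewrite muleC -/(c n j); apply: lee_wpmul2r => //.
  rewrite integral_indic//; last exact: measurable_itv.
  rewrite (@le_trans _ _ (leb (I n j)))//.
    rewrite le_measure// ?inE//.
      by apply: measurableI; exact: measurable_itv.
    exact: measurable_itv.
  rewrite lebesgue_measure_itv/= lte_fin ltrD2l ltr_pM2r// ltr_nat ltnSn.
  rewrite -EFinB lee_fin -/(del n) -natr1; lra.
have key : {ae leb, forall x, `[a, b]%classic x ->
    (phi (D x) <= limn_einf (F^~ x))%E}.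
  have /ae_imply2 H := ae_neq a; have {}H := H _ _ (ae_neq b).
  apply: (ae_imply2 (H _ (fun x p q => conj p q)) aeW) => x [/eqP xa /eqP xb] Wx.
  rewrite /= in_itv/= => /andP[ax xb'].
  have {}ax : a < x by rewrite lt_neqAle ax andbT; apply/eqP => /esym.
  have {xb'}xb : x < b by rewrite lt_neqAle xb' andbT; apply/eqP.
  have {}Wx : ediff W x (D x) by apply: Wx; rewrite ax.
  rewrite leNgt; apply/negP => Lphi.
  have [r Fr rphi] := lt_ereal_between Lphi.
  suff : (r%:E <= limn_einf (F^~ x))%E by rewrite leNgt Fr.
  apply: near_limn_einf_ge.
  have [V /nbhs_ballP[e /= e0 eV] Vr] := lphi _ _ rphi.
  have [e' e'0 He'] := ediff_quotient Wx (divr_gt0 e0 (ltr0n _ 2)).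
  have del_cvg m : 0 < m -> \forall n \near \oo, del n < m.
    move=> m0; near=> n; rewrite /del ltr_pdivrMr// mulrC -ltr_pdivrMr//.
    rewrite (@lt_le_trans _ _ n%:R)//; last by rewrite ler_nat -addn3 leq_addr.
    by near: n; exact: nbhs_infty_gtr.
  near=> n.
  pose j := Num.truncn ((x - a) / del n).
  have /andP[j1 j2] : j%:R <= (x - a) / del n < j.+1%:R.
    by apply/truncn_itv/divr_ge0; [rewrite subr_ge0 ltW|exact: ltW].
  rewrite ler_pdivlMr// in j1; rewrite ltr_pdivrMr// in j2.
  have n0 : 0 < n.+3%:R :> R by rewrite ltr0n.
  have bE : b - a = n.+3%:R * del n by rewrite /del mulrC divfK// gt_eqF.
  (* An interior point eventually lies neither in the first nor in the last cell. *)
  have jn : (1 <= j < n.+2)%N.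
    have da : del n < x - a by near: n; apply: del_cvg; rewrite subr_gt0.
    have db : del n < b - x by near: n; apply: del_cvg; rewrite subr_gt0.
    have h1 : 0 < j%:R * del n by move: j2; rewrite -natr1; lra.
    have h2 : j.+1%:R * del n < n.+3%:R * del n.
      by rewrite -bE; move: j1; rewrite -(natr1 j); lra.
    rewrite ltr_pM2r// ltr_nat ltnS in h2; rewrite h2 andbT.
    by rewrite lt0n; apply/eqP => j0; rewrite j0 mul0r ltxx in h1.
  rewrite /F (bigD1_seq j); [|by rewrite mem_index_iota|exact: iota_uniq].
  have -> : \1_(I n j) x = 1 :> R.
    by rewrite indicE mem_set// /I/= in_itv/=; apply/andP; split; lra.
  rewrite mule1 -[leLHS]adde0; apply: leeD; last first.
    by apply: sume_ge0 => i _; rewrite mule_ge0// lee_fin.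
  apply/ltW/Vr/eV; rewrite /ball/= distrC.
  have djE : a + j.+1%:R * del n - (a + j%:R * del n) = del n.
    by rewrite -natr1; ring.
  have := He' (a + j%:R * del n) (a + j.+1%:R * del n).
  rewrite djE => H'; apply: (le_lt_trans (H' _ _ _)); try lra.
  by near: n; exact: del_cvg.
have mphi (E : set R) : measurable_fun E (phi \o D).
  apply: measurable_funTS; apply: measurableT_comp mD.
  exact: lower_semicontinuous_measurable.
have mL (E : set R) : measurable_fun E (fun x => limn_einf (F^~ x)).
  rewrite /limn_einf; apply: measurableT_comp => //.
  by apply: measurable_fun_limn_esup => n; exact: measurableT_comp.
have L0 x : (0 <= limn_einf (F^~ x))%E.
  by apply: near_limn_einf_ge; apply: nearW => n; exact: F0.
apply: (@le_trans _ _ (\int[leb]_(x in `[a, b]) limn_einf (F^~ x))%E).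
  by apply: ae_ge0_le_integral key; [exact: measurable_itv| |exact: mphi| |exact: mL] => x _.
apply: (@le_trans _ _ (limn_einf (fun n => \int[leb]_(x in `[a, b]) F n x)%E)).
  by apply: fatou; [exact: measurable_itv|move=> n; exact: mF|move=> n x _].
rewrite (le_trans (limn_einf_sup _))//.
by apply: near_limn_esup_le; apply: nearW.
Unshelve. all: by end_near. Qed.
End step.

(** * Differentiability of monotone functions *)

Section monotone.
Context {R : realType}.
Implicit Types (f g h A M : R -> R) (x y d : R).
Local Notation leb := (@lebesgue_measure R).

(* Near a point where the left inverse [G] of [F] has slope [c > 0], increments of [F] are
   controlled by those of [G]; in particular [F] does not jump there. *)
Lemma ediff_left_inverse (F G : R -> R) x c :
  {homo F : x y / x <= y} -> {homo G : x y / x <= y} ->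
  (forall y, 0 <= y <= 1 -> G (F y) = y) -> 0 < x < 1 ->
  0 < c -> ediff G (F x) c -> ediff F x c^-1.
Proof.
move=> Fnd Gnd GF /andP[x0 x1] c0 GFx e e0.
have GFxE : G (F x) = x by rewrite GF// !ltW.
have c20 : 0 < c / 2 by lra.
have [a a0 Ha] := GFx _ c20.
(* With [u] and [v] the increments of [F] and of the argument, the final error is [c^-1] times this
   constant times [|u|], and [|u| <= 2 / c * |v|]. *)
have e'0 : 0 < e * c ^+ 2 / 2 by rewrite divr_gt0// mulr_gt0// exprn_gt0.
have [b b0 Hb] := GFx _ e'0.
have [m [m0 ma mb]] : exists m : R, [/\ 0 < m, m <= a & m <= b].
  by exists (Num.min a b); rewrite lt_min a0 !ge_min !lexx orbT.
(* At distance [m / 2] from [F x] the function [G] has moved by at least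
   [(c - c / 2) * m / 2 = c * m / 4]; an increment of [F] of size [m] would thus force [|y - x|] to
   be at least this. *)
exists (Num.min (c * m / 4) (Num.min x (1 - x))).
  by rewrite !lt_min x0 subr_gt0 x1 divr_gt0// mulr_gt0.
move=> y; rewrite !lt_min => /and3P[y1 y2 y3].
have y01 : 0 <= y <= 1.
  move: y2 y3; rewrite !ltr_distl => /andP[? ?] /andP[? ?].
  by apply/andP; split; lra.
have GFy := GF _ y01.
have FyFx : `|F y - F x| < m.
  rewrite ltNge; apply/negP => mF.
  have [xy|yx] := leP x y.
    have Fxy := Fnd _ _ xy; rewrite ger0_norm ?subr_ge0// in mF.
    have E : F x + m / 2 - F x = m / 2 by ring.
    have := Ha (F x + m / 2); rewrite E gtr0_norm; last by lra.
    move=> /(_ ltac:(lra)); rewrite GFxE ler_norml => /andP[Hm _].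
    have HFm : F x + m / 2 <= F y by lra.
    have := Gnd _ _ HFm; rewrite GFy => HG.
    by move: y1; rewrite ger0_norm ?subr_ge0//; nra.
  have Fxy := Fnd _ _ (ltW yx); rewrite ler0_norm ?subr_le0// in mF.
  have E : F x - m / 2 - F x = - (m / 2) by ring.
  have := Ha (F x - m / 2); rewrite E normrN gtr0_norm; last by lra.
  move=> /(_ ltac:(lra)); rewrite GFxE ler_norml => /andP[_ Hm].
  have HFm : F y <= F x - m / 2 by lra.
  have := Gnd _ _ HFm; rewrite GFy => HG.
  by move: y1; rewrite ler0_norm ?subr_le0 ?ltW//; nra.
have {}Ha := Ha _ (lt_le_trans FyFx ma).
have {}Hb := Hb _ (lt_le_trans FyFx mb).
rewrite GFy GFxE in Ha Hb.
set u := F y - F x in FyFx Ha Hb *; set v := y - x in y1 Ha Hb *.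
have uv : `|u| <= 2 / c * `|v|.
  have : c * `|u| <= `|v| + c / 2 * `|u|.
    rewrite -{1}(gtr0_norm c0) -normrM -lerBlDl.
    apply: le_trans Ha; rewrite -(normrN (v - _)) opprB; exact: lerB_dist.
  move=> H; rewrite mulrAC ler_pdivlMr//; move: H; lra.
have -> : u - c^-1 * v = - c^-1 * (v - c * u) by field; rewrite gt_eqF.
rewrite normrM normrN [`|c^-1|]gtr0_norm ?invr_gt0//.
rewrite [c^-1 * _]mulrC ler_pdivrMr//; apply: (le_trans Hb).
apply: (@le_trans _ _ (e * c ^+ 2 / 2 * (2 / c * `|v|))).
  by rewrite ler_wpM2l// ltW.
by rewrite le_eqVlt; apply/orP; left; apply/eqP; field; rewrite gt_eqF.
Qed.

(** An upper limit along fixed increments is measurable and defined at every point, and it equals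
    the derivative where there is one. An infinite upper limit is sent to 0 by [fine]. *)
Definition slope M x : R :=
  fine (limn_esup (fun n => ((M (x + n.+1%:R^-1) - M x) * n.+1%:R)%:E)).

Lemma measurable_slope M : {homo M : x y / x <= y} -> measurable_fun setT (slope M).
Proof.
move=> Mnd; apply: measurableT_comp => //.
apply: measurable_fun_limn_esup => n; apply/measurable_EFinP.
apply: measurable_funM => //; apply: measurable_funB.
  by apply: nondecreasing_measurable => // x y xy; apply: Mnd; rewrite lerD2r.
exact: nondecreasing_measurable.
Qed.

Lemma slope_ge0 M x : {homo M : x y / x <= y} -> 0 <= slope M x.
Proof.
move=> Mnd; apply: fine_ge0; apply: le_trans (limn_einf_sup _).
apply: near_limn_einf_ge; apply: nearW => n; rewrite lee_fin mulr_ge0//.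
by rewrite subr_ge0 Mnd// lerDl invr_ge0.
Qed.

Lemma slopeE M x d : ediff M x d -> slope M x = d.
Proof.
move=> Mx; rewrite /slope; set u := (fun n => _).
suff cu : u n @[n --> \oo] --> d%:E.
  by rewrite is_cvg_limn_esupE ?(cvg_lim _ cu)//; apply/cvg_ex; exists d%:E.
apply: cvg_EFin; first exact: nearW.
apply/cvgrPdist_le => e e0; have [a a0 Ha] := Mx _ e0.
near=> n; rewrite /u/=.
have n0 : 0 < n.+1%:R^-1 :> R by rewrite invr_gt0.
have := Ha (x + n.+1%:R^-1); rewrite addrAC subrr add0r gtr0_norm// => /(_ _).
have na : n.+1%:R^-1 < a by near: n; exact: near_infty_natSinv_lt (PosNum a0).
move=> /(_ na) H.
rewrite distrC -(ler_pM2r n0); apply: le_trans H.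
by rewrite -{2}(gtr0_norm n0) -normrM mulrBl mulfK.
Unshelve. all: by end_near. Qed.

(** [F] may jump but expands distances by a factor of at least [1 / K], so its inverse is
    [K]-Lipschitz; the supremum in [G] extends that inverse constantly across the jumps. *)
Lemma lipschitz_left_inverse (F : R -> R) (K : R) : 0 < K ->
  (forall x, F x = F (clamp x)) -> F 0 = 0 -> F 1 = 1 ->
  (forall x y, 0 <= x -> x <= y -> y <= 1 -> y - x <= K * (F y - F x)) ->
  exists2 G : R -> R, clamp_lipschitz K G & forall x, 0 <= x <= 1 -> G (F x) = x.
Proof.
move=> K0 Fc F0 F1 FK.
have Fnd x y : 0 <= x -> x <= y -> y <= 1 -> F x <= F y.
  move=> x0 xy y1; rewrite -subr_ge0 -(pmulr_rge0 _ K0).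
  by apply: le_trans (FK _ _ x0 xy y1); rewrite subr_ge0.
pose S y := [set x | 0 <= x <= 1 /\ F x <= clamp y].
have c01 y : 0 <= clamp y <= 1 by case: clampP => *; rewrite ?lexx ?ler01//; apply/andP.
have S0 y : S y 0 by split; rewrite ?lexx ?ler01// F0; case/andP: (c01 y).
have S1 y : ubound (S y) 1 by move=> x [/andP[]].
have hS y : has_ubound (S y) by exists 1.
pose G y := sup (S y).
have G0 y : 0 <= G y by apply: ub_le_sup.
have Gle y x : 0 <= x <= 1 -> G y < x -> clamp y < F x.
  move=> x01; rewrite ltNge => /negP H; rewrite ltNge; apply/negP => Fx.
  by apply: H; apply: ub_le_sup.
exists G => [x y xy|x x01].
  have cxy := clamp_homo xy.
  apply/andP; split.
    apply: sup_le; [|by exists 0|by split => //; exists 0].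
    move=> z [z01 Fz]; exists z; split => //; split => //; exact: le_trans cxy.
  apply: ge_sup; first by exists 0.
  move=> z [/andP[z0 z1] Fz]; rewrite leNgt; apply/negP => zG.
  set del := K * _ in zG.
  have del0 : 0 <= del by rewrite mulr_ge0 ?subr_ge0// ltW.
  (* Since [t] is strictly between [G x] and [z - del], [F t] exceeds [clamp x] while [F z] is at
     most [clamp y]; the expansion property then gives [z - t <= del], a contradiction. *)
  pose t := (G x + (z - del)) / 2.
  have Gx0 := G0 x.
  have Gt : G x < t by rewrite /t; lra.
  have tz : t < z - del by rewrite /t; lra.
  have t01 : 0 <= t <= 1 by apply/andP; split; lra.
  have /Gle := Gt; move=> /(_ t01) Ft.
  have := FK t z; case/andP: t01 => t0 t1 => /(_ t0) /(_ _ z1) H.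
  have {}H : z - t <= K * (F z - F t) by apply: H; lra.
  have : K * (F z - F t) <= del by rewrite /del ler_pM2l//; lra.
  by lra.
have Fx01 : 0 <= F x <= 1.
  case/andP: x01 => x0 x1; rewrite -{1}F0 -F1.
  by rewrite !Fnd// ?lexx ?ler01.
apply/eqP; rewrite eq_le; apply/andP; split.
  apply: ge_sup; first by exists 0.
  move=> z [/andP[z0 z1]]; rewrite clamp_id// => Fz.
  case/andP: x01 => x0 x1.
  rewrite leNgt; apply/negP => xz.
  have := FK _ _ x0 (ltW xz) z1; rewrite leNgt => /negP; apply.
  apply: (@le_lt_trans _ _ 0); last by rewrite subr_gt0.
  by rewrite mulr_ge0_le0 ?subr_le0// ltW.
by apply: ub_le_sup => //; split => //; rewrite clamp_id.
Qed.

End monotone.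

Section monotone2.
Context {R : realType}.
Implicit Types (f g h A M : R -> R) (x y d : R).
Local Notation leb := (@lebesgue_measure R).

Lemma ediffZ f k x d : ediff f x d -> ediff (fun y => k * f y) x (k * d).
Proof.
move=> fx e e0; have k0 : 0 < `|k| + 1 by rewrite ltr_wpDl.
have [a a0 Ha] := fx _ (divr_gt0 e0 k0); exists a => // y /Ha H.
rewrite -mulrBr -mulrA -mulrBr normrM.
have := ler_wpM2l (normr_ge0 k) H; move=> /le_trans; apply.
rewrite mulrA ler_wpM2r// mulrCA.
have kk : `|k| / (`|k| + 1) <= 1 by rewrite ler_pdivrMr// mul1r lerDl.
by have := ler_wpM2l (ltW e0) kk; rewrite mulr1.
Qed.

Lemma ediff_ext f g x d e : 0 < e -> (forall y, `|y - x| < e -> f y = g y) ->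
  ediff f x d -> ediff g x d.
Proof.
move=> e0 fg fx r r0; have [a a0 Ha] := fx _ r0.
exists (Num.min a e); first by rewrite lt_min a0.
move=> y; rewrite lt_min => /andP[ya ye].
by rewrite -fg// -fg ?subrr ?normr0//; exact: Ha.
Qed.

Lemma ediff_clamp x : 0 < x < 1 -> ediff (@clamp R) x 1.
Proof.
move=> /andP[x0 x1]; apply: (@ediff_ext id _ _ _ (Num.min x (1 - x))).
- by rewrite lt_min x0 subr_gt0.
- move=> y; rewrite lt_min !ltr_distl => /andP[/andP[? ?] /andP[? ?]].
  by rewrite clamp_id//; apply/andP; split; lra.
- by move=> e e0; exists 1 => // y _; rewrite mul1r subrr normr0 mulr_ge0// ltW.
Qed.

(** Lebesgue's theorem on monotone functions. The left inverse [G] of [F] is a primitive of some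
    [h], hence it maps the set where it lacks the derivative [h] or where [h] vanishes to a null
    set. Any other [x] is [G (F x)] with [G] of positive slope at [F x], so [F], and with it [M], is
    differentiable at [x]. *)
Lemma monotone_ae_ediff M : {homo M : x y / x <= y} ->
  (forall x, M x = M (clamp x)) ->
  {ae leb, forall x, 0 < x < 1 -> ediff M x (slope M x)}.
Proof.
move=> Mnd Mc.
pose K := 1 + (M 1 - M 0).
have M01 : 0 <= M 1 - M 0 by rewrite subr_ge0 Mnd.
have K0 : 0 < K by rewrite /K; lra.
pose F x := K^-1 * (clamp x + (M x - M 0)).
have Fc x : F x = F (clamp x).
  by rewrite /F -Mc (@clamp_id _ (clamp x))//; case: clampP => *; rewrite ?lexx ?ler01//; apply/andP.
have F0 : F 0 = 0 by rewrite /F subrr addr0 clamp_le0// mulr0.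
have F1 : F 1 = 1 by rewrite /F clamp_ge1// mulVf// gt_eqF.
have FK x y : 0 <= x -> x <= y -> y <= 1 -> y - x <= K * (F y - F x).
  move=> x0 xy y1; rewrite /F -mulrBr mulVKf ?gt_eqF//.
  have := Mnd _ _ xy; rewrite !clamp_id; try (by apply/andP; split; lra).
  by lra.
have [G GK GF] := lipschitz_left_inverse K0 Fc F0 F1 FK.
have [h [mh h0 ih Gh Gneg]] := clamp_lipschitz_density GK (ltW K0).
have ih01 : leb.-integrable `[0, 1] (EFin \o h) by exact: integrableS ih.
have Fnd : {homo F : x y / x <= y}.
  move=> x y xy; rewrite /F ler_pM2l ?invr_gt0//.
  by have := Mnd _ _ xy; have := clamp_homo xy; lra.
have Gnd : {homo G : x y / x <= y} by move=> x y /GK/andP[].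
have [N [mN N0 NP]] := prim_ediff ih01.
pose E := (N `|` h @^-1` [set 0]) `&` `[0, 1].
have mE : measurable E.
  apply: measurableI => //; apply: measurableU => //.
  by rewrite -[X in measurable X]setTI; apply: mh.
have hE : (\int[leb]_(x in E) (h x)%:E = 0)%E.
  rewrite (@ae_eq_integral _ _ _ _ _ (cst 0%E))//.
  - exact: integral0.
  - by apply/measurable_EFinP; exact: measurable_funS mh.
  - exists N; split => // x /= /not_implyP[[[//|hx] _]].
    by rewrite hx.
have {Gneg} /= := Gneg _ mE (@subIsetr _ _ _) hE.
move=> Gneg; have aeG : {ae leb, forall x, ~ (G @` E) x}.
  case: Gneg => A [mA A0 EA]; exists A; split => // x /=.
  by rewrite notK => /EA.
apply: (ae_imply aeG) => x Ex x01.
have x01' : 0 <= x <= 1 by case/andP: x01 => ? ?; rewrite !ltW.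
have Fx01 : 0 <= F x <= 1.
  by case/andP: x01' => x0 x1; rewrite -{1}F0 -F1 !Fnd.
have FE : ~ E (F x) by move=> EFx; apply: Ex; exists (F x) => //; exact: GF.
have FN : ~ N (F x) by move=> NFx; apply: FE; split; [left|rewrite /= in_itv].
have hFx : 0 < h (F x).
  rewrite lt_neqAle h0 andbT; apply/eqP => hFx; apply: FE.
  by split; [right; rewrite /= hFx|rewrite /= in_itv].
have GFx : ediff G (F x) (h (F x)).
  have : ediff (prim h) (F x) ((h \_ `[0, 1]) (F x)).
    by apply: contrapT => /NP.
  have IFx : `[0, 1]%classic (F x) by rewrite /= in_itv.
  rewrite patchE mem_set//.
  move=> H e e0; have [a a0 Ha] := H _ e0; exists a => // y /Ha.
  have -> // : G y - G (F x) = prim h y - prim h (F x) by rewrite -!Gh; ring.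
have Fx := ediff_left_inverse Fnd Gnd GF x01 hFx GFx.
have Mx : ediff M x (K * (h (F x))^-1 - 1).
  have := ediffB (ediffZ K Fx) (ediff_clamp x01).
  move=> H e e0; have [a a0 Ha] := H _ e0; exists a => // y /Ha.
  have KFE z : K * F z - clamp z = M z - M 0.
    by rewrite /F mulVKf ?gt_eqF//; ring.
  by have -> // : K * F y - clamp y - (K * F x - clamp x) = M y - M x;
    rewrite !KFE; ring.
by rewrite (slopeE Mx).
Qed.

(** [step_fatou] applies with the positive part as [phi], for which the sums telescope to at most
    the increment of [M]. The inequality says that [M - prim (slope M)] is again nondecreasing: it
    will be the singular part. *)
Lemma monotone_slope M : {homo M : x y / x <= y} ->
  (forall x, M x = M (clamp x)) ->
  leb.-integrable `[0, 1] (EFin \o slope M) /\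
  forall x y, x <= y -> prim (slope M) y - prim (slope M) x <= M y - M x.
Proof.
move=> Mnd Mc.
have mD := measurable_slope Mnd.
have D0 x := slope_ge0 x Mnd.
have aeM := monotone_ae_ediff Mnd Mc.
have key a b : 0 <= a -> a <= b -> b <= 1 ->
    (\int[leb]_(x in `[a, b]) (slope M x)%:E <= (M b - M a)%:E)%E.
  move=> a0; rewrite le_eqVlt => /predU1P[<- _|ab b1].
    by rewrite subrr set_itv1 integral_set1.
  have -> : (\int[leb]_(x in `[a, b]) (slope M x)%:E =
      \int[leb]_(x in `[a, b]) (Num.max (slope M x) 0)%:E)%E.
    by apply: eq_integral => x _; rewrite max_l.
  apply: (@step_fatou _ M (slope M) (fun z => (Num.max z 0)%:E)) => //.
  - apply: (ae_imply aeM) => x H /andP[ax xb]; apply: H.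
    by rewrite (le_lt_trans a0 ax) (lt_le_trans xb b1).
  - move=> x c; rewrite lte_fin lt_max => cx.
    have [c0|c0] := ltP c 0.
      by exists setT => [|y _]; [exact: filterT|rewrite lte_fin lt_max c0 orbT].
    have {}cx : c < x by move: cx; rewrite [c < 0]ltNge c0 orbF.
    exists [set y | c < y]; first exact: lt_nbhsr.
    by move=> y /= cy; rewrite lte_fin lt_max cy.
  - by move=> z; rewrite lee_fin le_max lexx orbT.
  - move=> n /=; set del := _ / _.
    have del0 : 0 < del by rewrite divr_gt0// subr_gt0.
    have E j : (del%:E * (Num.max ((M (a + j.+1%:R * del) - M (a + j%:R * del)) / del) 0)%:E =
        (M (a + j.+1%:R * del) - M (a + j%:R * del))%:E)%E.
      rewrite -EFinM max_l; first by rewrite mulrC divfK// gt_eqF.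
      apply: mulr_ge0; last by rewrite invr_ge0 ltW.
      by rewrite subr_ge0 Mnd// lerD2l ler_pM2r// ler_nat.
    under eq_bigr do rewrite E.
    rewrite sumEFin lee_fin (telescope_sumr (fun j => M (a + j%:R * del)))//.
    apply: lerB; apply: Mnd.
      have -> : b = a + n.+3%:R * del by rewrite /del mulrC divfK ?gt_eqF//; ring.
      by rewrite lerD2l ler_pM2r// ler_nat.
    by rewrite lerDl mulr_ge0// ltW.
have iD : leb.-integrable `[0, 1] (EFin \o slope M).
  apply/integrableP; split; first by apply/measurable_EFinP; exact: measurable_funS mD.
  under eq_integral do rewrite /= ger0_norm//.
  by apply: le_lt_trans (key 0 1 _ _ _) _; rewrite ?lexx ?ler01// ltry.
split => // x y xy; rewrite primB//.
have mS : measurable (`[0, 1] `&` `]x, y] : set R) by exact: measurableI.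
rewrite -lee_fin /Rintegral fineK; last first.
  by apply: integrable_fin_num => //; apply: integrableS iD.
have c01 (z : R) : 0 <= clamp z <= 1 by case: clampP => *; rewrite ?lexx ?ler01//; apply/andP.
have /andP[x0 x1] := c01 x; have /andP[y0 y1] := c01 y.
rewrite (Mc x) (Mc y); apply: le_trans (key _ _ x0 (clamp_homo xy) y1).
apply: ge0_subset_integral => //.
- by apply/measurable_EFinP; exact: measurable_funS mD.
- by move=> z _; rewrite lee_fin.
- move=> z /=; rewrite !in_itv/= => -[/andP[z0 z1] /andP[xz zy]].
  by rewrite -(@clamp_id _ z) ?z0// !clamp_homo// ltW.
Qed.
End monotone2.

(** * Piecewise affine functions *)

Section segments.
Context {R : realType}.
Implicit Types (a b c x y : R).

(** The length of the part of [[a, b]] on the left of [x]. Its increments measure overlaps of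
    intervals, which turns estimates by overlap into telescoping sums. *)
Definition seg a b x : R := Num.max 0 (Num.min (b - a) (x - a)).

Variant seg_spec a b x : R -> Type :=
  | SegLe of x <= a : seg_spec a b x 0
  | SegIn of a <= x & x <= b : seg_spec a b x (x - a)
  | SegGe of b <= x : seg_spec a b x (b - a).

Lemma segP a b x : a <= b -> seg_spec a b x (seg a b x).
Proof.
move=> ab; rewrite /seg; case: (lerP (b - a) (x - a)) => h.
  by rewrite max_r ?subr_ge0//; apply: SegGe; lra.
case: (lerP 0 (x - a)) => h'; first by apply: SegIn; lra.
by apply: SegLe; lra.
Qed.

Lemma seg_homo a b : a <= b -> {homo seg a b : x y / x <= y}.
Proof. by move=> ab x y; case: (segP x ab); case: (segP y ab); lra. Qed.

Lemma seg_ge0 a b x : a <= b -> 0 <= seg a b x.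
Proof. by move=> ab; case: (segP x ab); lra. Qed.

Lemma seg_le a b x : a <= b -> seg a b x <= b - a.
Proof. by move=> ab; case: (segP x ab); lra. Qed.

Lemma seg_left a b x : a <= b -> x <= a -> seg a b x = 0.
Proof. by move=> ab; case: (segP x ab); lra. Qed.

Lemma seg_right a b x : a <= b -> b <= x -> seg a b x = b - a.
Proof. by move=> ab; case: (segP x ab); lra. Qed.

Lemma seg_in a b x : a <= b -> a <= x <= b -> seg a b x = x - a.
Proof. by move=> ab /andP[]; case: (segP x ab); lra. Qed.

Lemma seg_cat a b c x : a <= b -> b <= c -> seg a b x + seg b c x = seg a c x.
Proof.
move=> ab bc; have ac := le_trans ab bc.
by case: (segP x ab); case: (segP x bc); case: (segP x ac); lra.
Qed.

Lemma seg01 x : seg 0 1 x = clamp x.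
Proof. by case: (segP x (@ler01 R)); case: (clampP x); lra. Qed.

Section piecewise.
Variable tau : nat -> R.
Hypothesis tau_nd : forall i, tau i <= tau i.+1.

Lemma tau_homo i j : (i <= j)%N -> tau i <= tau j.
Proof.
elim: j => [|j IH]; first by rewrite leqn0 => /eqP->.
by rewrite leq_eqVlt => /predU1P[->//|/IH/le_trans]; apply.
Qed.

Lemma sum_seg m n x : (m <= n)%N ->
  \sum_(m <= i < n) seg (tau i) (tau i.+1) x = seg (tau m) (tau n) x.
Proof.
move=> mn; rewrite -(subnKC mn); elim: (n - m)%N => [|k IH].
  by rewrite addn0 big_geq// /seg subrr; case: (lerP 0 (x - tau m)) => h; rewrite ?maxxx// max_l// ltW.
by rewrite addnS big_nat_recr/= ?leq_addr// IH seg_cat// tau_homo// leq_addr.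
Qed.

(** The continuous function with slope [S i] on the [i]-th interval, zero on the left of [tau 0] and
    constant on the right of [tau n]. *)
Definition pl (S : nat -> R) (n : nat) x := \sum_(0 <= i < n) S i * seg (tau i) (tau i.+1) x.

Lemma pl_in S n i x : (i < n)%N -> tau i <= x <= tau i.+1 ->
  pl S n x = \sum_(0 <= k < i) S k * (tau k.+1 - tau k) + S i * (x - tau i).
Proof.
move=> iN /andP[ix xi].
rewrite /pl (@big_cat_nat _ _ _ i)//=; last exact: ltnW.
congr (_ + _).
  rewrite !big_nat; apply: eq_bigr => k /andP[_ ki].
  by rewrite seg_right// (le_trans _ ix)// tau_homo.
rewrite big_ltn// seg_in ?ix// big_nat big1 ?addr0// => k /andP[ik _].
by rewrite seg_left ?mulr0// (le_trans xi)// tau_homo.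
Qed.

Lemma pl_node S n i : (i <= n)%N ->
  pl S n (tau i) = \sum_(0 <= k < i) S k * (tau k.+1 - tau k).
Proof.
rewrite leq_eqVlt => /predU1P[->|iN].
  rewrite /pl !big_nat; apply: eq_bigr => k /andP[_ kn].
  by rewrite seg_right// tau_homo.
by rewrite (pl_in _ iN) ?lexx ?tau_nd// subrr mulr0 addr0.
Qed.

Lemma pl_left S n x : x <= tau 0%N -> pl S n x = 0.
Proof.
by move=> x0; rewrite /pl big1// => i _; rewrite seg_left ?mulr0// (le_trans x0)// tau_homo.
Qed.

Lemma pl_right S n x : tau n <= x -> pl S n x = pl S n (tau n).
Proof.
move=> x1; rewrite /pl !big_nat; apply: eq_bigr => i /andP[_ ni].
by rewrite !seg_right// ?tau_homo// (le_trans _ x1)// tau_homo.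
Qed.

Lemma pl_incr S n x y a : x <= y -> (forall i, (i < n)%N -> a <= S i) ->
  a * (seg (tau 0%N) (tau n) y - seg (tau 0%N) (tau n) x) <= pl S n y - pl S n x.
Proof.
move=> xy aS; rewrite -!sum_seg// /pl -!sumrB mulr_sumr !big_nat.
apply: ler_sum => i /andP[_ /aS iS].
by rewrite -mulrBr ler_wpM2r// subr_ge0 seg_homo.
Qed.

Lemma pl_decr S n x y a : x <= y -> (forall i, (i < n)%N -> S i <= a) ->
  pl S n y - pl S n x <= a * (seg (tau 0%N) (tau n) y - seg (tau 0%N) (tau n) x).
Proof.
move=> xy aS; rewrite -!sum_seg// /pl -!sumrB mulr_sumr !big_nat.
apply: ler_sum => i /andP[_ /aS iS].
by rewrite -mulrBr ler_wpM2r// subr_ge0 seg_homo.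
Qed.

Lemma measurable_pl (E : set R) S n : measurable_fun E (pl S n).
Proof.
apply: measurable_sum => i; apply: measurable_funM => //.
by apply: measurable_funTS; apply: nondecreasing_measurable => //; exact: seg_homo.
Qed.

End piecewise.

Lemma ejensen (F : R -> \bar R) (w s : nat -> R) n : econvex F ->
  (forall x, (0 <= F x)%E) -> (forall i, 0 <= w i) ->
  0 < \sum_(0 <= i < n) w i ->
  ((\sum_(0 <= i < n) w i)%:E *
     F ((\sum_(0 <= i < n) w i * s i) / \sum_(0 <= i < n) w i)%R
   <= \sum_(0 <= i < n) (w i)%:E * F (s i))%E.
Proof.
move=> cF F0 w0; elim: n => [|n IH]; first by rewrite big_nil ltxx.
rewrite !big_nat_recr//=; set W := \sum_(0 <= i < n) w i.
set T := \sum_(0 <= i < n) w i * s i.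
have : 0 <= W by apply: sumr_ge0.
(* As long as the accumulated weight is zero the mean [T / W] is meaningless, and the last term has
   to carry the inequality alone. *)
rewrite le_eqVlt => /predU1P[W0|W0] Wn.
  have -> : T = 0.
    have : W = 0 by [].
    move/eqP; rewrite psumr_eq0// => /allP w00.
    by rewrite /T big_seq big1// => i /w00 /eqP ->; rewrite mul0r.
  rewrite -W0 !add0r in Wn *.
  have -> : w n * s n / w n = s n by rewrite mulrAC divff ?mul1r// gt_eqF.
  by rewrite leeDr// sume_ge0// => i _; rewrite mule_ge0// lee_fin.
have t1 : W / (W + w n) <= 1 by rewrite ler_pdivrMr// mul1r lerDl.
have t0 : 0 <= W / (W + w n) by apply: divr_ge0; apply: ltW.
have := cF (T / W) (s n) (W / (W + w n)); rewrite t0 t1 => /(_ isT).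
have Wne : W != 0 by rewrite gt_eqF.
have Wnne : W + w n != 0 by rewrite gt_eqF.
have -> : W / (W + w n) * (T / W) + (1 - W / (W + w n)) * s n =
   (T + w n * s n) / (W + w n) by field; rewrite Wne Wnne.
move=> H; have := lee_wpmul2l (_ : (0 <= (W + w n)%:E)%E) H.
rewrite lee_fin ltW// => /(_ isT) /le_trans; apply.
rewrite ge0_muleDr; last 2 first.
- by apply: mule_ge0 => //; rewrite lee_fin.
- by apply: mule_ge0 => //; rewrite lee_fin subr_ge0.
rewrite !muleA -!EFinM; apply: leeD; last first.
  by rewrite mulrBr mulr1 mulrC divfK// addrAC subrr add0r.
by rewrite mulrC divfK//; exact: IH.
Qed.

Lemma sume_lsc (U : set_system nat) (FU : Filter U) (K : nat) (x : nat -> nat -> \bar R)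
    (y : nat -> \bar R) (c : R) :
  (forall j, (0 <= y j)%E) ->
  (forall j (a : R), (a%:E < y j)%E -> \forall n \near U, (a%:E < x n j)%E) ->
  (c%:E < \sum_(0 <= j < K) y j)%E ->
  \forall n \near U, (c%:E < \sum_(0 <= j < K) x n j)%E.
Proof.
move=> y0 yx; elim: K c => [|K IH] c.
  by rewrite big_nil => c0; apply: nearW => n; rewrite big_nil.
rewrite big_nat_recr//= => cy.
have S0 : (0 <= \sum_(0 <= j < K) y j)%E by apply: sume_ge0.
(* The threshold [c] is shared between the two summands so that each stays strictly below its limit;
   an infinite summand absorbs any deficit of the other. *)
have [a [b [abc aS by_]]] : exists a b : R, [/\ a + b = c,
    (a%:E < \sum_(0 <= j < K) y j)%E & (b%:E < y K)%E].
  move: cy S0 (y0 K); case: (\sum_(0 <= j < K) y j)%E => [S| |]//; case: (y K) => [z| |]//.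
  - rewrite -EFinD !lte_fin !lee_fin => cS S0 z0.
    by exists (S - (S + z - c) / 2), (z - (S + z - c) / 2); rewrite !lte_fin; split; lra.
  - move=> _ S0 _; exists (S - 1), (c - S + 1); rewrite lte_fin ltry; split => //; lra.
  - move=> _ _ z0; exists (c - z + 1), (z - 1); rewrite lte_fin ltry; split => //; lra.
  - by move=> _ _ _; exists c, 0; rewrite !ltry addr0.
near=> n; rewrite big_nat_recr//= -abc EFinD; apply: lteD.
  by near: n; exact: IH.
by near: n; exact: yx.
Unshelve. all: by end_near. Qed.

(** An ultrafilter on a compact interval converges. The same [U] serves all points [x], so no
    diagonal extraction of subsequences is involved. *)
Lemma ultra_cvg (U : set_system nat) (UU : UltraFilter U) (x : nat -> R) (C : R) :
  (forall n, `|x n| <= C) -> exists l : R, x n @[n --> U] --> l.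
Proof.
move=> xC; have PF : ProperFilter (x @ U) by exact: fmap_proper_filter.
have [] := @segment_compact R (- C) C (x @ U) PF.
  by apply: (@filterS _ U _ setT); [move=> n _ /=; rewrite in_itv/= -ler_norml|exact: filterT].
move=> l [_ cl]; exists l => V lV.
have [//|UV] := in_ultra_setVsetC (x @^-1` V) UU.
by have [t [ ]] := cl (~` V) V UV lV.
Qed.

End segments.

(** * Compactness and lower bound *)

Section liminf_core.
Context {R : realType}.
Local Notation leb := (@lebesgue_measure R).
Variables (phi1 phi2 F : R -> \bar R) (B l : R) (N k1 k2 : nat -> nat).
Variables (s : nat -> nat -> R) (u : R -> R).
Hypothesis phi1_ge0 : forall z, (0 <= phi1 z)%E.
Hypothesis phi2_ge0 : forall z, (0 <= phi2 z)%E.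
Hypothesis F_ge0 : forall z, (0 <= F z)%E.
Hypothesis F_convex : econvex F.
Hypothesis F_lsc : lower_semicontinuous F.
Hypothesis F_le : forall z, (F z <= phi1 z + phi2 z)%E.
Hypothesis phi1_superlinear : forall M : R, 0 < M ->
  exists2 Z : R, 0 <= Z & forall z, z <= - Z -> ((M * `|z|)%:E <= phi1 z)%E.
Hypothesis N_gt0 : forall k, (0 < N k)%N.
Hypothesis energy1 : forall k,
  (\sum_(0 <= i < N k) (lam R (N k))%:E * phi1 (s k i) <= B%:E)%E.
Hypothesis energy2 : forall k,
  (\sum_((k1 k).+1 <= i < (k2 k).-1)
     (lam R (N k))%:E * (phi1 (s k i) + phi2 (s k i)) <= B%:E)%E.
Hypothesis k1_small : forall e : R, 0 < e ->
  \forall k \near \oo, (k1 k).+1%:R * lam R (N k) <= e.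
Hypothesis k2_large : forall e : R, 0 < e ->
  \forall k \near \oo, 1 - e <= (k2 k).-1%:R * lam R (N k).
Hypothesis k2_le : forall k, ((k2 k).-1 <= N k)%N.
Hypothesis sum_s : forall k, \sum_(0 <= i < N k) s k i * lam R (N k) = l.

Let tau k i : R := i%:R * lam R (N k).

Hypothesis ae_cvg : {ae leb, forall x, 0 < x < 1 ->
  pl (tau k) (s k) (N k) x @[k --> \oo] --> u x}.

Let lam_gt0 k : 0 < lam R (N k).
Proof. by rewrite invr_gt0 ltr0n. Qed.

Let tau_nd k i : tau k i <= tau k i.+1.
Proof. by rewrite ler_pM2r// ler_nat. Qed.

Let tau0 k : tau k 0%N = 0.
Proof. by rewrite /tau mul0r. Qed.

Let tau1 k : tau k (N k) = 1.
Proof. by rewrite /tau /lam mulfV// gt_eqF// ltr0n. Qed.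

Let tauS k i : tau k i.+1 - tau k i = lam R (N k).
Proof. by rewrite /tau -natr1; ring. Qed.

(* The slopes are split as [s = P - H]. The negative parts [H] are equi-integrable by the
   superlinear growth of [phi1]; [Cut j] truncates them at height [j]. *)
Let H k i : R := Num.max (- s k i) 0.
Let P k i : R := Num.max (s k i) 0.

Let H_ge0 k i : 0 <= H k i. Proof. by rewrite le_max lexx orbT. Qed.
Let P_ge0 k i : 0 <= P k i. Proof. by rewrite le_max lexx orbT. Qed.
Let sPH k i : s k i = P k i - H k i.
Proof.
rewrite /P /H; case: (lerP 0 (s k i)) => h.
  by rewrite max_r ?subr0// oppr_le0.
by rewrite max_l; [ring|rewrite oppr_ge0 ltW].
Qed.

Let Cut j k i : R := Num.min (H k i) j%:R.
Let V := fun S k => pl (tau k) (S k : nat -> R) (N k).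

(** Beyond a height where [phi1] exceeds [(B + 1) / e] times the modulus, the cut-off mass is at
    most [e * B / (B + 1)], uniformly in [k]. The [+ 1] keeps the growth factor positive for
    [B = 0]. *)
Let tail (e : R) : 0 < e -> exists j0 : nat, forall j k, (j0 <= j)%N ->
  \sum_(0 <= i < N k) (H k i - Cut j k i) * lam R (N k) <= e.
Proof.
move=> e0.
have B0 : 0 <= B.
  rewrite -lee_fin (le_trans _ (energy1 0))//; apply: sume_ge0 => i _.
  by rewrite mule_ge0// lee_fin ltW.
have M0 : 0 < (B + 1) / e by rewrite divr_gt0// ltr_wpDl.
have [Z Z0 HZ] := phi1_superlinear M0.
exists (Num.truncn Z).+1 => j k jZ.
have Zj : Z <= j%:R.
  rewrite (le_trans (ltW (truncnS_gt _)))// ler_nat//.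
have key i : (((B + 1) / e * (H k i - Cut j k i))%:E <= phi1 (s k i))%E.
  rewrite /Cut; case: (leP (H k i) j%:R) => Hj; first by rewrite subrr mulr0.
  have j0 : 0 <= j%:R :> R by [].
  have sH : H k i = - s k i.
    by move: Hj; rewrite /H; case: (lerP (- s k i) 0) => // _; lra.
  have sZ : s k i <= - Z by lra.
  apply: le_trans (HZ _ sZ); rewrite lee_fin ler_pM2l//.
  by rewrite -normrN -sH ger0_norm//; lra.
have : (((B + 1) / e * \sum_(0 <= i < N k) (H k i - Cut j k i) * lam R (N k))%:E <= B%:E)%E.
  apply: le_trans (energy1 k); rewrite mulr_sumr -sumEFin; apply: lee_sum => i _.
  by rewrite mulrA mulrC EFinM; apply: lee_wpmul2l => //; rewrite lee_fin ltW.
rewrite lee_fin mulrAC ler_pdivrMr// => h.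
rewrite -(ler_pM2l (x := B + 1)) ?ltr_wpDl// (le_trans h)//.
by rewrite ler_pM2r// lerDl.
Qed.

Let V_diff S T k x : V S k x - V T k x = V (fun k i => S k i - T k i) k x.
Proof. by rewrite /V /pl -sumrB; apply: eq_bigr => i _; rewrite mulrBl. Qed.

Let V_bound S k x : (forall i, 0 <= S k i) ->
  0 <= V S k x <= \sum_(0 <= i < N k) S k i * lam R (N k).
Proof.
move=> S0; apply/andP; split.
  by apply: sumr_ge0 => i _; rewrite mulr_ge0// seg_ge0.
by apply: ler_sum => i _; rewrite ler_wpM2l// -(tauS k i) seg_le.
Qed.

Let V_le0 S k x : x <= 0 -> V S k x = 0.
Proof. by move=> x0; rewrite /V (pl_left (tau_nd k)) ?tau0. Qed.

Let V_ge1 S k x : 1 <= x -> V S k x = \sum_(0 <= i < N k) S k i * lam R (N k).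
Proof.
move=> x1; rewrite /V (pl_right (tau_nd k)) ?tau1// -(tau1 k) (pl_node (tau_nd k))//.
by apply: eq_bigr => i _; rewrite tauS.
Qed.

Let V_clamp S k x : V S k x = V S k (clamp x).
Proof.
case: clampP => // x1; first by rewrite !V_le0.
by rewrite !V_ge1.
Qed.

Let V_homo S k : (forall i, 0 <= S k i) -> {homo V S k : x y / x <= y}.
Proof.
move=> S0 x y xy; rewrite -subr_ge0.
apply: le_trans (pl_incr (tau_nd k) xy (fun i _ => S0 i)).
by rewrite mul0r.
Qed.

Let V_le1 S k x y : (forall i, S k i <= 1) -> x <= y ->
  V S k y - V S k x <= clamp y - clamp x.
Proof.
move=> S1 xy; apply: le_trans (pl_decr (tau_nd k) xy (fun i _ => S1 i)) _.
by rewrite mul1r tau0 tau1 !seg01.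
Qed.

Let sum_lam k : \sum_(0 <= i < N k) lam R (N k) = 1.
Proof. by rewrite sumr_const_nat subn0 -mulr_natr mulrC; exact: tau1. Qed.

Let H_bound : exists2 C : R, 0 <= C & forall k, \sum_(0 <= i < N k) H k i * lam R (N k) <= C.
Proof.
have [j Hj] := tail (@ltr01 R); exists (1 + j%:R); first by rewrite addr_ge0.
move=> k.
have -> : \sum_(0 <= i < N k) H k i * lam R (N k) =
   \sum_(0 <= i < N k) (H k i - Cut j k i) * lam R (N k) +
   \sum_(0 <= i < N k) Cut j k i * lam R (N k).
  by rewrite -big_split/=; apply: eq_bigr => i _; rewrite -mulrDl subrK.
apply: lerD; first exact: Hj.
rewrite -[leRHS]mulr1 -[X in _ <= _ * X](sum_lam k) mulr_sumr; apply: ler_sum => i _.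
by rewrite ler_pM2r// /Cut ge_min lexx orbT.
Qed.

(** The total increment is fixed, so a bound on the negative parts also bounds the positive parts,
    for which no growth of the energy is assumed. *)
Let sumPH k : \sum_(0 <= i < N k) P k i * lam R (N k) =
  l + \sum_(0 <= i < N k) H k i * lam R (N k).
Proof.
by rewrite -(sum_s k) -big_split/=; apply: eq_bigr => i _; rewrite -mulrDl sPH subrK.
Qed.

Let Cut_ge0 j k i : 0 <= Cut j k i.
Proof. by rewrite le_min H_ge0 ler0n. Qed.

Let ulim (U : set_system nat) (UU : UltraFilter U) (S : nat -> nat -> R) (C : R) :
  (forall k i, 0 <= S k i) ->
  (forall k, \sum_(0 <= i < N k) S k i * lam R (N k) <= C) ->
  exists Q : R -> R, forall x, V S k x @[k --> U] --> Q x.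
Proof.
move=> S0 SC.
suff /choice[Q HQ] : forall x, exists q : R, V S k x @[k --> U] --> q by exists Q.
move=> x; apply: (ultra_cvg UU (C := C)) => k.
have /andP[V0 VC] := V_bound x (S0 k).
by rewrite ger0_norm// (le_trans VC).
Qed.

(** The weight [w j i] is the overlap of the [i]-th atomic cell with the [j]-th kept macroscopic
    cell. Jensen's inequality holds in each macroscopic cell; summing over [j] leaves the overlap
    [c i] with [[del, 1 - del]], which is at most [lam] and vanishes on both boundary layers. *)
Let local_energy n k : let del := n.+3%:R^-1 in
  (k1 k).+1%:R * lam R (N k) <= del -> 1 - del <= (k2 k).-1%:R * lam R (N k) ->
  (\sum_(0 <= j < n.+1) (del%:E *
     F ((V s k (j.+2%:R * del)%R - V s k (j.+1%:R * del)%R) / del)%R) <= B%:E)%E.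
Proof.
move=> del k1d k2d.
have n30 : 0 < n.+3%:R :> R by rewrite ltr0n.
have del0 : 0 < del by rewrite invr_gt0.
have nd : n.+3%:R * del = 1 by rewrite mulfV// gt_eqF.
have delN : n.+2%:R * del = 1 - del.
  have h : n.+3%:R * del = n.+2%:R * del + del by rewrite -(natr1 n.+2); ring.
  by rewrite -[X in X - _]nd h addrK.
pose sg i x := seg (tau k i) (tau k i.+1) x.
pose w j i := sg i (j.+2%:R * del) - sg i (j.+1%:R * del).
have w0 j i : 0 <= w j i.
  rewrite subr_ge0; apply: (seg_homo (tau_nd k i)).
  by rewrite ler_pM2r// ler_nat.
have jensen j : (j < n.+1)%N -> (del%:E *
     F ((V s k (j.+2%:R * del)%R - V s k (j.+1%:R * del)%R) / del)%R <=
     \sum_(0 <= i < N k) (w j i)%:E * F (s k i))%E.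
  move=> jn.
  have clampj i : (i <= n.+3)%N -> clamp (i%:R * del) = i%:R * del.
    move=> ni; apply: clamp_id; rewrite mulr_ge0//=; last exact: ltW.
    by rewrite -[leRHS]nd ler_pM2r// ler_nat.
  have sw : \sum_(0 <= i < N k) w j i = del.
    rewrite /w sumrB !(sum_seg (tau_nd k))// tau0 tau1 !seg01 !clampj//; last 2 first.
    - exact: leqW (leqW jn).
    - exact: leqW jn.
    by rewrite -(natr1 j.+1); ring.
  have := @ejensen R F (w j) (s k) (N k) F_convex F_ge0 (w0 j).
  rewrite sw => /(_ del0); congr (_ * F (_ / _) <= _)%E.
  rewrite /V /pl -sumrB; apply: eq_bigr => i _.
  by rewrite /w mulrBl mulrC [X in _ - X]mulrC.
apply: (@le_trans _ _ (\sum_(0 <= j < n.+1) \sum_(0 <= i < N k) (w j i)%:E * F (s k i))%E).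
  by rewrite big_nat [leRHS]big_nat; apply: lee_sum => j /andP[_ /jensen].
rewrite exchange_big/=.
pose c i := sg i (1 - del) - sg i del.
have -> : (\sum_(0 <= i < N k) \sum_(0 <= j < n.+1) (w j i)%:E * F (s k i) =
    \sum_(0 <= i < N k) (c i)%:E * F (s k i))%E.
  apply: eq_bigr => i _; rewrite -ge0_sume_distrl; last by move=> j _; rewrite lee_fin.
  rewrite sumEFin /w (telescope_sumr (fun j => sg i (j.+1%:R * del)))//.
  by rewrite delN mul1r.
have k12 : ((k1 k).+1 <= (k2 k).-1)%N.
  rewrite -(ler_nat R) -(ler_pM2r (lam_gt0 k)) (le_trans k1d)// (le_trans _ k2d)//.
  by rewrite -delN ler_peMl ?ler1n// ltW.
rewrite (@big_cat_nat _ _ _ (k1 k).+1)//=; last exact: leq_trans k12 _.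
rewrite [X in (_ + X)%E](@big_cat_nat _ _ _ (k2 k).-1)//=.
rewrite big_nat big1 ?add0e; last first.
  move=> i /andP[_ ik]; rewrite /c /sg !seg_right ?subrr ?mul0e//.
  - apply: le_trans k1d; rewrite /tau ler_pM2r// ler_nat//.
  - apply: (@le_trans _ _ del); last by rewrite -delN ler_peMl ?ler1n// ltW.
    by apply: le_trans k1d; rewrite /tau ler_pM2r// ler_nat.
rewrite [X in (_ + X)%E]big_nat [X in (_ + X)%E]big1 ?adde0; last first.
  move=> i /andP[ik _]; rewrite /c /sg !seg_left ?subrr ?mul0e//.
  - apply: (@le_trans _ _ (1 - del)); first by rewrite -delN ler_peMl ?ler1n// ltW.
    by rewrite (le_trans k2d)// /tau ler_pM2r// ler_nat.
  - by rewrite (le_trans k2d)// /tau ler_pM2r// ler_nat.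
apply: le_trans (energy2 k); apply: lee_sum => i _.
apply: (@le_trans _ _ ((lam R (N k))%:E * F (s k i))%E).
  apply: lee_wpmul2r => //; rewrite lee_fin /c /sg.
  have := seg_le (1 - del) (tau_nd k i); have := seg_ge0 del (tau_nd k i).
  by rewrite tauS; lra.
by apply: lee_wpmul2l => //; rewrite lee_fin ltW.
Qed.

(** [Pl] and [Q] are the limits of the accumulated positive and negative slopes. [Q] is the
    primitive of [h], the monotone [Pl] has derivative [D], and [Pl - prim D] is the singular part;
    hence the density [D - h]. *)
Lemma liminf_core_density : exists g : R -> R,
  [/\ BVl_Dsnonneg l u g, measurable_fun setT g &
    (\int[leb]_(x in `[0%R, 1%R]) F (g x) <= B%:E)%E].
Proof.
have [U [UU sU]] := ultraFilterLemma eventually_filter.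
have PU : ProperFilter U by exact: ultra_proper.
have [C C0 HC] := H_bound.
have [Q HQ] := ulim UU H_ge0 HC.
have [Pl HP] : exists Q : R -> R, forall x, V P k x @[k --> U] --> Q x.
  by apply: (ulim UU P_ge0 (C := l + C)) => k; rewrite sumPH lerD2l.
have /choice[A HA] : forall j, exists Q : R -> R, forall x, V (Cut j) k x @[k --> U] --> Q x.
  move=> j; apply: (ulim UU (Cut_ge0 j) (C := C)) => k.
  apply: le_trans (HC k); apply: ler_sum => i _.
  by rewrite ler_pM2r// /Cut ge_min lexx.
have ulim_le (x y : nat -> R) (a b : R) : x n @[n --> U] --> a -> y n @[n --> U] --> b ->
    (forall n, x n <= y n) -> a <= b.
  by move=> xa yb xy; apply: ler_cvg_to xa yb _; apply: nearW.
have ulim_eq (x y : nat -> R) (a b : R) : x n @[n --> U] --> a -> y n @[n --> U] --> b ->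
    (forall n, x n = y n) -> a = b.
  move=> xa yb xy; apply/eqP; rewrite eq_le; apply/andP; split.
    by apply: (ulim_le _ _ _ _ xa yb) => n; rewrite xy.
  by apply: (ulim_le _ _ _ _ yb xa) => n; rewrite xy.
have ucst (a : R) : (fun=> a) n @[n --> U] --> a by exact: cvg_cst.
have Q0 : Q 0 = 0 by apply: (ulim_eq _ _ _ _ (HQ 0) (ucst 0)) => k; rewrite V_le0.
have [h [mh h0 ih Qh]] : exists h : R -> R, [/\ measurable_fun setT h,
    (forall x, 0 <= h x), leb.-integrable `[0, 1] (EFin \o h) &
    (forall x, Q x - Q 0 = prim h x)].
  (* The layer [Cut j.+1 - Cut j] takes values between 0 and 1, so its primitive is 1-Lipschitz for
     every [k] and therefore in the limit; [tail] gives the convergence of the [A j] to [Q]. *)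
  apply: (@series_density _ Q A (fun=> 1)) => //.
  - move=> x; apply: (ulim_eq _ _ _ _ (HA 0%N x) (ucst 0)) => k.
    by rewrite /V /pl big1// => i _; rewrite /Cut min_r ?mul0r.
  - move=> j x y xy; rewrite mul1r.
    have dA z : V (Cut j.+1) k z - V (Cut j) k z @[k --> U] --> A j.+1 z - A j z.
      by apply: cvgB; exact: HA.
    have C0' k i : 0 <= Cut j.+1 k i - Cut j k i.
      by rewrite subr_ge0 /Cut le_min !ge_min lexx /= ler_nat leqnSn orbT.
    have C1 k i : Cut j.+1 k i - Cut j k i <= 1.
      rewrite /Cut; case: (leP (H k i) j%:R) => h1;
      case: (leP (H k i) j.+1%:R) => h2; move: h1 h2; rewrite -(natr1 j); lra.
    apply/andP; split.
      apply: (ulim_le _ _ _ _ (dA x) (dA y)) => k.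
      by rewrite !V_diff; apply: V_homo.
    apply: (ulim_le _ _ _ _ (dA y) (cvgD (dA x) (ucst (clamp y - clamp x)))) => k.
    by rewrite /= !V_diff -lerBlDl; exact: V_le1.
  - move=> x; apply/cvgrPdist_le => e e0; have [j0 Hj0] := tail e0.
    near=> j; have jj : (j0 <= j)%N by near: j; exists j0.
    have dA : V H k x - V (Cut j) k x @[k --> U] --> Q x - A j x.
      by apply: cvgB; [exact: HQ|exact: HA].
    have HC0 k i : 0 <= H k i - Cut j k i by rewrite subr_ge0 ge_min lexx.
    have b k : 0 <= V H k x - V (Cut j) k x <= e.
      rewrite V_diff; have /andP[-> h] := @V_bound (fun k i => H k i - Cut j k i) k x (HC0 k).
      exact: le_trans h (Hj0 _ _ jj).
    rewrite ger0_norm.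
      by apply: (ulim_le _ _ _ _ dA (ucst e)) => k; case/andP: (b k).
    by apply: (ulim_le _ _ _ _ (ucst 0) dA) => k; case/andP: (b k).
have Pnd : {homo Pl : x y / x <= y}.
  by move=> x y xy; apply: (ulim_le _ _ _ _ (HP x) (HP y)) => k; exact: V_homo.
have Pc x : Pl x = Pl (clamp x).
  by apply: (ulim_eq _ _ _ _ (HP x) (HP (clamp x))) => k; exact: V_clamp.
have [iD primD] := monotone_slope Pnd Pc.
have aeD := monotone_ae_ediff Pnd Pc.
pose D := slope Pl; pose g x := D x - h x.
have mD : measurable_fun setT D by exact: measurable_slope.
have mg : measurable_fun setT g by exact: measurable_funB.
have ig : leb.-integrable `[0, 1] (EFin \o g).
  have : leb.-integrable `[0, 1] ((EFin \o D) \- (EFin \o h))%E.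
    by apply: integrableB => //; exact: measurable_itv.
  exact: eq_integrable.
have primg x : prim g x = prim D x - prim h x.
  have mI : measurable (`[0, 1] `&` `]-oo, x] : set R) by exact: measurableI.
  rewrite /prim RintegralB//; first by apply: integrableS iD.
  by apply: integrableS ih.
pose W x := Pl x - Q x.
have HW x : V s k x @[k --> U] --> W x.
  have -> : (fun k => V s k x) = (fun k => V P k x - V H k x).
    by apply/funext => k; rewrite V_diff /V /pl; apply: eq_bigr => i _; rewrite -sPH.
  by apply: cvgB; [exact: HP|exact: HQ].
have WE x : W x = (Pl x - prim D x) + prim g x.
  by rewrite primg -Qh Q0 /W; ring.
exists g; split => //.
  split => //; exists W, (fun x => Pl x - prim D x).
  split; [|split; [|split; [|split; [|split]]]].
  - apply: (ae_imply ae_cvg) => x + /=; rewrite in_itv/= => H1 /H1 {}H1.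
    have : pl (tau k) (s k) (N k) x @[k --> U] --> u x.
      by apply: cvg_trans H1; exact: cvg_app.
    by move=> /(cvg_unique _ (HW x)); apply.
  - move=> x x0; apply: (ulim_eq _ _ _ _ (HW x) (ucst 0)) => k.
    by rewrite V_le0 ?ltW.
  - move=> x x1; apply: (ulim_eq _ _ _ _ (HW x) (ucst l)) => k.
    by rewrite V_ge1 ?sum_s// ltW.
  - move=> x y xy; rewrite lerBlDr -lerBlDl. 
    have := primD _ _ xy; lra.
  (* Inside the interval [Pl] and [prim D] have the same derivative almost everywhere, and outside
     both are constant. The endpoints, where the singular part may jump, are discarded. *)
  - have aeDD := ae_imply2 aeD (prim_ediff iD) (fun x p q => conj p q).
    have ae01 := ae_imply2 (ae_neq (0 : R)) (ae_neq (1 : R)) (fun x p q => conj p q).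
    refine (ae_imply2 aeDD ae01 _) => x [Px Dx] [/eqP x0 /eqP x1].
    apply: ediff_deriv_within.
    have [xlt0|x_ge0] := ltP x 0.
      apply: (@ediff_near_cst _ _ _ (- x)); first by rewrite oppr_gt0.
      move=> y; rewrite ltr_distl => /andP[_]; rewrite subrr => y0.
      by rewrite (Pc y) (Pc x) !clamp_le0 ?prim_le0// ltW.
    have [xgt1|x_le1] := ltP 1 x.
      apply: (@ediff_near_cst _ _ _ (x - 1)); first by rewrite subr_gt0.
      move=> y; rewrite ltr_distl => /andP[+ _]; rewrite subKr => y1.
      by rewrite (Pc y) (Pc x) !clamp_ge1 ?prim_ge1// ltW.
    have x01 : 0 < x < 1.
      by rewrite !lt_neqAle x_ge0 x_le1 !andbT; apply/andP; split; apply/eqP => // /esym.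
    have {}Px := Px x01.
    have := ediffB Px Dx; rewrite patchE mem_set ?subrr//=.
    by rewrite in_itv/= x_ge0.
  - exact: WE.
apply: (@step_fatou _ W g F) => //.
  apply: (ae_imply2 aeD (prim_ediff ih)) => x Px hx /andP[x0 x1].
  have := ediffB (Px (introT andP (conj x0 x1))) hx.
  rewrite patchE mem_set; last by rewrite /= in_itv/= !ltW.
  by congr ediff; apply/funext => y; rewrite /W -Qh Q0 subr0.
move=> n /=; set del := _ / _.
(* If the sum for the limit [W] exceeded [B], lower semicontinuity would make the sum exceed [B]
   also for some large [k], against [local_energy]. *)
rewrite leNgt; apply/negP; rewrite big_add1/= => BS.
have del0 : 0 < del by rewrite /del subr0 divr_gt0.
have delE : del = n.+3%:R^-1 by rewrite /del subr0 mul1r.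
have UB := @sume_lsc R U _ n.+1 (fun k j => (del%:E *
     F ((V s k (j.+2%:R * del)%R - V s k (j.+1%:R * del)%R) / del)%R)%E) _ B _ _ BS.
have : \forall k \near U, False.
  have k1U := sU _ (k1_small del0); have k2U := sU _ (k2_large del0).
  have {}UB := UB _ _.
  near=> k.
  have : (B%:E < B%:E)%E; last by rewrite ltxx.
  apply: (@lt_le_trans _ _ (\sum_(0 <= j < n.+1) (del%:E *
     F ((V s k (j.+2%:R * del)%R - V s k (j.+1%:R * del)%R) / del)%R))%E).
    near: k; apply: UB.
    - by move=> j; rewrite mule_ge0// lee_fin ltW.
    - move=> j a; rewrite -lte_pdivrMl// -EFinM => aF.
      have [X qX Xa] := F_lsc aF.
      have cq : (V s k (j.+2%:R * del) - V s k (j.+1%:R * del)) / del @[k --> U] -->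
          (W (0 + j.+2%:R * del) - W (0 + j.+1%:R * del)) / del.
        rewrite !add0r.
        exact: cvgM (cvgB (HW (j.+2%:R * del)) (HW (j.+1%:R * del))) (ucst del^-1).
      have UX : U [set k | X ((V s k (j.+2%:R * del) - V s k (j.+1%:R * del)) / del)].
        exact: cq.
      apply: filterS UX => k /Xa.
      by rewrite EFinM lte_pdivrMl.
  rewrite delE; apply: local_energy; rewrite -delE; near: k.
  - exact: k1U.
  - exact: k2U.
by move/filter_ex => [].
Unshelve. all: by end_near. Qed.
End liminf_core.

(** * The effective potential *)

Section potentials.
Context {R : realType}.
Implicit Types (J g : R -> \bar R) (z : R).

Lemma envelope_ge J g z : (forall y, (-oo < g y)%E) -> econvex g ->
  lower_semicontinuous g -> (forall y, (g y <= J y)%E) ->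
  (g z <= lsc_convex_envelope J z)%E.
Proof. by move=> *; apply: ereal_sup_ubound; exists g. Qed.

Lemma envelope_le J z : (lsc_convex_envelope J z <= J z)%E.
Proof. by apply: ge_ereal_sup => _ [g [_ [_ [_ gJ]]] <-]. Qed.

Lemma envelope_convex J : econvex (lsc_convex_envelope J).
Proof.
move=> x y t /andP[t0 t1]; apply: ge_ereal_sup => _ [g [gN [gc [gl gJ]]] <-].
apply: le_trans (gc x y t _) _; first by rewrite t0.
by apply: leeD; apply: lee_wpmul2l;
  rewrite ?lee_fin ?subr_ge0//; exact: envelope_ge.
Qed.

Lemma envelope_lsc J : lower_semicontinuous (lsc_convex_envelope J).
Proof.
move=> x a /ereal_sup_gt[_ [g [gN [gc [gl gJ]]] <-] ag].
have [V xV Va] := gl _ _ ag; exists V => // y /Va /lt_le_trans; apply.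
exact: envelope_ge.
Qed.

Lemma econvexD_cst g (c : R) : econvex g -> econvex (fun z => g z + c%:E)%E.
Proof.
move=> gc x y t t01; rewrite !muleDr ?fin_num_adde_defl//.
rewrite addeACA -!EFinM -EFinD -mulrDl subrKC mul1r.
by apply: leeD => //; exact: gc.
Qed.

Lemma lscD_cst g (c : R) : lower_semicontinuous g ->
  lower_semicontinuous (fun z => g z + c%:E)%E.
Proof.
move=> gl x a; rewrite -lteBlDr// -EFinB => /gl[V xV Va].
by exists V => // y /Va; rewrite EFinB lteBlDr.
Qed.

Lemma lower_semicontinuous_cst (r : R) : lower_semicontinuous (fun _ : R => r%:E).
Proof. by move=> x a ar; exists setT => //; exact: filterT. Qed.

(** The minimum value [r] is an admissible constant minorant. Conversely, [J] is bounded at distant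
    points [Z], and the chord from [gamma] to [Z] has height close to [r] at the fixed point [z]
    once [Z] is large. *)
Lemma envelope_constant J (gamma L r : R) : J gamma = r%:E ->
  (forall y, (J gamma <= J y)%E) -> J z @[z --> +oo] --> L%:E ->
  (forall z, z <= gamma -> J z = lsc_convex_envelope J z) ->
  forall z, lsc_convex_envelope J z = lsc_convex_envelope J (Num.min z gamma).
Proof.
move=> Jr Jmin JL Jeq z; case: (leP z gamma) => // gz.
have fgE : lsc_convex_envelope J gamma = r%:E by rewrite -Jeq.
rewrite fgE; apply/eqP; rewrite eq_le; apply/andP; split; last first.
  apply: (@envelope_ge J (fun=> r%:E)) => //.
  - by move=> y; rewrite ltNyr.
  - by move=> x y t _; rewrite -!EFinM -EFinD -mulrDl subrKC mul1r.
  - exact: lower_semicontinuous_cst.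
  - by move=> y; rewrite -Jr.
apply/lee_addgt0Pr => e e0.
(* The third condition makes the chord rise by at most [e] between [gamma] and [z]. *)
have [Z [gZ zZ Ze JZ]] : exists Z : R, [/\ gamma < Z, z < Z,
    (z - gamma) * (`|L| + 1 + `|r|) <= e * (Z - gamma) & (J Z <= (L + 1)%:E)%E].
  have /fine_cvgP[Jfin Jc] := JL.
  have L1 : L < L + 1 by rewrite ltrDl.
  have JL1 := cvgr_le _ Jc _ L1.
  near (pinfty_nbhs R) => Z; exists Z; split.
  - by near: Z; apply: nbhs_pinfty_gt; exact: num_real.
  - by near: Z; apply: nbhs_pinfty_gt; exact: num_real.
  - have : (z - gamma) * (`|L| + 1 + `|r|) / e + gamma <= Z.
      by near: Z; apply: nbhs_pinfty_ge; exact: num_real.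
    by rewrite -lerBrDr ler_pdivrMr// [e * _]mulrC.
  - have Zf : J Z \is a fin_num by near: Z; exact: Jfin.
    by rewrite -(fineK Zf) lee_fin; near: Z; exact: JL1.
have Zg0 : 0 < Z - gamma by rewrite subr_gt0.
pose t := (Z - z) / (Z - gamma).
have t1 : 1 - t = (z - gamma) / (Z - gamma) by rewrite /t; field; rewrite gt_eqF.
have t01 : 0 <= t <= 1.
  apply/andP; split; first by apply: divr_ge0; rewrite subr_ge0 ltW.
  by rewrite /t ler_pdivrMr// mul1r lerD2l lerN2 ltW.
have := @envelope_convex J gamma Z t t01.
have -> : t * gamma + (1 - t) * Z = z by rewrite /t; field; rewrite gt_eqF.
move/le_trans; apply; rewrite fgE.
have H : (lsc_convex_envelope J Z <= (L + 1)%:E)%E.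
  exact: le_trans (envelope_le _ _) JZ.
apply: (@le_trans _ _ (t%:E * r%:E + (1 - t)%:E * (L + 1)%:E)%E).
  apply: leeD => //; apply: lee_wpmul2l => //.
  by rewrite lee_fin subr_ge0; case/andP: t01.
rewrite -!EFinM -!EFinD lee_fin.
have -> : t * r + (1 - t) * (L + 1) = r + (1 - t) * (L + 1 - r) by ring.
rewrite lerD2l t1 mulrAC ler_pdivrMr//; apply: le_trans Ze.
apply: ler_wpM2l; first by rewrite subr_ge0 ltW.
by have := ler_norm L; have := ler_norm (- r); rewrite normrN; lra.
Unshelve. all: by end_near. Qed.

Lemma convex_le_max (Psi : R -> \bar R) (a b x : R) : econvex Psi ->
  (forall z, (0 <= Psi z)%E) -> a <= x <= b -> (Psi x <= maxe (Psi a) (Psi b))%E.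
Proof.
move=> cP P0 /andP[ax xb].
have [ab|ba] := ltP a b; last first.
  have -> : x = a by apply/eqP; rewrite eq_le ax (le_trans xb ba).
  by rewrite le_max lexx.
have ab0 : 0 < b - a by rewrite subr_gt0.
pose t := (b - x) / (b - a).
have t0 : 0 <= t by apply: divr_ge0; rewrite subr_ge0 ?(ltW ab).
have t1 : t <= 1 by rewrite /t ler_pdivrMr// mul1r lerD2l lerN2.
have := cP a b t; rewrite t0 t1 => /(_ isT).
have -> : t * a + (1 - t) * b = x by rewrite /t; field; rewrite gt_eqF.
move/le_trans; apply.
set m := maxe _ _.
have m0 : (0 <= m)%E by rewrite le_max P0.
apply: (@le_trans _ _ (t%:E * m + (1 - t)%:E * m)%E).
  apply: leeD; apply: lee_wpmul2l; rewrite ?lee_fin ?subr_ge0// /m le_max lexx ?orbT//.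
by rewrite -ge0_muleDl ?lee_fin ?subr_ge0// -EFinD subrKC mul1e.
Qed.

Section facts.
Variables J1 J2 : R -> \bar R.
Hypothesis J1N : forall z, (-oo < J1 z)%E.
Hypothesis lj2 : LJ2 J1 J2.
Hypothesis lj3 : LJ3 J1 J2.
Hypothesis lj4 : LJ4 J1 J2.

Lemma J0_le z : (J0 J1 J2 z <= J1 z + J2 z)%E.
Proof.
rewrite /J0 addeC; apply: leeD => //.
have : (ereal_inf [set (J1 p.1 + J1 p.2)%E | p in [set p : R * R | (p.1 + p.2 = 2 * z)%R]]
   <= J1 z + J1 z)%E.
  by apply: ereal_inf_lbound; exists (z, z) => //=; ring.
move=> /(lee_wpmul2l (_ : (0 <= (2^-1)%:E :> \bar R)%E)) => /(_ _)/le_trans; apply.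
  by rewrite lee_fin.
have := J1N z; case: (J1 z) => [r| |]// _.
  by rewrite -EFinD -EFinM lee_fin; lra.
by rewrite leey.
Qed.

Lemma J0_eq z : J0 J1 J2 z = J0ss J1 J2 z -> J0 J1 J2 z = (J1 z + J2 z)%E.
Proof.
move=> e; have := J0_le z; rewrite le_eqVlt => /predU1P[//|h].
have Jfin : (J0 J1 J2 z < +oo)%E by rewrite (lt_le_trans h)// leey.
have [[p1 p2] [[/= p12 pE] pU]] := lj2 Jfin e.
have : (p1, p2) = (p2, p1).
  by apply: pU; rewrite /= addrC p12 pE [(J1 p2 + _)%E]addeC.
case=> p21 _; subst p2.
have pz : p1 = z by lra.
rewrite pE pz addeC; congr (_ + _)%E.
have := J1N z; case: (J1 z) => [r| |]// _.
  by rewrite -EFinD -EFinM; congr EFin; field.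
by rewrite gt0_muley// lte_fin.
Qed.

(** The interface between the hypotheses on the potentials and the rest of the proof. The shift [c]
    is the lower growth constant [c1] of [LJ4], for which both shifted potentials dominate
    [c1 * Psi], and [gamma] is the minimizer of [J0]. [F] carries [c + c] because it is compared
    with the sum of the two shifted potentials. *)
Lemma potentials_facts : exists c gamma : R, [/\ 0 < c, 0 < gamma &
  let phi1 z := (J1 z + c%:E)%E in
  let phi2 z := (J2 z + c%:E)%E in
  let F z := (J0ss J1 J2 z + (c + c)%:E)%E in
  [/\ (forall z, (0 <= phi1 z)%E /\ (0 <= phi2 z)%E /\ (0 <= F z)%E),
    econvex F, lower_semicontinuous F,
    (forall z, (F z <= phi1 z + phi2 z)%E) &
  [/\ (forall M : R, 0 < M -> exists2 Z : R, 0 <= Z & forall z, z <= - Z ->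
      ((M * `|z|)%:E <= phi1 z)%E),
    (forall z, F z = F (Num.min z gamma)),
    (forall z, z <= gamma -> F z = (phi1 z + phi2 z)%E),
    (forall z0, (F z0 < +oo)%E -> exists C : R, forall z, z0 <= z ->
      (phi1 z <= C%:E)%E /\ (phi2 z <= C%:E)%E) &
    (forall z, 0 < z -> (F z < +oo)%E)]]].
Proof.
case: lj4 => -[Psi [c1 [c2 [P0 [cP [Psl [c10 [c20 HP]]]]]]]] [d1 [d2 [g [_ [_ [g0 [_ [_ [amin
  [_ [_ [[L [JL JgL]] Jeq]]]]]]]]]]]].
have [_ [_ [dom12 [dom0 [J1lim [J2lim _]]]]]] := lj3.
have Jc j (JJ : R -> \bar R) : (c1%:E * (Psi j - 1%E) <= JJ j)%E -> (c1%:E * Psi j <= JJ j + c1%:E)%E.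
  have := P0 j; case: (Psi j) => [p| |]// _; case: (JJ j) => [q| |]//=;
    rewrite ?leey ?gt0_muley ?lte_fin//.
  by rewrite -EFinB -!EFinM -EFinD !lee_fin; lra.
exists c1, g; split; [exact: c10|exact: g0|move=> phi1 phi2 F].
have phi1P z : (c1%:E * Psi z <= phi1 z)%E by apply: Jc; case: (HP z).
have phi2P z : (c1%:E * Psi z <= phi2 z)%E by apply: Jc; case: (HP z) => _ [_ []].
have cPsi0 z : (0 <= c1%:E * Psi z)%E by rewrite mule_ge0// lee_fin ltW.
have phi10 z : (0 <= phi1 z)%E by exact: le_trans (phi1P z).
have phi20 z : (0 <= phi2 z)%E by exact: le_trans (phi2P z).
(* Together with the strict inequality below the limit at infinity, this makes the minimum of [J0] a
   real number. *)
have J0ge z : ((- (c1 + c1))%:E <= J0 J1 J2 z)%E.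
  have Jge (JJ : R -> \bar R) x : (0 <= JJ x + c1%:E)%E -> ((- c1)%:E <= JJ x)%E.
    by move=> h; rewrite EFinN -sub0e leeBlDr.
  rewrite opprD EFinD; apply: leeD; first exact: Jge (phi20 z).
  have : ((- c1 - c1)%:E <= ereal_inf
      [set (J1 p.1 + J1 p.2)%E | p in [set p : R * R | (p.1 + p.2 = 2 * z)%R]])%E.
    apply: le_ereal_inf_tmp => _ [[p q] _ <-] /=.
    by rewrite EFinD; apply: leeD; exact: Jge (phi10 _).
  have -> : (- c1)%:E = ((2^-1)%:E * (- c1 - c1)%:E)%E by rewrite -EFinM; congr EFin; lra.
  by apply: lee_wpmul2l; rewrite lee_fin.
have [r Jgr] : exists r : R, J0 J1 J2 g = r%:E.
  have := J0ge g; move: JgL; case: (J0 J1 J2 g) => [r| |]//; by exists r.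
have Jmin := (amin g).2 erefl.
have Fmin z := envelope_constant Jgr Jmin JL Jeq z.
have FE z : (phi1 z + phi2 z = J1 z + J2 z + (c1 + c1)%:E)%E.
  by rewrite /phi1 /phi2 addeACA -EFinD.
have F0 z : (0 <= F z)%E.
  rewrite /F -leeBlDr// sub0e -EFinN; apply: (@envelope_ge _ (fun=> (- (c1 + c1))%:E)) => //.
  - by move=> y; rewrite ltNyr.
  - by move=> x y t _; rewrite -!EFinM -EFinD -mulrDl subrKC mul1r.
  - exact: lower_semicontinuous_cst.
have Fle z : (F z <= phi1 z + phi2 z)%E.
  by rewrite FE /F leeD2r// (le_trans (envelope_le _ _))// J0_le.
have Feq z : z <= g -> F z = (phi1 z + phi2 z)%E.
  by move=> zg; rewrite FE /F -Jeq// (J0_eq (Jeq _ zg)).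
have Fming z : F z = F (Num.min z g) by rewrite /F/= /J0ss Fmin.
have domF z : 0 < z -> (F z < +oo)%E.
  move=> z0; apply: le_lt_trans (Fle z) _; rewrite FE.
  have h1 : edom J1 z by apply: dom0; rewrite /= in_itv/= z0.
  have h2 : edom J2 z by rewrite -dom12.
  by rewrite !lte_add_pinfty// ltry.
split => //.
- exact/econvexD_cst/envelope_convex.
- exact/lscD_cst/envelope_lsc.
split => //.
- move=> M M0; have [A [_ HA]] := Psl (M / c1).
  exists (Num.max 0 (- A + 1)); first by rewrite le_max lexx.
  move=> z zZ; apply: le_trans (phi1P z).
  have zA : z < A by move: zZ; case: (leP 0 (- A + 1)); lra.
  have -> : (M * `|z|)%:E = (c1%:E * (M / c1 * `|z|)%:E)%E.
    by rewrite -EFinM mulrA mulrCA mulfV ?gt_eqF// mulr1.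
  by apply: lee_wpmul2l (HA _ zA); rewrite lee_fin ltW.
(* Right of some [A] both potentials are at most 1, as they tend to 0; on [[y, A]] the upper growth
   bound applies, and convexity bounds [Psi] by its end values. Replacing [z0] by [y <= gamma] makes
   [F y] the sum of the potentials, so that its finiteness carries over to [Psi y]. *)
- move=> z0; rewrite Fming; set y := Num.min z0 g => Fy.
  have yg : y <= g by rewrite ge_min lexx orbT.
  have Psiy : (Psi y < +oo)%E.
    rewrite Feq// in Fy; have := phi1P y; move: Fy (phi10 y) (phi20 y) (P0 y).
    case: (phi1 y) => [a| |]//; case: (phi2 y) => [b| |]//.
    by case: (Psi y) => [p| |]//; rewrite ?ltry// gt0_muley ?lte_fin.
  have Psi_dom x : 0 < x -> (Psi x < +oo)%E.
    move=> x0; have := domF _ x0; rewrite /F; have := phi1P x.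
    have : edom J1 x by apply: dom0; rewrite /= in_itv/= x0.
    rewrite /edom/= /phi1; have := J1N x; case: (J1 x) => [a| |]//= _ _; have := P0 x.
    by case: (Psi x) => [p| |]//=; rewrite ?ltry// gt0_muley ?lte_fin.
  have c0 : 0 < c1 + 1 by rewrite addr_gt0.
  have [A [A0 HA1 HA2]] : exists A : R, [/\ 0 < A, (forall z, A <= z -> (J1 z <= 1%:E)%E) &
      (forall z, A <= z -> (J2 z <= 1%:E)%E)].
    have lim1 (JJ : R -> \bar R) : JJ z @[z --> +oo] --> 0%E ->
        exists A : R, forall z, A < z -> (JJ z <= 1%:E)%E.
      move=> /fine_cvgP[Jfin Jcv].
      have J1' := cvgr_le _ Jcv _ ltr01.
      have [A [_ HA]] := filterI Jfin (J1' _).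
      by exists A => z /HA[Jf J1'']; rewrite -(fineK Jf) lee_fin.
    have [A1 H1] := lim1 _ J1lim; have [A2 H2] := lim1 _ J2lim.
    exists (`|A1| + `|A2| + 1); split.
    - by rewrite ltr_wpDl// addr_ge0.
    - move=> z zA; apply: H1; apply: lt_le_trans zA.
      have := ler_norm A1; have := normr_ge0 A2; lra.
    - move=> z zA; apply: H2; apply: lt_le_trans zA.
      have := ler_norm A2; have := normr_ge0 A1; lra.
  have [p Pp] : exists p : R, (maxe (Psi y) (Psi A) <= p%:E)%E.
    have := Psi_dom _ A0; move: Psiy (P0 y) (P0 A).
    case: (Psi y) => [a| |]//; case: (Psi A) => [b| |]//= _ _ _ _.
    by exists (Num.max a b); rewrite -EFin_max.
  pose C := Num.max (c2 * Num.max p (Num.max `|y| `|A|)) 1 + c1.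
  have JC (JJ : R -> \bar R) : (forall z, A <= z -> (JJ z <= 1%:E)%E) ->
     (forall z, (JJ z <= c2%:E * maxe (Psi z) `|z|%:E)%E) ->
     forall z, z0 <= z -> (JJ z + c1%:E <= C%:E)%E.
    move=> JA Jc2 z zz0; rewrite /C EFinD leeD2r//.
    have [Az|zA] := leP A z.
      by rewrite (le_trans (JA _ Az))// lee_fin le_max lexx orbT.
    apply: le_trans (Jc2 z) _.
    apply: (@le_trans _ _ (c2 * Num.max p (Num.max `|y| `|A|))%:E); last first.
      by rewrite lee_fin le_max lexx.
    rewrite EFinM; apply: lee_wpmul2l; first by rewrite lee_fin ltW.
    have yz : y <= z by rewrite ge_min zz0.
    rewrite ge_max; apply/andP; split.
      apply: (@le_trans _ _ p%:E); last by rewrite lee_fin le_max lexx.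
      by apply: le_trans Pp; apply: convex_le_max => //; rewrite yz ltW.
    rewrite lee_fin le_max; apply/orP; right.
    rewrite le_max; have [z0'|z0'] := leP 0 z.
      by rewrite (gtr0_norm A0) (ger0_norm z0') (ltW zA) orbT.
    by rewrite (ltr0_norm z0') -(normrN y) (le_trans _ (ler_norm _))// lerN2.
  exists C => z zz0; split; apply: JC => // x; first by case: (HP x) => _ [].
  by case: (HP x) => _ [_ []].
Qed.
End facts.
End potentials.

(** * Jensen's inequality for extended-real convex functions *)

Section integral_jensen.
Context {R : realType}.
Local Notation leb := (@lebesgue_measure R).
Variables (F : R -> \bar R).
Hypothesis F_ge0 : forall z, (0 <= F z)%E.
Hypothesis F_convex : econvex F.
Hypothesis F_lsc : lower_semicontinuous F.
Hypothesis F_dom : forall x y, x <= y -> (F x < +oo)%E -> (F y < +oo)%E.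

(** The slope of the supporting line is the infimum of the difference quotients to the right of [A].
    It is finite because the domain contains a point [z1] to the left of [A], whose quotient is a
    lower bound. *)
Lemma econvex_subgradient (z1 A : R) : z1 < A -> (F z1 < +oo)%E ->
  exists p : R, forall z, ((fine (F A) + p * (z - A))%:E <= F z)%E.
Proof.
move=> z1A Fz1.
have Ffin z : (F z < +oo)%E -> F z = (fine (F z))%:E.
  by move=> Fz; rewrite fineK// ge0_fin_numE.
have FA : (F A < +oo)%E by apply: F_dom Fz1; exact: ltW.
have slopes z z' : (F z < +oo)%E -> z < A -> A < z' ->
    (fine (F A) - fine (F z)) / (A - z) <= (fine (F z') - fine (F A)) / (z' - A).
  move=> Fz zA Az'.
  have Fz' : (F z' < +oo)%E by apply: F_dom FA; exact: ltW.
  have zz' : 0 < z' - z by lra.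
  pose t := (z' - A) / (z' - z).
  have t0 : 0 <= t by apply: divr_ge0; lra.
  have t1 : t <= 1 by rewrite /t ler_pdivrMr// mul1r; lra.
  have tA : t * z + (1 - t) * z' = A by rewrite /t; field; rewrite gt_eqF.
  have zA1 : z' - A = t * (z' - z) by rewrite /t divfK// gt_eqF.
  have zA2 : A - z = (1 - t) * (z' - z) by rewrite /t; field; rewrite gt_eqF.
  clearbody t.
  have := F_convex z z' (t := t); rewrite t0 t1 => /(_ isT); rewrite tA.
  rewrite (Ffin _ FA) (Ffin _ Fz) (Ffin _ Fz') -!EFinM -EFinD lee_fin /=.
  set fA := fine (F A); set fz := fine (F z); set fz' := fine (F z') => H.
  rewrite ler_pdivrMr ?subr_gt0// mulrAC ler_pdivlMr ?subr_gt0//.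
  by rewrite zA1 zA2 !mulrA ler_pM2r//; lra.
pose S := [set (fine (F z) - fine (F A)) / (z - A) | z in [set z | A < z]].
have S0 : S !=set0.
  by exists ((fine (F (A + 1)) - fine (F A)) / (A + 1 - A)), (A + 1) => //=; rewrite ltrDl.
have Sl z : (F z < +oo)%E -> z < A -> lbound S ((fine (F A) - fine (F z)) / (A - z)).
  by move=> Fz zA _ [z' /= Az' <-]; exact: slopes.
exists (inf S) => z.
have [zA|Az|->] := ltgtP z A.
- have [->|] := eqVneq (F z) +oo%E; first by rewrite leey.
  rewrite -ltey => Fz; rewrite (Ffin _ Fz) lee_fin.
  have : (fine (F A) - fine (F z)) / (A - z) <= inf S by apply: lb_le_inf => //; exact: Sl.
  by rewrite ler_pdivrMr ?subr_gt0//; lra.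
- have Fz : (F z < +oo)%E by apply: F_dom FA; exact: ltW.
  rewrite (Ffin _ Fz) lee_fin.
  have : inf S <= (fine (F z) - fine (F A)) / (z - A).
    by apply: ge_inf; [exists ((fine (F A) - fine (F z1)) / (A - z1)); exact: Sl|exists z].
  by rewrite ler_pdivlMr ?subr_gt0//; lra.
- by rewrite subrr mulr0 addr0 -Ffin.
Qed.

(** If the domain of [F] reaches to the left of the mean [A], a supporting line at [A] is
    integrated. Otherwise a finite right-hand side forces [g >= A] almost everywhere; having mean
    [A], [g] then equals [A] almost everywhere. *)
Lemma integral_jensen (D : set R) (d : R) (g : R -> R) : measurable D ->
  leb D = d%:E -> 0 < d -> leb.-integrable D (EFin \o g) ->
  (d%:E * F (Rintegral leb D g / d)%R <= \int[leb]_(x in D) F (g x))%E.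
Proof.
move=> mD Dd d0 ig; set A := _ / _.
have mFg : measurable_fun D (F \o g).
  apply: (@measurableT_comp _ _ _ _ _ _ F).
    exact: lower_semicontinuous_measurable.
  by apply/measurable_EFinP; case/integrableP: ig.
have mD' : measurable (D : set (measurableTypeR R)) by exact: mD.
have Dfin : (leb D < +oo)%E by rewrite Dd ltry.
have Ad : Rintegral leb D g = A * d by rewrite /A divfK// gt_eqF.
have icst (c : R) : leb.-integrable D (EFin \o (fun=> c)).
  apply/integrableP; split; first exact: measurable_cst.
  by rewrite /= integral_cst//; apply: lte_mul_pinfty.
have RC (c : R) : Rintegral leb D (fun=> c) = c * d.
  have -> : d = fine (leb D) by rewrite Dd.
  exact: Rintegral_cst.
have [->|] := eqVneq (\int[leb]_(x in D) F (g x))%E +oo%E; first by rewrite leey.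
rewrite -ltey => Foo.
have iFg : leb.-integrable D (F \o g).
  apply/integrableP; split; first exact: mFg.
  by under eq_integral do rewrite /= gee0_abs//.
have [[z1 z1A Fz1]|noz] := pselect (exists2 z1, z1 < A & (F z1 < +oo)%E).
  have [p Hp] := econvex_subgradient z1A Fz1.
  have FA : (F A < +oo)%E by apply: F_dom Fz1; exact: ltW.
  have FAE : F A = (fine (F A))%:E by rewrite fineK// ge0_fin_numE.
  have ipg : leb.-integrable D (EFin \o (fun x => p * g x)).
    by have := integrableZl mD' p ig.
  have iaff : leb.-integrable D (EFin \o (fun x => (fine (F A) - p * A) + p * g x)).
    have := integrableD mD' (icst (fine (F A) - p * A)) ipg.
    exact: eq_integrable.
  apply: (@le_trans _ _ (\int[leb]_(x in D) ((fine (F A) - p * A) + p * g x)%:E)%E); last first.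
    apply: le_integral => // x _ /=; have := Hp (g x); congr (_%:E <= _)%E; ring.
  rewrite FAE -EFinM.
  have -> : (\int[leb]_(x in D) ((fine (F A) - p * A) + p * g x)%:E)%E =
      (Rintegral leb D (fun x => (fine (F A) - p * A) + p * g x))%:E.
    by rewrite /Rintegral fineK//; exact: integrable_fin_num.
  rewrite lee_fin RintegralD// RintegralZl// RC Ad.
  by rewrite le_eqVlt; apply/orP; left; apply/eqP; ring.
have gA : {ae leb, forall x, D x -> A <= g x}.
  have := integrable_ae mD' iFg.
  move=> H; apply: (ae_imply H) => x + Dx => /(_ Dx) /= fx.
  rewrite leNgt; apply/negP => gxA; apply: noz; exists (g x) => //.
  by rewrite ltey_eq fx.
have igA : leb.-integrable D (EFin \o (fun x => g x - A)).
  have := integrableB mD' ig (icst A); exact: eq_integrable.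
have gA0 : (\int[leb]_(x in D) `|(g x - A)%:E| = 0)%E.
  have mgA : measurable_fun D (EFin \o (fun x => g x - A)) by case/integrableP: igA.
  transitivity (\int[leb]_(x in D) (g x - A)%:E)%E.
    apply: ae_eq_integral => //; first exact: measurableT_comp mgA.
    by apply: (ae_imply gA) => x + Dx => /(_ Dx) gx; rewrite gee0_abs// lee_fin subr_ge0.
  transitivity (Rintegral leb D (fun x => g x - A))%:E.
    by rewrite /Rintegral fineK//; exact: integrable_fin_num.
  by rewrite RintegralB// RC Ad subrr.
have : ae_eq leb D (EFin \o (fun x => g x - A)) (cst 0%E).
  by apply/ae_eq_integral_abs => //; case/integrableP: igA.
move=> gAae.
apply: (@le_trans _ _ (\int[leb]_(x in D) (cst (F A)) x)%E).
  have -> : d%:E = leb D by rewrite Dd.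
  by rewrite muleC -integral_cst.
rewrite le_eqVlt; apply/orP; left; apply/eqP.
apply: ae_eq_integral => //.
apply: (ae_imply gAae) => x + Dx => /(_ Dx) /= [] /eqP.
by rewrite subr_eq0 => /eqP ->.
Qed.
End integral_jensen.

(** * Macroscopic approximation *)

Section jump_functions.
Context {R : realType}.
Implicit Types (K : nat) (sigma rho : nat -> R) (x y : R).

Definition knot K i : R := i%:R / K%:R.

(** Right-continuous, with a jump already at 0, where the boundary value is 0; this first jump is
    the room in which the initial slope [u0] is later accommodated. *)
Definition jump_pl K sigma rho x : R :=
  \sum_(0 <= i < K) (if knot K i <= x then rho i else 0) + pl (knot K) sigma K x.

Lemma knot_nd K i : knot K i <= knot K i.+1.
Proof. by rewrite ler_wpM2r ?invr_ge0// ler_nat. Qed.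

Lemma knot0 K : knot K 0 = 0. Proof. by rewrite /knot mul0r. Qed.

Lemma knot1 K : (0 < K)%N -> knot K K = 1.
Proof. by move=> K0; rewrite /knot mulfV// gt_eqF// ltr0n. Qed.

Lemma knotS K i : knot K i.+1 - knot K i = K%:R^-1.
Proof. by rewrite /knot -natr1; ring. Qed.

Lemma knot_le K i j : (i <= j)%N -> knot K i <= knot K j.
Proof. exact: tau_homo (knot_nd K) _ _. Qed.

Lemma jump_pl_in K sigma rho j x : (j < K)%N -> knot K j <= x < knot K j.+1 ->
  jump_pl K sigma rho x = \sum_(0 <= i < j.+1) rho i +
    (\sum_(0 <= i < j) sigma i / K%:R + sigma j * (x - knot K j)).
Proof.
move=> jK /andP[jx xj]; rewrite /jump_pl; congr (_ + _).
  rewrite (@big_cat_nat _ _ _ j.+1)//= [X in _ + X](_ : _ = 0) ?addr0.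
    apply: eq_big_nat => i /andP[_ ij].
    by rewrite (le_trans _ jx)// knot_le.
  rewrite big_nat big1// => i /andP[ji _]; rewrite leNgt (lt_le_trans xj)//.
  exact: knot_le.
have jxj : knot K j <= x <= knot K j.+1 by rewrite jx ltW.
rewrite (pl_in (knot_nd K) _ jK jxj); congr (_ + _).
by apply: eq_bigr => i _; rewrite knotS.
Qed.

Section bounds.
Variables (K : nat) (sigma rho : nat -> R) (z : R).
Hypothesis K0 : (0 < K)%N.
Hypothesis rho_ge0 : forall j, (j < K)%N -> 0 <= rho j.
Hypothesis sigma_ge : forall j, (j < K)%N -> z <= sigma j.

Let jump_homo : {homo (fun x => \sum_(0 <= i < K) (if knot K i <= x then rho i else 0)) :
  x y / x <= y}.
Proof.
move=> x y xy; rewrite !big_nat; apply: ler_sum => i /andP[_ iK].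
case: ifPn => ix; first by rewrite (le_trans ix).
by case: ifPn => // _; exact: rho_ge0.
Qed.

Lemma jump_pl_incr x y : 0 <= x -> x <= y -> y <= 1 ->
  z * (y - x) <= jump_pl K sigma rho y - jump_pl K sigma rho x.
Proof.
move=> x0 xy y1; have := jump_homo xy.
have := pl_incr (knot_nd K) xy sigma_ge.
rewrite knot0 knot1// !seg01 !clamp_id ?x0 ?y1 ?(le_trans x0)// ?(le_trans xy)//.
by rewrite /jump_pl; lra.
Qed.

Lemma jump_pl0 : jump_pl K sigma rho 0 = rho 0%N.
Proof.
rewrite (@jump_pl_in K sigma rho 0)//.
  by rewrite big_nat1 big_geq// knot0 subrr mulr0 !addr0.
by rewrite knot0 lexx /knot divr_gt0 ?ltr0n.
Qed.

Lemma jump_pl_ge x : 0 <= x <= 1 -> rho 0%N + z * x <= jump_pl K sigma rho x.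
Proof. by move=> /andP[x0 x1]; have := jump_pl_incr (lexx 0) x0 x1; rewrite jump_pl0; lra. Qed.

Lemma jump_pl1 : jump_pl K sigma rho 1 = \sum_(0 <= j < K) rho j + \sum_(0 <= j < K) sigma j / K%:R.
Proof.
rewrite /jump_pl; congr (_ + _).
  apply: eq_big_nat => i /andP[_ iK].
  by rewrite -[leRHS](knot1 K0) knot_le// ltnW.
rewrite -[in LHS](knot1 K0) (pl_node (knot_nd K))//.
by apply: eq_bigr => i _; rewrite knotS.
Qed.

Lemma jump_pl_le x : 0 <= x <= 1 -> jump_pl K sigma rho x <=
  \sum_(0 <= j < K) rho j + \sum_(0 <= j < K) sigma j / K%:R - z * (1 - x).
Proof. by move=> /andP[x0 x1]; have := jump_pl_incr x0 x1 (lexx 1); rewrite jump_pl1; lra. Qed.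

End bounds.
End jump_functions.

Section macro.
Context {R : realType}.
Local Notation leb := (@lebesgue_measure R).
Variables (F : R -> \bar R) (gamma l E : R) (u g : R -> R).
Hypothesis F_ge0 : forall z, (0 <= F z)%E.
Hypothesis F_convex : econvex F.
Hypothesis F_lsc : lower_semicontinuous F.
Hypothesis F_min : forall z, F z = F (Num.min z gamma).
Hypothesis F_pos : forall z, 0 < z -> (F z < +oo)%E.
Hypothesis gamma_gt0 : 0 < gamma.
Hypothesis l_gt0 : 0 < l.
Hypothesis BV : BVl_Dsnonneg l u g.
Hypothesis FE : (\int[leb]_(x in `[0%R, 1%R]) F (g x) <= E%:E)%E.

Lemma dom_up x y : x <= y -> (F x < +oo)%E -> (F y < +oo)%E.
Proof.
move=> xy Fx; rewrite F_min; have [yg|gy] := leP y gamma; last exact: F_pos.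
apply: le_lt_trans (convex_le_max F_convex F_ge0 (introT andP (conj xy yg))) _.
by rewrite gt_max Fx F_pos.
Qed.

Let ig : leb.-integrable `[0, 1] (EFin \o g). Proof. by case: BV. Qed.

Let mFg : measurable_fun (`[0, 1]%classic : set R) (F \o g).
Proof.
apply: (@measurableT_comp _ _ _ _ _ _ F).
  exact: lower_semicontinuous_measurable.
by apply/measurable_EFinP; case/integrableP: ig.
Qed.

Let ign : leb.-integrable `[0, 1] (EFin \o (fun x => `|g x|)).
Proof. exact: integrable_norm ig. Qed.

Lemma prim_norm x y : x <= y ->
  `|prim g y - prim g x| <= prim (fun x => `|g x|) y - prim (fun x => `|g x|) x.
Proof.
move=> xy; rewrite !primB//.
have mD : measurable (`[0, 1] `&` `]x, y] : set R) by exact: measurableI.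
apply: le_normr_Rintegral => //.
by apply: integrableS ig => //.
Qed.

Lemma cell_jensen (K j : nat) : (j < K)%N ->
  ((K%:R^-1)%:E * F ((prim g (knot K j.+1) - prim g (knot K j)) * K%:R)%R
    <= \int[leb]_(x in `](knot K j), (knot K j.+1)]) F (g x))%E.
Proof.
move=> jK; have K0 : (0 < K)%N by exact: leq_trans jK.
have K0' : 0 < K%:R^-1 :> R by rewrite invr_gt0 ltr0n.
have sub : `](knot K j), (knot K j.+1)] `<=` `[(0 : R), 1].
  move=> x /=; rewrite !in_itv/= => /andP[jx xj]; apply/andP; split.
    by rewrite -(knot0 K) (le_trans _ (ltW jx))// knot_le.
  by rewrite -(knot1 (R := R) K0) (le_trans xj)// knot_le.
rewrite primB//; last exact: knot_nd.
rewrite [_ `&` _](_ : _ = `](knot K j), (knot K j.+1)]%classic); last exact/setIidPr.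
have -> x : x * K%:R = x / (K%:R^-1) :> R by rewrite invrK.
apply: integral_jensen => //.
- exact: dom_up.
- rewrite lebesgue_measure_itv/= lte_fin -subr_gt0 knotS K0'.
  by rewrite -EFinB knotS.
- by apply: integrableS ig.
Qed.

Lemma cell_sum (K : nat) : (0 < K)%N ->
  (\sum_(0 <= j < K) (K%:R^-1)%:E * F ((prim g (knot K j.+1) - prim g (knot K j)) * K%:R)%R
    <= E%:E)%E.
Proof.
move=> K0; apply: le_trans FE.
apply: (@le_trans _ _ (\sum_(0 <= j < K) \int[leb]_(x in `](knot K j), (knot K j.+1)]) F (g x))%E).
  by rewrite big_nat [leRHS]big_nat; apply: lee_sum => j /andP[_ jK]; exact: cell_jensen.
have sub j : (j <= K)%N -> `](0 : R), (knot K j)] `<=` `[(0 : R), 1].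
  move=> jK x /=; rewrite !in_itv/= => /andP[x0 xj]; rewrite (ltW x0)/= (le_trans xj)//.
  by rewrite -[leRHS](knot1 (R := R) K0) knot_le.
have key j : (j <= K)%N ->
    (\sum_(0 <= i < j) \int[leb]_(x in `](knot K i), (knot K i.+1)]) F (g x) =
    \int[leb]_(x in `]0%R, (knot K j)]) F (g x))%E.
  elim: j => [|j IH] jK; first by rewrite big_geq// knot0 set_itv_ge ?integral_set0 ?bnd_simp// ltxx.
  rewrite big_nat_recr//= IH ?(ltnW jK)//.
  have j0 : 0 <= knot K j :> R by rewrite -(knot0 (R := R) K) knot_le.
  have -> : `](0 : R), (knot K j.+1)]%classic =
     `]0, (knot K j)] `|` `](knot K j), (knot K j.+1)].
    by rewrite -itv_bndbnd_setU// bnd_simp//; exact: knot_nd.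
  have U01 : `](0 : R), (knot K j)] `|` `](knot K j), (knot K j.+1)] `<=` `[0, 1].
    rewrite -itv_bndbnd_setU ?bnd_simp//; last exact: knot_nd.
    exact: sub.
  rewrite ge0_integral_setU//=; first exact: measurable_funS mFg.
  rewrite disj_set2E; apply/eqP; rewrite -subset0 => x [/=]; rewrite !in_itv/=.
  by move=> /andP[_ xj] /andP[/lt_le_trans/(_ xj)]; rewrite ltxx.
rewrite key// knot1//; apply: ge0_subset_integral => //.
by move=> x /=; rewrite !in_itv/= => /andP[/ltW -> ->].
Qed.

(** The cut at [gamma] does not change [F], so only the mixing costs energy. On the [j]-th interval
    the distance to [u] is controlled by the growth there of [m] and of the primitive of [|g|];
    these growths have bounded sums, so their average over [K] intervals is of order [1 / K]. *)
Lemma macro_approx (eps : R) : 0 < eps ->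
  exists (K : nat) (sigma rho b : nat -> R), [/\ (0 < K)%N,
    (forall j, (j < K)%N -> sigma j <= gamma /\ (F (sigma j) < +oo)%E),
    [/\ (forall j, (j < K)%N -> 0 <= rho j), 0 < rho 0%N &
     \sum_(0 <= j < K) rho j + \sum_(0 <= j < K) sigma j / K%:R < l],
    (\sum_(0 <= j < K) (K%:R^-1)%:E * F (sigma j) <= (E + eps)%:E)%E &
    [/\ (forall j, (j < K)%N -> 0 <= b j), \sum_(0 <= j < K) b j / K%:R <= eps &
    {ae leb, forall x, forall j, (j < K)%N -> knot K j < x < knot K j.+1 ->
      `|jump_pl K sigma rho x - u x| <= b j}]].
Proof.
move=> eps0.
case: BV => _ [w [m [wu [w0 [wl [mnd [_ wE]]]]]]].
pose G := prim g; pose P := prim (fun x => `|g x|).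
have Pnd : {homo P : x y / x <= y} by exact: prim_homo.
(* The value [sstar > 0] has finite energy; mixing it in with weight [th] leaves room for
   strictly positive jumps at both ends, where the discretization repairs the boundary
   conditions. *)
pose sstar := Num.min l gamma / 2.
have ss0 : 0 < sstar by rewrite divr_gt0// lt_min l_gt0.
have ssl : sstar <= l / 2 by rewrite ler_pM2r// ge_min lexx.
have ssg : sstar <= gamma.
  have h : Num.min l gamma <= gamma by rewrite ge_min lexx orbT.
  have := gamma_gt0; rewrite /sstar; lra.
have [fs fsE] : exists fs : R, F sstar = fs%:E.
  by exists (fine (F sstar)); rewrite fineK// ge0_fin_numE// F_pos.
have fs0 : 0 <= fs by rewrite -lee_fin -fsE.
pose Mt := m 2 - m (-1); pose Gt := P 1.
have Mt0 : 0 <= Mt by rewrite subr_ge0 mnd//; lra.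
have Gt0 : 0 <= Gt by rewrite -(prim_le0 (fun x => `|g x|) (lexx 0)) Pnd.
have wide (y : R) : 0 <= y <= 1 -> -1 <= y /\ y <= 2 by move=> /andP[? ?]; split; lra.
(* [C0] bounds the profile [A] before mixing, [l] bounds the affine profile [B] mixed in, and [fs]
   is the energy density of the latter; [th] is chosen to make the effect of mixing at most
   [eps / 2]. *)
pose C0 := 2 * Mt + 4 * Gt + 2 * gamma.
have C00 : 0 <= C0 by rewrite !addr_ge0// mulr_ge0// ltW.
have D0 : 0 < C0 + l + fs + 1 by lra.
pose th := Num.min 1 (eps / (2 * (C0 + l + fs + 1))).
have th0 : 0 < th by rewrite lt_min ltr01 divr_gt0// mulr_gt0.
have th1 : th <= 1 by rewrite ge_min lexx.
have theps : th * (C0 + l + fs + 1) <= eps / 2.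
  have : th <= eps / (2 * (C0 + l + fs + 1)) by rewrite ge_min lexx orbT.
  by rewrite ler_pdivlMr ?mulr_gt0//; lra.
clearbody th.
pose N0 := 2 * Mt + 4 * Gt + 2 * gamma.
have [K [K0 KN]] : exists K : nat, (0 < K)%N /\ N0 / K%:R <= eps / 2.
  exists (Num.truncn (N0 / (eps / 2))).+1; split => //.
  rewrite ler_pdivrMr ?ltr0n// mulrC -ler_pdivrMr ?divr_gt0//.
  by apply/ltW; exact: truncnS_gt.
have K0' : 0 < K%:R :> R by rewrite ltr0n.
have Ki0 : 0 < K%:R^-1 :> R by rewrite invr_gt0.
(* Evaluating [m] at -1 and 2 instead of 0 and 1 includes possible jumps at the two ends, and there
   the boundary values of [w] are known. *)
pose mm j : R := if j == 0%N then m (-1) else if (j < K)%N then m (knot K j) else m 2.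
have knot01 j : (j <= K)%N -> 0 <= knot (R := R) K j <= 1.
  move=> jK; apply/andP; split; first by rewrite -(knot0 (R := R) K) knot_le.
  by rewrite -[leRHS](knot1 (R := R) K0) knot_le.
have mm_x j x : (j < K)%N -> knot K j < x < knot K j.+1 -> mm j <= m x <= mm j.+1.
  move=> jK /andP[jx xj]; have /andP[j0 j1] := knot01 _ (ltnW jK).
  have /andP[i0 i1] := knot01 _ jK.
  rewrite /mm jK /=; apply/andP; split; case: ifP => _; apply: mnd.
  - by apply: le_trans (ltW jx); have [] := wide _ (knot01 _ (ltnW jK)).
  - exact: ltW.
  - exact: ltW.
  - by apply: le_trans (ltW xj) _; have [] := wide _ (knot01 _ jK).
have mmS j : (j < K)%N -> mm j <= mm j.+1.
  move=> jK; have e := @knotS R K j.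
  pose x : R := knot K j + K%:R^-1 / 2.
  have jx : knot K j < x < knot K j.+1 by rewrite /x; apply/andP; split; lra.
  by have /andP[/le_trans+ ] := mm_x _ _ jK jx; apply.
pose del j := mm j.+1 - mm j.
have del0 j : (j < K)%N -> 0 <= del j by move=> /mmS; rewrite subr_ge0.
have sumdel : \sum_(0 <= j < K) del j = Mt.
  by rewrite telescope_sumr// /mm eqxx ltnn (gtn_eqF K0).
pose gg j := P (knot K j.+1) - P (knot K j).
have gg0 j : 0 <= gg j by rewrite subr_ge0 Pnd// knot_nd.
have P0 : P 0 = 0 by exact: prim_le0.
have sumgg : \sum_(0 <= j < K) gg j = Gt.
  by rewrite telescope_sumr// knot1// knot0 P0 subr0.
pose a j := (G (knot K j.+1) - G (knot K j)) * K%:R.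
have aK j : `|a j / K%:R| <= gg j.
  by rewrite /a mulfK ?gt_eqF//; apply: prim_norm; exact: knot_nd.
pose sg j := Num.min (a j) gamma.
pose rh j := a j / K%:R + del j - sg j / K%:R.
have rh0 j : (j < K)%N -> 0 <= rh j.
  move=> /del0 d0; rewrite /rh; have : sg j / K%:R <= a j / K%:R.
    by rewrite ler_pM2r// ge_min lexx.
  lra.
have sgK j : `|sg j / K%:R| <= gg j + gamma / K%:R.
  have := aK j; rewrite /sg; case: (leP (a j) gamma) => h.
    have : 0 <= gamma / K%:R by apply: divr_ge0; apply: ltW.
    lra.
  rewrite [`|gamma / _|]ger0_norm; last by apply: divr_ge0; apply: ltW.
  by have := gg0 j; lra.
(* Mixing lowers the total increment by [th * (l - sstar)]; one half is added as a jump at 0 and the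
   other half remains as a gap below [l] at 1. *)
pose e := th * (l - sstar) / 2.
have e0 : 0 < e by rewrite divr_gt0// mulr_gt0//; lra.
pose sigma j := (1 - th) * sg j + th * sstar.
pose rho j := (1 - th) * rh j + (if j == 0%N then e else 0).
pose b j := 2 * del j + 4 * gg j + 2 * (gamma / K%:R) + th * (C0 + l).
have m1 : m (-1) = 0.
  by have := wE (-1); rewrite w0 ?ltrN10// -/(prim g (-1)) prim_le0 ?lerN10// addr0.
have m2 : m 2 + G 1 = l.
  have := wE 2; rewrite wl; last by lra.
  rewrite -/(prim g 2) prim_ge1; last by lra.
  by rewrite /G prim_ge1.
have G0 : G 0 = 0 by exact: prim_le0.
have sumag j : (j <= K)%N ->
    \sum_(0 <= i < j) (a i / K%:R + del i) = G (knot K j) + mm j.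
  move=> jK; rewrite big_split/= telescope_sumr// /mm eqxx m1 subr0.
  congr (_ + _).
  have <- : \sum_(0 <= i < j) (G (knot K i.+1) - G (knot K i)) = G (knot K j).
    by rewrite telescope_sumr// knot0 G0 subr0.
  by apply: eq_bigr => i _; rewrite /a mulfK// gt_eqF.
have sumrs : \sum_(0 <= j < K) rh j + \sum_(0 <= j < K) sg j / K%:R = l.
  rewrite -big_split/=.
  under eq_bigr do rewrite /rh subrK.
  by rewrite sumag// knot1// /mm ltnn (gtn_eqF K0) addrC.
have cellK (c : R) : \sum_(0 <= j < K) c / K%:R = c.
  by rewrite sumr_const_nat subn0 -[LHS]mulr_natr divfK// gt_eqF.
have sumsigma : \sum_(0 <= j < K) sigma j / K%:R =
    (1 - th) * (\sum_(0 <= j < K) sg j / K%:R) + th * sstar.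
  rewrite -[th * sstar]cellK mulr_sumr -big_split/=; apply: eq_bigr => j _.
  by rewrite /sigma; ring.
have sumrho : \sum_(0 <= j < K) rho j = (1 - th) * (\sum_(0 <= j < K) rh j) + e.
  rewrite big_split/= -mulr_sumr; congr (_ + _).
  by rewrite big_ltn//= big_nat big1 ?addr0// => -[].
have Fa j : (j < K)%N -> (F (a j) < +oo)%E.
  move=> jK; rewrite ltey; apply/eqP => Fa.
  have : ((K%:R^-1)%:E * F (a j) <= E%:E)%E.
    apply: le_trans (cell_sum K0).
    rewrite (bigD1_seq j); [|by rewrite mem_index_iota jK|exact: iota_uniq].
    apply: leeDl; apply: sume_ge0 => i _.
    by rewrite mule_ge0// lee_fin ltW.
  by rewrite Fa gt0_muley ?lte_fin.
have Fsg j : F (sg j) = F (a j) by rewrite /sg -F_min.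
have Fsigma j : (F (sigma j) <= F (a j) + (th * fs)%:E)%E.
  have t01 : 0 <= 1 - th <= 1 by rewrite subr_ge0 th1 gerBl ltW.
  have := F_convex (sg j) sstar t01; rewrite subKr => /le_trans; apply.
  rewrite fsE -EFinM leeD2r// Fsg.
  rewrite -[leRHS]mul1e; apply: lee_wpmul2r => //.
  by rewrite lee_fin lerBlDr lerDl ltW.
exists K, sigma, rho, b; split => //.
- move=> j jK; split.
    have sgg : sg j <= gamma by rewrite ge_min lexx orbT.
    rewrite /sigma; have h1 : 0 <= 1 - th by rewrite subr_ge0.
    rewrite [leRHS](_ : _ = (1 - th) * gamma + th * gamma); last by ring.
    by apply: lerD; [exact: ler_wpM2l|apply: ler_wpM2l => //; exact: ltW].
  apply: le_lt_trans (Fsigma j) _.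
  by rewrite lte_add_pinfty ?ltry// Fa.
- split.
  + move=> j /rh0 rhj; rewrite /rho; apply: addr_ge0.
      by apply: mulr_ge0 => //; rewrite subr_ge0.
    by case: ifP => // _; exact: ltW.
  + rewrite /rho eqxx; apply: ltr_wpDl => //; apply: mulr_ge0; last exact: rh0.
    by rewrite subr_ge0.
  + rewrite sumrho sumsigma.
    have -> : \sum_(0 <= j < K) rh j = l - \sum_(0 <= j < K) sg j / K%:R by lra.
    by move: e0; rewrite /e; lra.
- apply: (@le_trans _ _ (\sum_(0 <= j < K) ((K%:R^-1)%:E * F (a j) + (th * fs / K%:R)%:E))%E).
    apply: lee_sum => j _.
    have := lee_wpmul2l (_ : (0 <= (K%:R^-1)%:E :> \bar R)%E) (Fsigma j).
    rewrite lee_fin => /(_ (ltW Ki0)) /le_trans; apply.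
    rewrite ge0_muleDr; [|exact: F_ge0|by rewrite lee_fin (mulr_ge0 (ltW th0))].
    by rewrite leeD2l// -EFinM mulrC.
  rewrite big_split/= sumEFin cellK EFinD; apply: leeD; first exact: cell_sum.
  rewrite lee_fin; apply: le_trans (_ : eps / 2 <= _); last by rewrite ler_pdivrMr// ler_peMr ?ler1n// ltW.
  apply: le_trans theps; rewrite ler_pM2l// -subr_ge0 [leRHS](_ : _ = C0 + l + 1); last by ring.
  by apply: addr_ge0 => //; apply: addr_ge0 => //; exact: ltW.
have gK0 : 0 < gamma / K%:R by rewrite divr_gt0.
have gK1 : gamma / K%:R <= gamma.
  by rewrite ler_pdivrMr// -[leLHS]mulr1 ler_pM2l// ler1n.
split.
- move=> j jK; have := del0 _ jK; have := gg0 j.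
  have := mulr_ge0 (ltW th0) (addr_ge0 C00 (ltW l_gt0)).
  move=> h h1 h2; rewrite /b !addr_ge0// ?mulr_ge0//; exact: ltW.
- have -> : \sum_(0 <= j < K) b j / K%:R = N0 / K%:R + th * (C0 + l).
    transitivity ((2 * \sum_(0 <= j < K) del j + 4 * \sum_(0 <= j < K) gg j) / K%:R +
        \sum_(0 <= j < K) (2 * gamma / K%:R + th * (C0 + l)) / K%:R).
      rewrite !mulr_sumr -big_split/= mulr_suml -big_split/=.
      by apply: eq_bigr => j _; rewrite /b; ring.
    by rewrite sumdel sumgg cellK /N0; ring.
  have : th * (C0 + l) <= th * (C0 + l + fs + 1) by rewrite ler_pM2l// -[leRHS]addrA lerDl addr_ge0.
  by move=> h; rewrite [leRHS]splitr; apply: lerD => //; exact: le_trans h _.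
apply: (ae_imply wu) => x wux j jK jx.
have x01 : 0 < x < 1.
  have /andP[j0 j1] := knot01 _ (ltnW jK); have /andP[i0 i1] := knot01 _ jK.
  by case/andP: jx => jx xj; rewrite (le_lt_trans j0)// (lt_le_trans xj).
rewrite -wux; last by rewrite /= in_itv.
have jx' : knot K j <= x < knot K j.+1 by case/andP: jx => /ltW -> ->.
rewrite (@jump_pl_in _ K sigma rho j)//.
have /andP[j0 j1] := knot01 _ (ltnW jK).
pose y := x - knot K j.
have y0 : 0 <= y by rewrite subr_ge0; case/andP: jx'.
have yK : y <= K%:R^-1 by rewrite -(knotS K j) lerD2r ltW//; case/andP: jx'.
(* The profile is the combination [(1 - th) * A + th * B], with [B] the affine function of slope
   [sstar] starting from the jump [(l - sstar) / 2]. *)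
pose A := G (knot K j) + mm j + rh j + sg j * y.
pose B := (l - sstar) / 2 + sstar * x.
have -> : \sum_(0 <= i < j.+1) rho i + (\sum_(0 <= i < j) sigma i / K%:R + sigma j * (x - knot K j))
    = A + th * (B - A).
  have h1 : \sum_(0 <= i < j.+1) rho i = (1 - th) * (\sum_(0 <= i < j.+1) rh i) + e.
    rewrite big_split/= -mulr_sumr; congr (_ + _).
    by rewrite big_ltn//= big_nat big1 ?addr0// => -[].
  have h2 : \sum_(0 <= i < j) sigma i / K%:R =
      (1 - th) * (\sum_(0 <= i < j) sg i / K%:R) + th * sstar * knot K j.
    have -> : th * sstar * knot K j = \sum_(0 <= i < j) th * sstar / K%:R.
      by rewrite sumr_const_nat subn0 -[RHS]mulr_natr /knot; ring.
    rewrite mulr_sumr -big_split/=; apply: eq_bigr => i _.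
    by rewrite /sigma; ring.
  have h3 : \sum_(0 <= i < j) rh i + \sum_(0 <= i < j) sg i / K%:R = G (knot K j) + mm j.
    by rewrite -sumag ?(ltnW jK)// -big_split/=; apply: eq_bigr => i _; rewrite /rh subrK.
  have h4 : \sum_(0 <= i < j) sg i / K%:R = G (knot K j) + mm j - \sum_(0 <= i < j) rh i by rewrite -h3; ring.
  by rewrite h1 h2 big_nat_recr//= h4 /A /B /e /sigma /y; field.
have mmj : m (-1) <= mm j <= m 2.
  have [h1 h2] := wide _ (knot01 _ (ltnW jK)).
  by rewrite /mm jK; case: ifP => _; rewrite ?lexx !mnd// (le_trans h1).
have mmj1 : mm j.+1 <= m 2.
  by rewrite /mm /=; case: ifP => // _; apply: mnd; have [] := wide _ (knot01 _ jK).
have delM : del j <= Mt by rewrite /del /Mt; apply: lerB => //; case/andP: mmj.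
have ggM : gg j <= Gt.
  have /andP[i0 i1] := knot01 _ jK.
  by rewrite /gg /Gt -[leRHS]subr0 -P0; apply: lerB; exact: Pnd.
have GxG : `|G x - G (knot K j)| <= gg j.
  case/andP: jx' => jx1 /ltW xj1; apply: le_trans (prim_norm jx1) _.
  by rewrite lerD2r; apply: Pnd.
have Gj : `|G (knot K j)| <= Gt.
  have := prim_norm j0; rewrite -/G -/P G0 P0 !subr0 => /le_trans; apply.
  by apply: Pnd.
have sgy : `|sg j * y| <= gg j + gamma / K%:R.
  apply: le_trans (sgK j); rewrite !normrM ler_wpM2l//.
  by rewrite !ger0_norm// ltW.
have rhj : rh j <= 2 * gg j + del j + gamma / K%:R.
  have := aK j; have := sgK j; rewrite !ler_norml /rh => /andP[s1 _] /andP[_ a2].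
  rewrite [leRHS](_ : _ = gg j + del j + (gg j + gamma / K%:R)); last by ring.
  by apply: lerD; [apply: lerD|rewrite lerNl].
have rhj0 := rh0 _ jK.
have /andP[mx1 mx2] := mm_x _ _ jK jx.
have wxE : w x = m x + G x by rewrite wE.
have AW : `|A - w x| <= 2 * del j + 4 * gg j + 2 * (gamma / K%:R).
  have -> : A - w x = (G (knot K j) - G x) + (mm j - m x) + rh j + sg j * y.
    by rewrite /A wxE; ring.
  have -> : 2 * del j + 4 * gg j + 2 * (gamma / K%:R) =
    gg j + del j + (2 * gg j + del j + gamma / K%:R) + (gg j + gamma / K%:R) by ring.
  apply: le_trans (ler_normD _ _) _; apply: lerD => //.
  apply: le_trans (ler_normD _ _) _; apply: lerD; last by rewrite ger0_norm.
  apply: le_trans (ler_normD _ _) _; apply: lerD; first by rewrite distrC.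
  by rewrite ler0_norm ?subr_le0// opprB lerB.
have AC : `|A| <= C0.
  have -> : C0 = Gt + Mt + (2 * Gt + Mt + gamma) + (Gt + gamma) by rewrite /C0; ring.
  apply: le_trans (ler_normD _ _) _; apply: lerD; last by apply: le_trans sgy _; exact: lerD.
  apply: le_trans (ler_normD _ _) _; apply: lerD; last first.
    rewrite ger0_norm//; apply: le_trans rhj _; apply: lerD => //; apply: lerD => //.
    by rewrite ler_pM2l.
  apply: le_trans (ler_normD _ _) _; apply: lerD => //.
  by rewrite /Mt m1 subr0; move: mmj; rewrite m1 => /andP[? ?]; rewrite ger0_norm.
have BC : `|B| <= l.
  case/andP: x01 => x0 x1; have sx0 := mulr_ge0 (ltW ss0) (ltW x0).
  have sl : sstar <= l by rewrite (le_trans ssl)// ler_pdivrMr// ler_peMr ?ler1n// ltW.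
  rewrite /B ger0_norm; last by rewrite addr_ge0// divr_ge0// subr_ge0.
  rewrite [leRHS]splitr; apply: lerD; first by rewrite ler_pM2r// gerBl ltW.
  by apply: le_trans ssl; rewrite ler_piMr ?ltW.
have thBA : `|th * (B - A)| <= th * (C0 + l).
  rewrite normrM (gtr0_norm th0) ler_pM2l//.
  by apply: le_trans (ler_normB _ _) _; rewrite addrC lerD.
have -> : A + th * (B - A) - w x = (A - w x) + th * (B - A) by ring.
by rewrite (le_trans (ler_normD _ _))// /b lerD.
Qed.
End macro.

(** * Discretization on a mesh of representative atoms *)

Section glue.
Context {R : realType}.
Variables (f : R -> R) (a b z u0 u1 l : R).

Definition glue x : R := if x <= a then u0 * x else if b <= x then l - (1 - x) * u1 else f x.

Hypothesis a0 : 0 <= a.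
Hypothesis ab : a < b.
Hypothesis b1 : b <= 1.
Hypothesis zu0 : z <= u0.
Hypothesis zu1 : z <= u1.
Hypothesis f_incr : forall x y, 0 <= x -> x <= y -> y <= 1 -> z * (y - x) <= f y - f x.
Hypothesis f_left : forall y, a <= y <= b -> u0 * a + z * (y - a) <= f y.
Hypothesis f_right : forall x, a <= x <= b -> f x + z * (b - x) <= l - (1 - b) * u1.

(** Within one piece the bound is that of the piece; across [a] and [b] it is what [f_left] and
    [f_right] express, namely that the glued function does not drop there. *)
Lemma glue_incr x y : 0 <= x -> x <= y -> y <= 1 -> z * (y - x) <= glue y - glue x.
Proof.
have [a0' ab' b1' zu0' zu1'] := And5 a0 ab b1 zu0 zu1.
move=> x0 xy y1; rewrite /glue.
have [xa|ax] := leP x a; have [ya|ay] := leP y a.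
- have : 0 <= (u0 - z) * (y - x) by apply: mulr_ge0; lra.
  lra.
- have h1 : 0 <= (u0 - z) * (a - x) by apply: mulr_ge0; lra.
  have [yb|yb] := leP b y.
    have h2 : 0 <= (u1 - z) * (y - b) by apply: mulr_ge0; lra.
    have := f_left (y := b); have := f_right (x := b); rewrite lexx (ltW ab) => /(_ isT) + /(_ isT).
    lra.
  by have := f_left (y := y); rewrite (ltW ay) (ltW yb) => /(_ isT); lra.
- by lra.
- have [yb|yb] := leP b y; have [xb|xb] := leP b x.
  + have : 0 <= (u1 - z) * (y - x) by apply: mulr_ge0; lra.
    lra.
  + have h2 : 0 <= (u1 - z) * (y - b) by apply: mulr_ge0; lra.
    by have := f_right (x := x); rewrite (ltW ax) (ltW xb) => /(_ isT); lra.
  + by lra.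
  + exact: f_incr.
Qed.

Lemma glue_left x : x <= a -> glue x = u0 * x. Proof. by rewrite /glue => ->. Qed.

Lemma glue_right x : b <= x -> glue x = l - (1 - x) * u1.
Proof. by move=> bx; rewrite /glue bx leNgt (lt_le_trans ab bx). Qed.

Lemma glue_mid x : a < x < b -> glue x = f x.
Proof. by move=> /andP[ax xb]; rewrite /glue leNgt ax/= leNgt xb. Qed.

End glue.

Section mesh.
Context {R : realType}.
Variables (n r p : nat) (t : nat -> nat).
Hypothesis n_gt0 : (0 < n)%N.
Hypothesis t0 : t 0%N = 0%N.
Hypothesis tr : t r = n.
Hypothesis t_lt : forall i, (i < r)%N -> (t i < t i.+1)%N.
Hypothesis t_gap : forall i, (i < r)%N -> (t i.+1 - t i <= p)%N.
Variables (K : nat) (sigma rho : nat -> R) (z u0 u1 l : R).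
Hypothesis K0 : (0 < K)%N.
Hypothesis rho_ge0 : forall j, (j < K)%N -> 0 <= rho j.
Hypothesis sigma_ge : forall j, (j < K)%N -> z <= sigma j.
Hypothesis zu0 : z <= u0.
Hypothesis zu1 : z <= u1.
Let lambda : R := lam R n.
Let eta : R := lambda * p%:R.
Hypothesis eta_small : 4 * eta < 1.
Hypothesis eta_left : (u0 - z) * eta <= rho 0%N.
Hypothesis eta_right : (u1 - z) * eta <=
  l - (\sum_(0 <= j < K) rho j + \sum_(0 <= j < K) sigma j / K%:R).

(** Capping the index at [r] makes the sequence nondecreasing for all indices, as the results on
    [pl] require. *)
Definition mesh_node e : R := (t (minn e r))%:R * lambda.

Let lambda_gt0 : 0 < lambda. Proof. by rewrite invr_gt0 ltr0n. Qed.

Let nlambda : n%:R * lambda = 1.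
Proof. by rewrite /lambda /lam mulfV// gt_eqF// ltr0n. Qed.

Let r_gt0 : (0 < r)%N.
Proof. by rewrite lt0n; apply/eqP => r0; move: n_gt0; rewrite -tr r0 t0. Qed.

Lemma mesh_nodeE e : (e <= r)%N -> mesh_node e = (t e)%:R * lambda.
Proof. by move=> er; rewrite /mesh_node (minn_idPl er). Qed.

Lemma mesh_node_nd e : mesh_node e <= mesh_node e.+1.
Proof.
rewrite /mesh_node; case: (boolP (e < r)%N) => [er|]; last rewrite -leqNgt => re.
  by rewrite (minn_idPl er) (minn_idPl (ltnW er)) ler_pM2r// ler_nat ltnW// t_lt.
by rewrite (minn_idPr re) (minn_idPr (leqW re)).
Qed.

Lemma mesh_node0 : mesh_node 0 = 0. Proof. by rewrite mesh_nodeE// t0 mul0r. Qed.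
Lemma mesh_noder : mesh_node r = 1. Proof. by rewrite mesh_nodeE// tr. Qed.

Lemma mesh_node_lt e : (e < r)%N -> mesh_node e < mesh_node e.+1.
Proof.
move=> er; rewrite (mesh_nodeE er) (mesh_nodeE (ltnW er)) (ltr_pM2r lambda_gt0) ltr_nat.
exact: t_lt.
Qed.

Lemma mesh_node_gap e : (e < r)%N -> mesh_node e.+1 - mesh_node e <= eta.
Proof.
move=> er; rewrite (mesh_nodeE er) (mesh_nodeE (ltnW er)) -mulrBl.
rewrite -natrB; last exact: ltnW (t_lt er).
by rewrite /eta mulrC (ler_pM2l lambda_gt0) ler_nat; exact: t_gap.
Qed.

Lemma mesh_node01 e : 0 <= mesh_node e <= 1.
Proof.
apply/andP; split; first by rewrite -mesh_node0; apply: tau_homo => //; exact: mesh_node_nd.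
case: (boolP (e <= r)%N) => [er|]; last rewrite -ltnNge => re.
  by rewrite -mesh_noder; apply: tau_homo => //; exact: mesh_node_nd.
by rewrite /mesh_node (minn_idPr (ltnW re)) tr nlambda.
Qed.

Lemma find_element i : (i < n)%N -> exists2 e, (e < r)%N & (t e <= i < t e.+1)%N.
Proof.
move=> iN; have ex : exists e, (i < t e)%N by exists r; rewrite tr.
case: (ex_minnP ex) => -[|e]; first by rewrite t0.
move=> ie emin; exists e; last first.
  by rewrite ie andbT leqNgt; apply/negP => /emin; rewrite ltnn.
by rewrite -ltnS; apply: emin; rewrite tr.
Qed.

(* The profile starts with slope [u0] and ends with slope [u1] on the two outermost elements,
   so that its interpolant satisfies the boundary conditions. *)
Definition profile := glue (jump_pl K sigma rho) (mesh_node 1) (mesh_node r.-1) u0 u1 l.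

Let node1 : 0 < mesh_node 1 <= eta.
Proof. by have := mesh_node_lt r_gt0; have := mesh_node_gap r_gt0; rewrite mesh_node0 subr0 => -> ->. Qed.

Let noder1 : 1 - eta <= mesh_node r.-1 < 1.
Proof.
have rr : (r.-1 < r)%N by rewrite prednK.
have := mesh_node_lt rr; have := mesh_node_gap rr; rewrite prednK// mesh_noder => h ->.
by rewrite andbT; lra.
Qed.

Lemma profile_incr x y : 0 <= x -> x <= y -> y <= 1 -> z * (y - x) <= profile y - profile x.
Proof.
have /andP[n10 n1e] := node1; have /andP[nre nr1] := noder1.
have [es el er' zu0' zu1'] := And5 eta_small eta_left eta_right zu0 zu1.
apply: glue_incr => //; try lra.
- exact: jump_pl_incr.
- move=> y' /andP[h1 h2].
  have : rho 0%N + z * y' <= jump_pl K sigma rho y'.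
    by apply: jump_pl_ge => //; apply/andP; split; lra.
  have : (u0 - z) * mesh_node 1 <= (u0 - z) * eta by rewrite ler_wpM2l// subr_ge0.
  lra.
- move=> x' /andP[h1 h2].
  have : jump_pl K sigma rho x' <= \sum_(0 <= j < K) rho j + \sum_(0 <= j < K) sigma j / K%:R - z * (1 - x').
    by apply: jump_pl_le => //; apply/andP; split; lra.
  have : (u1 - z) * (1 - mesh_node r.-1) <= (u1 - z) * eta by rewrite ler_wpM2l ?subr_ge0//; lra.
  lra.
Qed.

Definition element_slope e : R := (profile (mesh_node e.+1) - profile (mesh_node e)) / (mesh_node e.+1 - mesh_node e).
Definition discr := pl mesh_node element_slope r.

Lemma element_slope_ge e : (e < r)%N -> z <= element_slope e.
Proof.
move=> er; have h := mesh_node_lt er; rewrite /element_slope ler_pdivlMr ?subr_gt0//.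
have /andP[? _] := mesh_node01 e; have /andP[_ ?] := mesh_node01 e.+1.
by apply: profile_incr => //; exact: ltW.
Qed.

Lemma profile0 : profile 0 = 0.
Proof. by rewrite /profile glue_left ?mulr0//; case/andP: (mesh_node01 1). Qed.

Lemma discr_node e : (e <= r)%N -> discr (mesh_node e) = profile (mesh_node e).
Proof.
move=> er; rewrite /discr (pl_node mesh_node_nd)//.
have -> : profile (mesh_node e) = profile (mesh_node e) - profile (mesh_node 0) by rewrite mesh_node0 profile0 subr0.
rewrite -(telescope_sumr (fun e => profile (mesh_node e)))//.
rewrite big_nat [RHS]big_nat; apply: eq_bigr => k /andP[_ ke].
rewrite /element_slope divfK// subr_eq0 gt_eqF//.
by apply: mesh_node_lt; exact: leq_trans er.
Qed.

Lemma discr_in e x : (e < r)%N -> mesh_node e <= x <= mesh_node e.+1 ->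
  discr x = profile (mesh_node e) + element_slope e * (x - mesh_node e).
Proof.
move=> er ex; rewrite /discr (pl_in mesh_node_nd _ er ex); congr (_ + _).
by rewrite -(pl_node mesh_node_nd element_slope (ltnW er)) -/discr; apply: discr_node; exact: ltnW.
Qed.

Lemma discr_in_A : in_A_T n r t discr.
Proof.
move=> e er x; rewrite -(mesh_nodeE (ltnW er)) -(mesh_nodeE er) => ex.
rewrite (discr_in er ex) discr_node ?(ltnW er)// discr_node// /element_slope.
have -> : ((t e.+1)%:R - (t e)%:R) * lam R n = mesh_node e.+1 - mesh_node e.
  by rewrite (mesh_nodeE er) (mesh_nodeE (ltnW er)) mulrBl.
by ring.
Qed.

(** The outermost elements contain at least one atomic cell each, and on them the interpolant is
    affine with slope [u0], respectively [u1]. *)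
Lemma discr_BC : BC n l u0 u1 discr.
Proof.
have /andP[n10 n1e] := node1; have /andP[nre nr1] := noder1.
have [es el er' zu0' zu1'] := And5 eta_small eta_left eta_right zu0 zu1.
have rr : (r.-1 < r)%N by rewrite prednK.
have rE : r.-1.+1 = r by rewrite prednK.
have lam1 : lambda <= mesh_node 1.
  rewrite mesh_nodeE// -{1}(mul1r lambda) ler_pM2r// ler1n.
  by have := t_lt r_gt0; rewrite t0.
have n1lam : n.-1%:R * lambda = 1 - lambda.
  have h : n.-1%:R + 1 = n%:R :> R by rewrite natr1 prednK.
  by have := nlambda; rewrite -h mulrDl mul1r; move: (_ * lambda) => q; lra.
have lamr : mesh_node r.-1 <= 1 - lambda.
  have := t_lt rr; rewrite rE tr => tn.
  rewrite mesh_nodeE ?leq_pred// -n1lam ler_pM2r// ler_nat -ltnS prednK//.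
split; first by rewrite -[X in discr X]mesh_node0 discr_node// mesh_node0 profile0.
split.
  rewrite (@discr_in 0)//; last by rewrite mesh_node0 ltW.
  rewrite mesh_node0 profile0 /element_slope mesh_node0 profile0 /profile glue_left// !subr0 add0r.
  by rewrite -/lambda; field; rewrite gt_eqF.
have yr1 : profile (mesh_node r.-1) = l - (1 - mesh_node r.-1) * u1.
  by rewrite /profile glue_right//; lra.
split.
  rewrite -/lambda n1lam (@discr_in r.-1)// ?rE ?mesh_noder; last by rewrite lamr/= gerBl ltW.
  rewrite /element_slope rE mesh_noder yr1 {1}/profile glue_right//; try lra.
  rewrite subrr mul0r subr0; field.
  by rewrite gt_eqF// subr_gt0.
rewrite -/lambda nlambda -mesh_noder discr_node// mesh_noder /profile glue_right//; lra.
Qed.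

Lemma discr_incr x y : 0 <= x -> x <= y -> y <= 1 -> z * (y - x) <= discr y - discr x.
Proof.
move=> x0 xy y1; have := pl_incr mesh_node_nd xy element_slope_ge.
by rewrite mesh_node0 mesh_noder !seg01 !clamp_id ?x0 ?y1 ?(le_trans x0)// (le_trans xy).
Qed.

(** An element has length at most [eta]. If it contains a point farther than [2 * eta] from every
    knot, it lies inside one macroscopic interval and is not outermost, so the profile is affine on
    it and interpolation is exact. *)
Lemma good_element e x : (e < r)%N -> mesh_node e <= x <= mesh_node e.+1 ->
  (forall j, (j <= K)%N -> 2 * eta < `|x - knot K j|) ->
  exists j, [/\ (j < K)%N, knot K j < mesh_node e, mesh_node e.+1 < knot K j.+1,
    element_slope e = sigma j & discr x = jump_pl K sigma rho x].
Proof.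
move=> er ex far.
have /andP[n10 n1e] := node1; have /andP[nre nr1] := noder1.
have [es el er' zu0' zu1'] := And5 eta_small eta_left eta_right zu0 zu1.
have /andP[ex1 ex2] := ex.
have /andP[e0 _] := mesh_node01 e; have /andP[_ e1] := mesh_node01 e.+1.
have gap := mesh_node_gap er; have elt := mesh_node_lt er.
have eta0 : 0 < eta by lra.
have x_gt : 2 * eta < x.
  by have := far 0%N (leq0n _); rewrite knot0 subr0 ger0_norm//; lra.
have x_lt : x < 1 - 2 * eta.
  have := far K (leqnn _); rewrite knot1// ler0_norm; lra.
pose j := Num.truncn (x * K%:R).
have K0' : 0 < K%:R :> R by rewrite ltr0n.
have /andP[j1 j2] : j%:R <= x * K%:R < j.+1%:R by apply: truncn_itv; rewrite mulr_ge0//; lra.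
have jx : knot K j <= x by rewrite /knot ler_pdivrMr.
have xj : x < knot K j.+1 by rewrite /knot ltr_pdivlMr.
have jK : (j < K)%N.
  by rewrite -(ltr_nat R) (le_lt_trans j1)// gtr_pMl//; lra.
have far1 := far j (ltnW jK); rewrite ger0_norm ?subr_ge0// in far1.
have far2 := far j.+1 jK; rewrite ltr0_norm ?subr_lt0// in far2.
exists j; have je : knot K j < mesh_node e by lra.
have ej : mesh_node e.+1 < knot K j.+1 by lra.
have jump_plE y : knot K j <= y -> y < knot K j.+1 -> jump_pl K sigma rho y =
   \sum_(0 <= i < j.+1) rho i + (\sum_(0 <= i < j) sigma i / K%:R + sigma j * (y - knot K j)).
  by move=> h1 h2; apply: jump_pl_in => //; rewrite h1.
have yE y : mesh_node e <= y <= mesh_node e.+1 -> profile y = jump_pl K sigma rho y.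
  by move=> /andP[h1 h2]; rewrite /profile glue_mid//; apply/andP; split; lra.
have Se : element_slope e = sigma j.
  rewrite /element_slope !yE; [|by apply/andP; split; lra..].
  rewrite (@jump_plE (mesh_node e.+1)); [|lra|lra]; rewrite (@jump_plE (mesh_node e)); [|lra|lra].
  by field; rewrite gt_eqF// subr_gt0.
split => //; rewrite (discr_in er ex) Se yE; last by apply/andP; split; lra.
rewrite (@jump_plE x); [|lra|lra]; rewrite (@jump_plE (mesh_node e)); [|lra|lra]; by ring.
Qed.

(** * Energy of the interpolant *)

Section energy.
Variables (phi1 phi2 F : R -> \bar R) (C : R) (k1 k2 : nat).
Hypothesis phi1_ge0 : forall y, (0 <= phi1 y)%E.
Hypothesis phi2_ge0 : forall y, (0 <= phi2 y)%E.
Hypothesis phi1_le : forall y, z <= y -> (phi1 y <= C%:E)%E.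
Hypothesis phi2_le : forall y, z <= y -> (phi2 y <= C%:E)%E.
Hypothesis F_sigma : forall j, (j < K)%N -> F (sigma j) = (phi1 (sigma j) + phi2 (sigma j))%E.
Hypothesis k12 : (k1 < k2)%N.
Hypothesis k2n : (k2 < n)%N.

Let U i := discr (i%:R * lambda).
Let a1 i := (U i.+1 - U i) / lambda.
Let a2 i := (U i.+2 - U i) / (2 * lambda).
Let f1 y := fine (phi1 y).
Let f2 y := fine (phi2 y).

Let phi1E y : z <= y -> phi1 y = (f1 y)%:E.
Proof.
by move=> zy; rewrite fineK// ge0_fin_numE// (le_lt_trans (phi1_le zy)) ?ltry.
Qed.

Let phi2E y : z <= y -> phi2 y = (f2 y)%:E.
Proof.
by move=> zy; rewrite fineK// ge0_fin_numE// (le_lt_trans (phi2_le zy)) ?ltry.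
Qed.

Let f1_ge0 y : 0 <= f1 y. Proof. exact: fine_ge0. Qed.
Let f2_ge0 y : 0 <= f2 y. Proof. exact: fine_ge0. Qed.
Let f1_le y : z <= y -> f1 y <= C.
Proof. by move=> zy; rewrite -lee_fin -phi1E// phi1_le. Qed.
Let f2_le y : z <= y -> f2 y <= C.
Proof. by move=> zy; rewrite -lee_fin -phi2E// phi2_le. Qed.

Let ilambda i : (i <= n)%N -> i%:R * lambda <= 1.
Proof. by move=> iN; rewrite -[leRHS]nlambda (ler_pM2r lambda_gt0) ler_nat. Qed.

Let a1_ge i : (i < n)%N -> z <= a1 i.
Proof.
move=> iN; rewrite /a1 ler_pdivlMr//.
have := @discr_incr (i%:R * lambda) (i.+1%:R * lambda).
have -> : i.+1%:R * lambda - i%:R * lambda = lambda by rewrite -natr1; ring.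
apply; rewrite ?ilambda// ?ler_pM2r ?ler_nat//.
by apply: mulr_ge0 => //; exact: ltW.
Qed.

Let a2_ge i : (i.+1 < n)%N -> z <= a2 i.
Proof.
move=> iN; rewrite /a2 ler_pdivlMr ?mulr_gt0//.
have := @discr_incr (i%:R * lambda) (i.+2%:R * lambda).
have -> : i.+2%:R * lambda - i%:R * lambda = 2 * lambda by rewrite -!natr1; ring.
apply; rewrite ?ilambda// ?ler_pM2r ?ler_nat//.
  by apply: mulr_ge0 => //; exact: ltW.
exact: leqW.
Qed.

Let lambda_eta : lambda <= eta.
Proof.
rewrite /eta -{1}(mulr1 lambda) ler_pM2l// ler1n.
by apply: leq_trans (t_gap r_gt0); rewrite subn_gt0 t_lt.
Qed.

Let sub_sum (q : nat -> R) a b : (forall i, 0 <= q i) -> (b <= n)%N ->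
  \sum_(a <= i < b) q i <= \sum_(0 <= i < n) q i.
Proof.
move=> q0 bn; have s0 c d : 0 <= \sum_(c <= i < d) q i by apply: sumr_ge0.
have [ab|ba] := leqP a b; last by rewrite big_geq// ltnW.
rewrite [leRHS](@big_cat_nat _ _ _ a)//=; last exact: leq_trans bn.
rewrite [X in _ + X](@big_cat_nat _ _ _ b)//=.
by rewrite addrCA lerDl addr_ge0.
Qed.

(* [ov] and [om] measure how much of a cell lies in a macroscopic interval, respectively near
   a knot, where only the bound [C] on the potentials is available. *)
Let ov j (x : R) := seg (knot K j) (knot K j.+1) x.
Let om j x := seg (knot K j - 3 * eta) (knot K j + 3 * eta) x.

Let C_ge0 : 0 <= C.
Proof. by have := f1_le (lexx z); have := f1_ge0 z; apply: le_trans. Qed.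

Let eta_gt0 : 0 < eta. Proof. exact: lt_le_trans lambda_eta. Qed.

Let om_nd j : knot K j - 3 * eta <= knot K j + 3 * eta.
Proof. by have := eta_gt0; lra. Qed.

(** A cell starting within [2 * eta] of a knot lies within [3 * eta] of it, since [lambda <= eta]:
    the increment of [om] is then the full [lambda], and the bound [C] on each potential suffices.
    Any other cell has slope [sigma j] and lies in the [j]-th interval, so there the increment of
    [ov] is [lambda]. *)
Let local_bound i : (i < n)%N -> lambda * (f1 (a1 i) + f2 (a1 i)) <=
  \sum_(0 <= j < K) (ov j (i.+1%:R * lambda) - ov j (i%:R * lambda)) * fine (F (sigma j)) +
  2 * C * \sum_(0 <= j < K.+1) (om j (i.+1%:R * lambda) - om j (i%:R * lambda)).
Proof.
move=> iN.
have iS : i.+1%:R * lambda = i%:R * lambda + lambda by rewrite -natr1; ring.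
have ii : i%:R * lambda <= i.+1%:R * lambda by rewrite ler_pM2r// ler_nat.
have ov0 j : 0 <= ov j (i.+1%:R * lambda) - ov j (i%:R * lambda).
  by rewrite subr_ge0; apply: seg_homo ii; exact: knot_nd.
have om0 j : 0 <= om j (i.+1%:R * lambda) - om j (i%:R * lambda).
  by rewrite subr_ge0; apply: seg_homo ii.
have fF0 j : (j < K)%N -> 0 <= fine (F (sigma j)).
  by move=> jK; apply: fine_ge0; rewrite F_sigma// adde_ge0.
have S1 : 0 <= \sum_(0 <= j < K) (ov j (i.+1%:R * lambda) - ov j (i%:R * lambda)) * fine (F (sigma j)).
  by rewrite big_nat; apply: sumr_ge0 => j /andP[_ jK]; rewrite mulr_ge0// fF0.
have S2 : 0 <= \sum_(0 <= j < K.+1) (om j (i.+1%:R * lambda) - om j (i%:R * lambda)).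
  exact: sumr_ge0.
have le_eta := lambda_eta.
have [[j jK near]|far] := pselect (exists2 j, (j <= K)%N & `|i%:R * lambda - knot K j| <= 2 * eta).
  apply: (@le_trans _ _ (2 * C * (om j (i.+1%:R * lambda) - om j (i%:R * lambda)))).
    move: near; rewrite ler_norml => /andP[h1 h2].
    rewrite /om !seg_in//; [|by apply/andP; split; lra..].
    have -> : i.+1%:R * lambda - (knot K j - 3 * eta) - (i%:R * lambda - (knot K j - 3 * eta)) = lambda.
      by rewrite iS; ring.
    rewrite mulrC ler_pM2r//.
    by have := f1_le (a1_ge iN); have := f2_le (a1_ge iN); lra.
  apply: ler_wpDl => //; apply: ler_wpM2l; first by rewrite mulr_ge0.
  rewrite [leRHS](bigD1_seq j); [|by rewrite mem_index_iota ltnS|exact: iota_uniq].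
  by rewrite lerDl; apply: sumr_ge0.
have {}far j : (j <= K)%N -> 2 * eta < `|i%:R * lambda - knot K j|.
  by move=> jK; rewrite ltNge; apply/negP => h; apply: far; exists j.
have [e er /andP[ei ie]] := find_element iN.
have ne1 : mesh_node e <= i%:R * lambda by rewrite mesh_nodeE ?(ltnW er)// ler_pM2r// ler_nat.
have ne2 : i.+1%:R * lambda <= mesh_node e.+1 by rewrite mesh_nodeE// ler_pM2r// ler_nat.
have exi : mesh_node e <= i%:R * lambda <= mesh_node e.+1 by rewrite ne1 (le_trans ii).
have exi1 : mesh_node e <= i.+1%:R * lambda <= mesh_node e.+1 by rewrite ne2 (le_trans ne1).
have [j [jK je ej Se _]] := good_element er exi far.
have a1E : a1 i = sigma j.
  rewrite /a1 /U (discr_in er exi) (discr_in er exi1) Se iS; field.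
  by rewrite gt_eqF.
have zs := sigma_ge jK.
have FE : f1 (a1 i) + f2 (a1 i) = fine (F (sigma j)).
  by rewrite a1E F_sigma// phi1E// phi2E.
apply: (@le_trans _ _ ((ov j (i.+1%:R * lambda) - ov j (i%:R * lambda)) * fine (F (sigma j)))).
  rewrite FE /ov !seg_in ?knot_nd//; [|by apply/andP; split; lra..].
  rewrite ler_wpM2r ?fF0//; lra.
apply: ler_wpDr; first by rewrite !mulr_ge0.
rewrite [leRHS](bigD1_seq j); [|by rewrite mem_index_iota|exact: iota_uniq].
rewrite lerDl big_seq_cond; apply: sumr_ge0 => k /andP[+ _].
by rewrite mem_index_iota => /andP[_ kK]; rewrite mulr_ge0// fF0.
Qed.

(** Summed over the cells, the overlaps telescope to at most [K%:R^-1] per interval and [6 * eta]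
    per knot. *)
Let local_sum : \sum_(0 <= i < n) lambda * (f1 (a1 i) + f2 (a1 i)) <=
  \sum_(0 <= j < K) K%:R^-1 * fine (F (sigma j)) + 2 * C * (K.+1%:R * (6 * eta)).
Proof.
have fF0 j : (j < K)%N -> 0 <= fine (F (sigma j)).
  by move=> jK; apply: fine_ge0; rewrite F_sigma// adde_ge0.
apply: (@le_trans _ _ (\sum_(0 <= i < n)
   (\sum_(0 <= j < K) (ov j (i.+1%:R * lambda) - ov j (i%:R * lambda)) * fine (F (sigma j)) +
  2 * C * \sum_(0 <= j < K.+1) (om j (i.+1%:R * lambda) - om j (i%:R * lambda))))).
  by rewrite big_nat [leRHS]big_nat; apply: ler_sum => i /andP[_ iN]; exact: local_bound.
rewrite big_split/= -mulr_sumr; apply: lerD.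
  rewrite exchange_big/= big_nat [leRHS]big_nat; apply: ler_sum => j /andP[_ jK].
  rewrite -mulr_suml (telescope_sumr (fun i => ov j (i%:R * lambda)))// nlambda mul0r.
  apply: ler_wpM2r; first exact: fF0.
  rewrite -[leRHS](knotS K j) /ov; have := seg_le 1 (knot_nd (R := R) K j).
  by have := seg_ge0 0 (knot_nd (R := R) K j); lra.
apply: ler_wpM2l; first by rewrite mulr_ge0.
rewrite exchange_big/=.
apply: (@le_trans _ _ (\sum_(0 <= j < K.+1) (6 * eta))).
  apply: ler_sum => j _.
  rewrite (telescope_sumr (fun i => om j (i%:R * lambda)))// nlambda mul0r.
  have := seg_le 1 (om_nd j); have := seg_ge0 0 (om_nd j); rewrite /om; lra.
by rewrite sumr_const_nat subn0 -[leLHS]mulr_natl.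
Qed.

(** In the boundary layers each term is charged [C]. In the local region a cell occurs in at most
    two averaged terms with weight one half, so these terms are dominated by the full sum over
    cells. *)
Lemma discr_energy : (QCenergy phi1 phi2 n k1 k2 discr <=
  \sum_(0 <= j < K) (K%:R^-1)%:E * F (sigma j) +
  (2 * C * (K.+1%:R * (6 * eta)) + C * (lambda * k1%:R + lambda * (n - k2)%:R))%:E)%E.
Proof.
rewrite /QCenergy -/lambda.
have -> : (\sum_(0 <= j < K) (K%:R^-1)%:E * F (sigma j) =
    (\sum_(0 <= j < K) K%:R^-1 * fine (F (sigma j)))%:E)%E.
  rewrite -sumEFin; rewrite big_nat [RHS]big_nat; apply: eq_bigr => j /andP[_ jK].
  rewrite EFinM fineK// F_sigma// phi1E ?sigma_ge// phi2E ?sigma_ge//.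
have -> : (\sum_(0 <= i < n) (lambda%:E * phi1 ((discr (i.+1%:R * lambda) - discr (i%:R * lambda)) / lambda)%R) =
    (\sum_(0 <= i < n) lambda * f1 (a1 i))%:E)%E.
  rewrite -sumEFin; rewrite big_nat [RHS]big_nat; apply: eq_bigr => i /andP[_ iN].
  by rewrite -/(U _) -/(U _) -/(a1 i) phi1E ?a1_ge.
have -> : (\sum_(0 <= i < k1) (lambda%:E * phi2 ((discr (i.+2%:R * lambda) - discr (i%:R * lambda)) / (2 * lambda))%R) =
    (\sum_(0 <= i < k1) lambda * f2 (a2 i))%:E)%E.
  rewrite -sumEFin; rewrite big_nat [RHS]big_nat; apply: eq_bigr => i /andP[_ ik].
  have iN : (i.+1 < n)%N by apply: leq_ltn_trans k2n; apply: leq_trans k12; exact: leqW.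
  by rewrite -/(U _) -/(U _) -/(a2 i) phi2E ?a2_ge.
have -> : (\sum_(k2.-1 <= i < n.-1) (lambda%:E * phi2 ((discr (i.+2%:R * lambda) - discr (i%:R * lambda)) / (2 * lambda))%R) =
    (\sum_(k2.-1 <= i < n.-1) lambda * f2 (a2 i))%:E)%E.
  rewrite -sumEFin; rewrite big_nat [RHS]big_nat; apply: eq_bigr => i /andP[_ ik].
  have iN : (i.+1 < n)%N by rewrite -ltnS prednK// in ik.
  by rewrite -/(U _) -/(U _) -/(a2 i) phi2E ?a2_ge.
have -> : (\sum_(k1 <= i < k2.-1) ((lambda / 2)%:E * (phi2 ((discr (i.+1%:R * lambda) - discr (i%:R * lambda)) / lambda)%R +
     phi2 ((discr (i.+2%:R * lambda) - discr (i.+1%:R * lambda)) / lambda)%R)) =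
    (\sum_(k1 <= i < k2.-1) lambda / 2 * (f2 (a1 i) + f2 (a1 i.+1)))%:E)%E.
  rewrite -sumEFin; rewrite big_nat [RHS]big_nat; apply: eq_bigr => i /andP[_ ik].
  have iN : (i.+1 < n)%N by apply: leq_trans k2n; rewrite ltnS (leq_trans ik)// leq_pred.
  rewrite -/(U _) -/(U _) -/(U _) -/(a1 i) -/(a1 i.+1) !phi2E ?a1_ge//.
  exact: ltnW.
rewrite -!EFinD lee_fin.
have k2_gt0 : (0 < k2)%N by exact: leq_ltn_trans k12.
have s2 : \sum_(0 <= i < k1) lambda * f2 (a2 i) <= C * (lambda * k1%:R).
  apply: (@le_trans _ _ (\sum_(0 <= i < k1) lambda * C)).
    rewrite big_nat [leRHS]big_nat; apply: ler_sum => i /andP[_ ik].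
    rewrite ler_pM2l// f2_le// a2_ge//.
    by apply: leq_ltn_trans k2n; apply: leq_trans k12; exact: leqW.
  by rewrite sumr_const_nat subn0 -[leLHS]mulr_natr; lra.
have s4 : \sum_(k2.-1 <= i < n.-1) lambda * f2 (a2 i) <= C * (lambda * (n - k2)%:R).
  apply: (@le_trans _ _ (\sum_(k2.-1 <= i < n.-1) lambda * C)).
    rewrite big_nat [leRHS]big_nat; apply: ler_sum => i /andP[_ ik].
    rewrite ler_pM2l// f2_le// a2_ge//.
    by rewrite -ltnS prednK// in ik.
  rewrite sumr_const_nat -[leLHS]mulr_natr.
  have -> : (n.-1 - k2.-1 = n - k2)%N by rewrite -subn1 -[in RHS](prednK k2_gt0) -subnDA add1n.
  by lra.
have s3 : \sum_(k1 <= i < k2.-1) lambda / 2 * (f2 (a1 i) + f2 (a1 i.+1)) <=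
    \sum_(0 <= i < n) lambda * f2 (a1 i).
  under eq_bigr do rewrite mulrDr.
  rewrite big_split/=.
  have h1 := @sub_sum (fun i => lambda / 2 * f2 (a1 i)) k1 k2.-1.
  have h2 := @sub_sum (fun i => lambda / 2 * f2 (a1 i)) k1.+1 k2.
  have q0 i : 0 <= lambda / 2 * f2 (a1 i) by rewrite mulr_ge0// divr_ge0// ltW.
  have {}h1 := h1 q0 (leq_trans (leq_pred _) (ltnW k2n)).
  have {}h2 := h2 q0 (ltnW k2n).
  rewrite big_add1/= in h2.
  apply: le_trans (lerD h1 h2) _.
  rewrite -big_split/=; apply: ler_sum => i _; lra.
have s13 := local_sum.
have : \sum_(0 <= i < n) lambda * f1 (a1 i) + \sum_(0 <= i < n) lambda * f2 (a1 i) =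
   \sum_(0 <= i < n) lambda * (f1 (a1 i) + f2 (a1 i)).
  by rewrite -big_split/=; apply: eq_bigr => i _; ring.
lra.
Qed.

End energy.

Lemma discr_ut_far x : 0 < x < 1 -> (forall j, (j <= K)%N -> 2 * eta < `|x - knot K j|) ->
  discr x = jump_pl K sigma rho x.
Proof.
move=> /andP[x0 x1] far.
pose i := Num.truncn (x * n%:R).
have n0 : 0 < n%:R :> R by rewrite ltr0n.
have /andP[i1 i2] : i%:R <= x * n%:R < i.+1%:R by apply: truncn_itv; rewrite mulr_ge0// ltW.
have iN : (i < n)%N by rewrite -(ltr_nat R) (le_lt_trans i1)// gtr_pMl.
have [e er /andP[ei ie]] := find_element iN.
have h1 : mesh_node e <= x.
  rewrite mesh_nodeE ?(ltnW er)//; apply: (@le_trans _ _ (i%:R * lambda)).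
    by rewrite ler_pM2r// ler_nat.
  by rewrite /lambda /lam ler_pdivrMr.
have h2 : x <= mesh_node e.+1.
  rewrite mesh_nodeE//; apply: (@le_trans _ _ (i.+1%:R * lambda)).
    by rewrite /lambda /lam ler_pdivlMr// ltW.
  by rewrite ler_pM2r// ler_nat.
have ex : mesh_node e <= x <= mesh_node e.+1 by rewrite h1.
by have [j [_ _ _ _ ->]] := good_element er ex far.
Qed.

(** Both functions have increments of at least [z] times the length, are nonnegative at 0 and at
    most [l] at 1, so both lie between [z * x] and [l - z * (1 - x)]. The bound serves near the
    knots, where the two functions differ. *)
Lemma discr_ut_bound x : 0 <= x <= 1 -> `|discr x - jump_pl K sigma rho x| <= 2 * (`|l| + `|z|).
Proof.
move=> x01; have /andP[x0 x1] := x01.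
have [es el er' zu0' zu1'] := And5 eta_small eta_left eta_right zu0 zu1.
have v1 := discr_incr (lexx 0) x0 x1; have v2 := discr_incr x0 x1 (lexx 1).
have v0 : discr 0 = 0 by case: discr_BC.
have v1E : discr 1 = l by case: discr_BC => _ [_ [_]]; rewrite -/lambda nlambda.
rewrite v0 in v1; rewrite v1E in v2.
have u1' := jump_pl_ge K0 rho_ge0 sigma_ge x01; have u2' := jump_pl_le K0 rho_ge0 sigma_ge x01.
have eta0 : 0 <= eta by rewrite /eta mulr_ge0// ltW.
have h1 : 0 <= (u0 - z) * eta by apply: mulr_ge0; lra.
have h2 : 0 <= (u1 - z) * eta by apply: mulr_ge0; lra.
have zx : `|z * x| <= `|z| by rewrite normrM ler_piMr// ger0_norm.
have zx1 : `|z * (1 - x)| <= `|z| by rewrite normrM ler_piMr// ger0_norm; lra.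
have := ler_norm l; have := normr_ge0 l; have := rho_ge0 K0.
move: zx zx1; rewrite !ler_norml => /andP[? ?] /andP[? ?] ? ? ?.
by apply/andP; split; lra.
Qed.

End mesh.

(** * Recovery sequences *)

Section recovery.
Context {R : realType}.
Local Notation leb := (@lebesgue_measure R).

Let D : set R := `[0, 1]%classic.
Let mD : measurable (D : set (measurableTypeR R)). Proof. exact: measurable_itv. Qed.

Lemma integral_indic_itv_le (a b c : R) (B : bool) (B' : bool) : 0 <= c -> a <= b ->
  (\int[leb]_(x in D) (c * \1_[set` Interval (BSide B a) (BSide B' b)] x)%:E <= (c * (b - a))%:E)%E.
Proof.
move=> c0 ab; set A : set R := [set` _].
have mA : measurable (A : set (measurableTypeR R)) by exact: measurable_itv.
under eq_integral do rewrite EFinM.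
rewrite ge0_integralZl_EFin//; last by apply/measurable_EFinP; exact: measurable_indic.
rewrite integral_indic// EFinM; apply: lee_wpmul2l; first by rewrite lee_fin.
apply: (@le_trans _ _ (leb A)).
  by apply: le_measure; rewrite ?inE//; exact: measurableI.
rewrite /A lebesgue_measure_itv/=; case: ifP => _ //.
by rewrite lee_fin subr_ge0.
Qed.

Lemma integral_near_step_le (K : nat) (b : nat -> R) (eta M : R) (u v : R -> R) :
  (0 < K)%N -> 0 <= eta -> 0 <= M -> (forall j, (j < K)%N -> 0 <= b j) ->
  measurable_fun (D : set (measurableTypeR R)) u ->
  measurable_fun (D : set (measurableTypeR R)) v ->
  {ae leb, forall x, forall j, (j < K)%N -> knot K j < x < knot K j.+1 ->
    `|v x - u x| <= b j +
      M * \sum_(0 <= i < K.+1) \1_`[knot K i - 2 * eta, knot K i + 2 * eta] x} ->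
  (\int[leb]_(x in D) (`|v x - u x|)%:E <=
    (\sum_(0 <= j < K) b j / K%:R + M * (K.+1%:R * (4 * eta)))%:E)%E.
Proof.
move=> K0 eta0 M0 b0 mu mv vu.
pose c j := if (j < K)%N then b j else 0.
have c0 j : 0 <= c j by rewrite /c; case: ifP => // /b0.
pose p j (x : R) : \bar R := (c j * \1_`]knot K j, knot K j.+1[ x)%:E.
pose q j (x : R) : \bar R := (M * \1_`[knot K j - 2 * eta, knot K j + 2 * eta] x)%:E.
have mp j : measurable_fun (D : set (measurableTypeR R)) (p j).
  by apply/measurable_EFinP; apply: measurable_funM.
have mq j : measurable_fun (D : set (measurableTypeR R)) (q j).
  by apply/measurable_EFinP; apply: measurable_funM.
have p0 j x : (0 <= p j x)%E by rewrite lee_fin mulr_ge0// indicE ler0n.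
have q0 j x : (0 <= q j x)%E by rewrite lee_fin mulr_ge0// indicE ler0n.
pose H x := (\sum_(0 <= j < K) p j x + \sum_(0 <= j < K.+1) q j x)%E.
have mP : measurable_fun (D : set (measurableTypeR R)) (fun x => \sum_(0 <= j < K) p j x)%E.
  exact: emeasurable_sum.
have mQ : measurable_fun (D : set (measurableTypeR R)) (fun x => \sum_(0 <= j < K.+1) q j x)%E.
  exact: emeasurable_sum.
have P0 x : (0 <= \sum_(0 <= j < K) p j x)%E by apply: sume_ge0.
have Q0 x : (0 <= \sum_(0 <= j < K.+1) q j x)%E by apply: sume_ge0.
have key : {ae leb, forall x, D x -> ((`|v x - u x|)%:E <= H x)%E}.
  have ne : {ae leb, forall x, forall j, x != knot K j}.
    by apply: ae_foralln => j; exact: ae_neq.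
  apply: (ae_imply2 vu ne) => x + nx; rewrite /D/= in_itv/= => vux /andP[x0 x1].
  have K0' : 0 < K%:R :> R by rewrite ltr0n.
  pose j := Num.truncn (x * K%:R).
  have /andP[j1 j2] : j%:R <= x * K%:R < j.+1%:R by apply: truncn_itv; rewrite mulr_ge0.
  have jx : knot K j <= x by rewrite /knot ler_pdivrMr.
  have xj : x < knot K j.+1 by rewrite /knot ltr_pdivlMr.
  have {}x1 : x < 1 by rewrite lt_neqAle x1 andbT -(knot1 (R := R) K0) nx.
  have jK : (j < K)%N by rewrite -(ltr_nat R) (le_lt_trans j1)// gtr_pMl.
  have {}jx : knot K j < x by rewrite lt_neqAle jx andbT eq_sym nx.
  have := vux j jK; rewrite jx xj => /(_ isT) => h.
  apply: (@le_trans _ _ (b j + M * \sum_(0 <= i < K.+1) \1_`[knot K i - 2 * eta, knot K i + 2 * eta] x)%:E); first by rewrite lee_fin.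
  rewrite EFinD /H; apply: leeD; last first.
    by rewrite mulr_sumr -sumEFin.
  rewrite (bigD1_seq j)/=; [|by rewrite mem_index_iota|exact: iota_uniq].
  rewrite -[leLHS]adde0; apply: leeD; last exact: sume_ge0.
  by rewrite /p /c jK indicE mem_set ?mulr1//= in_itv/= jx.
apply: (@le_trans _ _ (\int[leb]_(x in D) H x)%E).
  apply: ae_ge0_le_integral => //.
  - by apply/measurable_EFinP; apply: measurableT_comp => //; exact: measurable_funB.
  - by move=> x _; rewrite adde_ge0.
  - exact: emeasurable_funD.
rewrite /H ge0_integralD//.
rewrite EFinD; apply: leeD.
  rewrite ge0_integral_sum// -sumEFin big_nat [leRHS]big_nat.
  apply: lee_sum => j /andP[_ jK]; rewrite /p.
  have cb : c j = b j by rewrite /c jK.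
  rewrite -[in leRHS](knotS (R := R) K j) -cb.
  exact: integral_indic_itv_le (c0 j) (knot_nd K j).
rewrite ge0_integral_sum//.
apply: (@le_trans _ _ (\sum_(0 <= j < K.+1) (M * (4 * eta))%:E)%E).
  apply: lee_sum => j _; rewrite /q.
  have -> : 4 * eta = (knot K j + 2 * eta) - (knot K j - 2 * eta) by ring.
  by apply: integral_indic_itv_le => //; lra.
rewrite sumEFin lee_fin sumr_const_nat subn0 -[leLHS]mulr_natl.
by rewrite mulrCA.
Qed.

Lemma common_lower_bound (P : R -> Prop) (K : nat) (sigma : nat -> R) (a : R) : P a ->
  (forall j, (j < K)%N -> P (sigma j)) ->
  exists z, [/\ P z, z <= a & forall j, (j < K)%N -> z <= sigma j].
Proof.
move=> Pa; elim: K => [|K IH] Ps; first by exists a.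
have [z [Pz za zs]] := IH (fun j jK => Ps j (ltnW jK)).
exists (Num.min z (sigma K)); split.
- by case: leP => _ //; exact: Ps.
- by rewrite ge_min za.
- move=> j; rewrite ltnS leq_eqVlt => /predU1P[->|jK]; first by rewrite ge_min lexx orbT.
  by rewrite ge_min zs.
Qed.

Lemma near_mul_le (eta : nat -> R) (a b : R) : eta @ \oo --> (0 : R) -> 0 < b ->
  \forall n \near \oo, a * eta n <= b.
Proof.
move=> eta0 b0.
have a1 : 0 < `|a| + 1 by rewrite ltr_wpDl.
have small : \forall n \near \oo, `|eta n| < b / (`|a| + 1).
  by apply: cvgr0_norm_lt; [exact: eta0|exact: divr_gt0].
apply: filterS small => n.
rewrite ltr_pdivlMr// => h.
rewrite (le_trans (ler_norm _))// normrM (le_trans _ (ltW h))//.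
by rewrite mulrC ler_wpM2l// lerDl.
Qed.

Section recovery_step.
Variables (phi1 phi2 F : R -> \bar R) (gamma l E u0 u1 : R) (u g : R -> R).
Variables (k1 k2 r p : nat -> nat) (t : nat -> nat -> nat).
Hypothesis phi1_ge0 : forall y, (0 <= phi1 y)%E.
Hypothesis phi2_ge0 : forall y, (0 <= phi2 y)%E.
Hypothesis F_ge0 : forall y, (0 <= F y)%E.
Hypothesis F_convex : econvex F.
Hypothesis F_lsc : lower_semicontinuous F.
Hypothesis F_min : forall z, F z = F (Num.min z gamma).
Hypothesis F_pos : forall z, 0 < z -> (F z < +oo)%E.
Hypothesis F_eq : forall z, z <= gamma -> F z = (phi1 z + phi2 z)%E.
Hypothesis phi_bounded : forall z0, (F z0 < +oo)%E ->
  exists C : R, forall z, z0 <= z -> (phi1 z <= C%:E)%E /\ (phi2 z <= C%:E)%E.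
Hypothesis gamma_gt0 : 0 < gamma.
Hypothesis l_gt0 : 0 < l.
Hypothesis u0_gt0 : 0 < u0.
Hypothesis u1_gt0 : 0 < u1.
Hypothesis K_k12 : condK R k1 k2.
Hypothesis atoms_t : atoms r t.
Hypothesis p_cvg : (fun n => lam R n * (p n)%:R) @ \oo --> (0 : R).
Hypothesis t_gap : forall n i, (i < r n)%N -> (t n i.+1 - t n i <= p n)%N.
Hypothesis L1u : L1 u.
Hypothesis BV : BVl_Dsnonneg l u g.
Hypothesis FE : (\int[leb]_(x in D) F (g x) <= E%:E)%E.

(** The macroscopic profile is fixed before [n]: [K], the slopes, the jumps and [C] are then
    constants, and every remaining error is a constant times the mesh size or times the length of a
    boundary layer. *)
Lemma recovery_step eps : 0 < eps -> \forall n \near \oo, exists v : R -> R,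
  [/\ in_A_T n (r n) (t n) v, BC n l u0 u1 v, L1 v,
    (\int[leb]_(x in D) (`|v x - u x|)%:E <= eps%:E)%E &
    (QCenergy phi1 phi2 n (k1 n) (k2 n) v <= (E + eps)%:E)%E].
Proof.
move=> eps0; have e2 : 0 < eps / 2 by rewrite divr_gt0.
have [K [sigma [rho [b [K0 sF [rho0 rho00 slack] Es [b0 be bu]]]]]] :=
  macro_approx F_ge0 F_convex F_lsc F_min F_pos gamma_gt0 l_gt0 BV FE e2.
have u01 : (F (Num.min u0 u1) < +oo)%E by apply: F_pos; rewrite lt_min u0_gt0.
(* [z] is a lower bound of all slopes that can occur. Being one of finitely many slopes of finite
   energy it has finite energy itself, so both potentials are bounded by some [C] from [z] on. *)
have [z [Fz zu zs]] := @common_lower_bound (fun z => (F z < +oo)%E) K sigma _ u01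
  (fun j jK => (sF j jK).2).
have [C phiC] := phi_bounded Fz.
have zu0 : z <= u0 by rewrite (le_trans zu)// ge_min lexx.
have zu1 : z <= u1 by rewrite (le_trans zu)// ge_min lexx orbT.
have C0 : 0 <= C by rewrite -lee_fin (le_trans (phi1_ge0 z))//; exact: (phiC z (lexx z)).1.
pose M := 2 * (`|l| + `|z|).
have M0 : 0 <= M by rewrite mulr_ge0// addr_ge0.
have [k12n [_ [_ [k1_cvg k2_cvg]]]] := K_k12.
have e16 : 0 < eps / 16 by rewrite divr_gt0.
have slack0 : 0 < l - (\sum_(0 <= j < K) rho j + \sum_(0 <= j < K) sigma j / K%:R) by lra.
have h2 : 0 < 2^-1 :> R by rewrite invr_gt0.
have N1 := near_mul_le 4 p_cvg h2.
have N2 := near_mul_le (u0 - z) p_cvg rho00.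
have N3 := near_mul_le (u1 - z) p_cvg slack0.
have N4 := near_mul_le (M * K.+1%:R * 4) p_cvg e2.
have N5 := near_mul_le (2 * C * K.+1%:R * 6) p_cvg e16.
have N6 := near_mul_le C k1_cvg e16.
have N7 := near_mul_le C k2_cvg e16.
near=> n.
have [k1_gt0 [k12 k2n]] : (0 < k1 n)%N /\ (k1 n < k2 n)%N /\ (k2 n < n - 2)%N by near: n.
have n_gt0 : (0 < n)%N by case: (n) k2n.
have k2n' : (k2 n < n)%N by apply: leq_trans k2n (leq_subr _ _).
have [t0 [tr t_lt]] := atoms_t n.
set eta := lam R n * (p n)%:R.
have eta0 : 0 <= eta by rewrite mulr_ge0// invr_ge0.
have eta_small : 4 * eta < 1.
  have : 4 * eta <= 2^-1 by rewrite /eta; near: n; exact: N1.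
  lra.
have eta_left : (u0 - z) * eta <= rho 0%N by rewrite /eta; near: n; exact: N2.
have eta_right : (u1 - z) * eta <=
  l - (\sum_(0 <= j < K) rho j + \sum_(0 <= j < K) sigma j / K%:R) by rewrite /eta; near: n; exact: N3.
have sm1 : M * K.+1%:R * 4 * eta <= eps / 2 by rewrite /eta; near: n; exact: N4.
have sm2 : 2 * C * K.+1%:R * 6 * eta <= eps / 16 by rewrite /eta; near: n; exact: N5.
have sm3 : C * (lam R n * (k1 n)%:R) <= eps / 16 by near: n; exact: N6.
have sm4 : C * (lam R n * (n - k2 n)%:R) <= eps / 16 by near: n; exact: N7.
pose v := discr n (r n) (t n) K sigma rho u0 u1 l.
have mv : measurable_fun (D : set (measurableTypeR R)) v.
  by apply: measurable_pl => //; exact: mesh_node_nd.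
have mu : measurable_fun (D : set (measurableTypeR R)) u.
  by case/integrableP: L1u => /measurable_EFinP.
have close : (\int[leb]_(x in D) (`|v x - u x|)%:E <= eps%:E)%E.
  have := @integral_near_step_le K b eta M u v K0 eta0 M0 b0 mu mv.
  move=> /(_ _)/le_trans; apply; last by rewrite lee_fin; lra.
  have le1 x : 0 <= \sum_(0 <= i < K.+1) \1_`[knot K i - 2 * eta, knot K i + 2 * eta] x :> R.
    by apply: sumr_ge0 => i _; rewrite indicE ler0n.
  have pw x : (forall j, (j < K)%N -> knot K j < x < knot K j.+1 ->
      `|jump_pl K sigma rho x - u x| <= b j) ->
    forall j, (j < K)%N -> knot K j < x < knot K j.+1 -> `|v x - u x| <= b j +
      M * \sum_(0 <= i < K.+1) \1_`[knot K i - 2 * eta, knot K i + 2 * eta] x; last exact: (ae_imply bu pw).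
  move=> + j jK jx; move=> /(_ j jK jx) ub.
  have /andP[j0 j1] := jx.
  have x0 : 0 < x by apply: le_lt_trans j0; rewrite -(knot0 (R := R) K) knot_le.
  have x1 : x < 1 by apply: lt_le_trans j1 _; rewrite -(knot1 (R := R) K0) knot_le.
  have [[i iK near]|far] := pselect (exists2 i, (i <= K)%N & `|x - knot K i| <= 2 * eta).
    have : `|v x - jump_pl K sigma rho x| <= M.
      by apply: (discr_ut_bound n_gt0 t0 tr t_lt (t_gap (n := n))) => //; rewrite !ltW.
    have : M <= M * \sum_(0 <= i < K.+1) \1_`[knot K i - 2 * eta, knot K i + 2 * eta] x.
      have one : \1_`[knot K i - 2 * eta, knot K i + 2 * eta] x = 1 :> R.
        rewrite indicE mem_set//= in_itv/=; move: near; rewrite ler_norml => /andP[h3 h4].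
        by rewrite lerBrDl in h3; rewrite lerBlDl in h4; rewrite h3.
      rewrite ler_peMr// -[leLHS]one [leRHS](bigD1_seq i); [|by rewrite mem_index_iota ltnS|exact: iota_uniq].
      by rewrite lerDl; apply: sumr_ge0 => k _; rewrite indicE ler0n.
    have -> : v x - u x = (v x - jump_pl K sigma rho x) + (jump_pl K sigma rho x - u x) by ring.
    by move=> MS vM; rewrite (le_trans (ler_normD _ _))// addrC lerD// (le_trans vM).
  have -> : v x = jump_pl K sigma rho x.
    apply: (discr_ut_far n_gt0 t0 tr t_lt (t_gap (n := n)) K0 zu0 zu1) => //; first by rewrite x0.
    by move=> i iK; rewrite ltNge; apply/negP => h; apply: far; exists i.
  by rewrite (le_trans ub)// lerDl mulr_ge0.
exists v; split => //.
- exact: discr_in_A.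
- exact: (discr_BC n_gt0 t0 tr t_lt (t_gap (n := n)) zu0 zu1 eta_small eta_left eta_right).
- have iv : leb.-integrable D (fun x => (v x - u x)%:E).
    apply/integrableP; split; first by apply/measurable_EFinP; exact: measurable_funB.
    by apply: le_lt_trans close _; rewrite ltry.
  have := integrableD mD iv L1u; rewrite /L1; apply: eq_integrable => //.
  by move=> x _; rewrite /= -EFinD subrK.
- have := @discr_energy R n (r n) (p n) (t n) n_gt0 t0 tr t_lt (t_gap (n := n)) K sigma rho z u0 u1 l
    K0 rho0 zs zu0 zu1 eta_small eta_left eta_right phi1 phi2 F C (k1 n) (k2 n) phi1_ge0 phi2_ge0
    (fun y zy => (phiC y zy).1) (fun y zy => (phiC y zy).2)
    (fun j jK => F_eq (sF j jK).1) k12 k2n'.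
  move=> /le_trans; apply; apply: le_trans (leeD Es (lexx _)) _.
  by rewrite -EFinD lee_fin -/eta; lra.
Unshelve. all: by end_near. Qed.

End recovery_step.
End recovery.

(** * Energies *)

Section energies.
Context {R : realType}.
Local Notation leb := (@lebesgue_measure R).

Lemma sume_mul_shift (q : nat -> \bar R) (m c : R) (a b : nat) :
  (\sum_(a <= i < b) (m%:E * (q i + c%:E)) =
   \sum_(a <= i < b) (m%:E * q i) + (m * c * (b - a)%:R)%:E)%E.
Proof.
under eq_bigr do rewrite muleDr ?fin_num_adde_defl// -EFinM.
by rewrite big_split/= sumEFin sumr_const_nat mulr_natr.
Qed.

(** There are [n] nearest-neighbour terms and [n - 1] second-neighbour ones, each shifted by [c]
    with total weight [lam]; hence the defect [c * lam]. *)
Lemma QCenergy_shift (J1 J2 : R -> \bar R) (c : R) (n k1 k2 : nat) (v : R -> R) :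
  (0 < n)%N -> (k1 < k2)%N -> (k2 <= n)%N ->
  QCenergy (fun z => J1 z + c%:E)%E (fun z => J2 z + c%:E)%E n k1 k2 v =
  (QCenergy J1 J2 n k1 k2 v + (c + c - c * lam R n)%:E)%E.
Proof.
move=> n0 k12 k2n; rewrite /QCenergy.
under [X in (_ + X + _)%E = _]eq_bigr do rewrite addeACA -EFinD.
rewrite !sume_mul_shift subn0.
set S1 := (\sum_(0 <= i < n) _)%E; set S2 := (\sum_(0 <= i < k1) _)%E.
set S3 := (\sum_(k1 <= i < k2.-1) _)%E; set S4 := (\sum_(k2.-1 <= i < n.-1) _)%E.
have k20 : (0 < k2)%N by exact: leq_ltn_trans k12.
have k1k2 : (k1 <= k2.-1)%N by rewrite -ltnS prednK.
have k2n1 : (k2.-1 <= n.-1)%N by rewrite -ltnS !prednK.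
rewrite (addeACA S1) (addeACA (S1 + S2)) (addeACA (S1 + S2 + S3)) -!EFinD subn0.
congr (_ + _%:E)%E; rewrite natrB// natrB//.
have -> : n.-1%:R = n%:R - 1 :> R by rewrite -[in RHS](prednK n0) -natr1 addrK.
have nl : n%:R * lam R n = 1 by rewrite /lam mulfV// gt_eqF// ltr0n.
have -> : c + c - c * lam R n = (n%:R * lam R n) * c + (n%:R * lam R n) * c - c * lam R n.
  by rewrite nl mul1r.
by field.
Qed.

Lemma sume_nneg_sub (q : nat -> \bar R) (a a' b b' : nat) : (forall i, (0 <= q i)%E) ->
  (a' <= a)%N -> (b <= b')%N -> (\sum_(a <= i < b) q i <= \sum_(a' <= i < b') q i)%E.
Proof.
move=> q0 aa bb; have [ab|ba] := leqP a b; last first.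
  by rewrite big_geq 1?ltnW//; apply: sume_ge0.
rewrite [leRHS](@big_cat_nat _ _ _ a)//=; last exact: leq_trans bb.
rewrite [X in (_ <= _ + X)%E](@big_cat_nat _ _ _ b)//=.
by apply: (@le_trans _ _ (\sum_(a <= i < b) q i + \sum_(b <= i < b') q i)%E);
  [apply: leeDl|apply: leeDr]; exact: sume_ge0.
Qed.

Section extraction.
Variables (phi1 phi2 : R -> \bar R) (B : R) (n k1 k2 : nat) (v : R -> R).
Hypothesis phi1_ge0 : forall y, (0 <= phi1 y)%E.
Hypothesis phi2_ge0 : forall y, (0 <= phi2 y)%E.
Hypothesis QB : (QCenergy phi1 phi2 n k1 k2 v <= B%:E)%E.
Hypothesis k2n : (k2 <= n)%N.

Definition cell_slope i : R := (v (i.+1%:R * lam R n) - v (i%:R * lam R n)) / lam R n.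

Let lam0 : 0 <= lam R n. Proof. by rewrite invr_ge0. Qed.

Let S1 := (\sum_(0 <= i < n) ((lam R n)%:E * phi1 (cell_slope i)))%E.
Let S3 := (\sum_(k1 <= i < k2.-1) ((lam R n / 2)%:E *
  (phi2 (cell_slope i) + phi2 (cell_slope i.+1))))%E.

Let S13 : (S1 + S3 <= B%:E)%E.
Proof.
apply: le_trans QB; rewrite /QCenergy -/S1.
have S0 (m k : nat) (q : nat -> \bar R) : (forall i, (0 <= q i)%E) ->
    (0 <= \sum_(m <= i < k) ((lam R n)%:E * q i))%E.
  by move=> q0; apply: sume_ge0 => i _; rewrite mule_ge0.
apply: (le_trans _ (leeDl _ _)); last exact: S0.
by apply: leeD => //; apply: leeDl; exact: S0.
Qed.

Lemma QCenergy_bound1 : (S1 <= B%:E)%E.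
Proof.
apply: le_trans S13; apply: leeDl; apply: sume_ge0 => i _.
by rewrite mule_ge0 ?lee_fin ?divr_ge0// adde_ge0.
Qed.

(** A cell strictly inside the local region occurs in two consecutive averaged terms, with weight
    one half in each. Cell [k1] occurs only once, which is why the sum starts at [k1.+1]. *)
Lemma QCenergy_bound2 : (\sum_(k1.+1 <= i < k2.-1)
  ((lam R n)%:E * (phi1 (cell_slope i) + phi2 (cell_slope i))) <= B%:E)%E.
Proof.
apply: le_trans S13; under eq_bigr do rewrite ge0_muleDr//.
rewrite big_split/=; apply: leeD.
  apply: sume_nneg_sub => //; first by move=> i; rewrite mule_ge0.
  by rewrite (leq_trans (leq_pred _)).
pose q i := ((lam R n / 2)%:E * phi2 (cell_slope i))%E.
have q0 i : (0 <= q i)%E by rewrite mule_ge0// lee_fin divr_ge0.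
rewrite /S3; under [leRHS]eq_bigr do rewrite ge0_muleDr// -/(q _) -/(q _.+1).
rewrite big_split/=.
have -> : (\sum_(k1.+1 <= i < k2.-1) ((lam R n)%:E * phi2 (cell_slope i)) =
    \sum_(k1.+1 <= i < k2.-1) q i + \sum_(k1.+1 <= i < k2.-1) q i)%E.
  rewrite -big_split/=; apply: eq_bigr => i _.
  rewrite /q -ge0_muleDl ?lee_fin ?divr_ge0// -EFinD; congr (_%:E * _)%E.
  by field.
apply: leeD; first exact: sume_nneg_sub.
rewrite -(big_add1 _ _ k1 k2 xpredT q); apply: sume_nneg_sub => //.
exact: leq_pred.
Qed.

End extraction.

Section interpolation.
Variables (n r : nat) (t : nat -> nat) (v : R -> R).
Hypothesis n0 : (0 < n)%N.
Hypothesis t0 : t 0%N = 0%N.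
Hypothesis tr : t r = n.
Hypothesis v_A : in_A_T n r t v.
Hypothesis v0 : v 0 = 0.
Let lambda : R := lam R n.
Let lambda_gt0 : 0 < lambda. Proof. by rewrite invr_gt0 ltr0n. Qed.

Let grid_nd i : i%:R * lambda <= i.+1%:R * lambda.
Proof. by rewrite ler_pM2r// ler_nat. Qed.

Lemma sum_cell_slope i :
  \sum_(0 <= k < i) cell_slope n v k * (k.+1%:R * lambda - k%:R * lambda) = v (i%:R * lambda).
Proof.
have -> : v (i%:R * lambda) = v (i%:R * lambda) - v (0%:R * lambda).
  by rewrite mul0r v0 subr0.
rewrite -(telescope_sumr (fun i => v (i%:R * lambda)))//.
apply: eq_bigr => k _; rewrite /cell_slope -/lambda -mulrBl -natr1.
have -> : k%:R + 1 - k%:R = 1 :> R by ring.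
by rewrite mul1r divfK// gt_eqF.
Qed.

(** Each atomic cell is contained in one element, so [v] is affine on it and the lower bound can be
    argued on the full atomic mesh. *)
Lemma in_A_T_pl x : 0 < x < 1 -> v x = pl (fun i => i%:R * lambda) (cell_slope n v) n x.
Proof.
move=> /andP[x0 x1]; pose i := Num.truncn (x * n%:R).
have n0' : 0 < n%:R :> R by rewrite ltr0n.
have /andP[i1 i2] : i%:R <= x * n%:R < i.+1%:R by apply: truncn_itv; rewrite mulr_ge0// ltW.
have iN : (i < n)%N by rewrite -(ltr_nat R) (le_lt_trans i1)// gtr_pMl.
have xi : i%:R * lambda <= x <= i.+1%:R * lambda.
  by rewrite /lambda /lam ler_pdivrMr// i1 ler_pdivlMr// ltW.
rewrite (pl_in grid_nd (cell_slope n v) iN xi) sum_cell_slope.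
have [e er /andP[ei ie]] := find_element t0 tr iN.
have aff y : i%:R * lambda <= y <= i.+1%:R * lambda ->
    v y = v ((t e)%:R * lambda) + (y - (t e)%:R * lambda) / (((t e.+1)%:R - (t e)%:R) * lambda) *
      (v ((t e.+1)%:R * lambda) - v ((t e)%:R * lambda)).
  move=> /andP[y1 y2]; apply: v_A => //; apply/andP; split.
    by apply: le_trans y1; rewrite ler_pM2r// ler_nat.
  by apply: (le_trans y2); rewrite ler_pM2r// ler_nat.
rewrite /cell_slope -/lambda (aff x xi) (aff (i%:R * lambda)); last by rewrite lexx grid_nd.
rewrite (aff (i.+1%:R * lambda)); last by rewrite lexx grid_nd.
have tt : (t e)%:R < (t e.+1)%:R :> R by rewrite ltr_nat (leq_ltn_trans ei).
rewrite -natr1; field.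
by rewrite !gt_eqF ?subr_gt0.
Qed.

End interpolation.
End energies.

(** * Convergence, integration and diagonal selection *)

Section analysis.
Context {R : realType}.
Local Notation leb := (@lebesgue_measure R).
Let D : set R := `[0, 1]%classic.
Let mD : measurable (D : set (measurableTypeR R)). Proof. exact: measurable_itv. Qed.

Lemma cvge0_near_lt (f : nat -> \bar R) (e : R) : f @ \oo --> 0%E -> 0 < e ->
  \forall n \near \oo, (f n < e%:E)%E.
Proof.
move=> f0 e0; apply: (f0 [set x | (x < e%:E)%E]).
have : nbhs (0 : R) (fun r => (r%:E < e%:E)%E); last by [].
apply/nbhs_ballP; exists e => //= y; rewrite /ball/= sub0r normrN => h.
by rewrite lte_fin (le_lt_trans (ler_norm _) h).
Qed.

Lemma cvge0_near_le (f : nat -> \bar R) : (forall n, (0 <= f n)%E) ->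
  (forall e, 0 < e -> \forall n \near \oo, (f n <= e%:E)%E) -> f @ \oo --> 0%E.
Proof.
move=> f0 fe A; change (nbhs (0 : R) (fun r => A r%:E) -> (f @ \oo) A).
move=> /nbhs_ballP[e /= e0 eA]; have e2 : 0 < e / 2 by rewrite divr_gt0.
have := fe _ e2; apply: filterS => n; rewrite /preimage/=.
have := f0 n; case: (f n) => [y||] //; rewrite !lee_fin => y0 ye.
have : (fun r => A r%:E) y by apply: eA; rewrite /ball/= sub0r normrN ger0_norm//; lra.
by [].
Qed.

Lemma near_subsequence (P : nat -> Prop) (N : nat -> nat) : (forall k, (k <= N k)%N) ->
  (\forall n \near \oo, P n) -> \forall k \near \oo, P (N k).
Proof.
by move=> kN [M _ HM]; exists M => // k /= Mk; apply: HM => /=; exact: leq_trans (kN k).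
Qed.

(** [f] may change sign and take the value [+oo], but its negative part is at most [a] and so has a
    finite integral, which can be moved across the equality. *)
Lemma integral_addcst (f : R -> \bar R) (a : R) : 0 <= a ->
  measurable_fun (D : set (measurableTypeR R)) (fun x => f x + a%:E)%E ->
  (forall x, (0 <= f x + a%:E)%E) ->
  (\int[leb]_(x in D) (f x + a%:E) = \int[leb]_(x in D) f x + a%:E)%E.
Proof.
move=> a0 mfa fa0.
have mf : measurable_fun (D : set (measurableTypeR R)) f.
  have -> : f = (fun x => f x + a%:E - (cst a%:E) x)%E.
    by apply/funext => x /=; rewrite addeK.
  by apply: emeasurable_funB => //; exact: measurable_cst.
have mp := measurable_funepos mf; have mn := measurable_funeneg mf.
have cstE : (\int[leb]_(x in D) (cst a%:E x) = a%:E)%E.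
  have leb_D : leb D = 1%:E by rewrite lebesgue_measure_itv/= lte_fin ltr01 oppr0 adde0.
  by transitivity (a%:E * leb D)%E; [exact: integral_cst|rewrite leb_D mule1].
have nfin : (\int[leb]_(x in D) f^\- x)%E \is a fin_num.
  rewrite ge0_fin_numE; last by apply: integral_ge0 => x _; exact: funeneg_ge0.
  apply: (@le_lt_trans _ _ a%:E); last exact: ltry.
  rewrite -[leRHS]cstE; apply: ge0_le_integral => //.
  move=> x _; rewrite funenegE ge_max lee_fin a0 andbT.
  by rewrite /cst; have := fa0 x; case: (f x) => [y||] //=; rewrite ?lee_fin; [lra|rewrite leNye].
have key : (\int[leb]_(x in D) (f x + a%:E) + \int[leb]_(x in D) f^\- x =
    \int[leb]_(x in D) f^\+ x + a%:E)%E.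
  rewrite -[in RHS]cstE -!ge0_integralD//.
  apply: eq_integral => x _; rewrite /= funeposE funenegE.
  have := fa0 x; case: (f x) => [y||] //= _.
  - rewrite -!EFin_max -!EFinD; congr (_%:E).
    case: leP => h1; case: leP => h2; lra.
  - by rewrite maxye maxNye.
by rewrite [in RHS]integralE addeAC -key addeK.
Qed.

(** The distances have summable integrals, so their series converges almost everywhere and its terms
    tend to 0. *)
Lemma ae_cvg_fast (f : nat -> R -> R) (u : R -> R) :
  (forall k, measurable_fun (D : set (measurableTypeR R)) (f k)) ->
  measurable_fun (D : set (measurableTypeR R)) u ->
  (forall k, (\int[leb]_(x in D) (`|f k x - u x|)%:E <= (1 / (2 ^ k.+1)%:R)%:E)%E) ->
  {ae leb, forall x, D x -> f k x @[k --> \oo] --> u x}.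
Proof.
move=> mf mu fu; pose h k x := (`|f k x - u x|)%:E.
have mh k : measurable_fun (D : set (measurableTypeR R)) (h k).
  by apply/measurable_EFinP; apply: measurableT_comp => //; exact: measurable_funB.
have h0 k x : (0 <= h k x)%E by rewrite lee_fin.
have S0 x : (0 <= \sum_(0 <= k <oo) h k x)%E by apply: nneseries_ge0 => k _ _.
have iS : leb.-integrable D (fun x => \sum_(0 <= k <oo) h k x)%E.
  apply/integrableP; split; first exact: ge0_emeasurable_sum.
  under eq_integral do rewrite gee0_abs//.
  rewrite integral_nneseries//.
  apply: (@le_lt_trans _ _ 1%E); last exact: ltry.
  apply: le_trans (epsilon_trick0 xpredT (ler01 : 0 <= 1 :> R)).
  by apply: lee_nneseries => [k _ _|k _]; [exact: integral_ge0|exact: fu].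
apply: (ae_imply (integrable_ae mD iS)) => x + Dx => /(_ Dx) Sfin.
have Slt : (\sum_(0 <= k <oo) h k x < +oo)%E by rewrite -ge0_fin_numE.
have tail := nneseries_tail_cvg Slt (fun k _ => h0 k x).
apply/cvgrPdist_lt => e e0; have := cvge0_near_lt tail e0; apply: filterS => k.
rewrite -lte_fin; apply: le_lt_trans.
have := nneseries_lim_ge k.+1 (fun n (_ : (k <= n)%N) (_ : xpredT n) => h0 n x).
by rewrite big_nat1 /h distrC.
Qed.

(** At index [n] the witness is taken from the highest level up to [n] whose threshold has been
    passed; it serves all lower levels because the conclusion allows any [j >= k]. *)
Lemma diagonal_selection (T : Type) (A : T -> Prop) (Q : nat -> nat -> T -> Prop) (x0 : T) :
  A x0 -> (forall k n x, Q k n x -> A x) ->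
  (forall k, \forall n \near \oo, exists x, Q k n x) ->
  exists x : nat -> T, (forall n, A (x n)) /\
    forall k, \forall n \near \oo, exists2 j, (k <= j)%N & Q j n (x n).
Proof.
move=> Ax0 QA Qnear.
have /choice[N HN] : forall k, exists N, forall n, (N <= n)%N -> exists x, Q k n x.
  by move=> k; have [N _ HN] := Qnear k; exists N.
have step n m : exists x, A x /\ forall k, (k < m)%N -> (N k <= n)%N ->
    exists2 j, (k <= j)%N & Q j n x.
  elim: m => [|m [x [Ax IH]]]; first by exists x0.
  have [Nn|Nn] := leqP (N m) n.
    have [y Qy] := HN m n Nn; exists y; split; first exact: QA Qy.
    by move=> k km _; exists m.
  exists x; split => // k; rewrite ltnS leq_eqVlt => /predU1P[->|]; last exact: IH.
  by rewrite leqNgt Nn.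
have /choice[x Hx] : forall n, exists x, A x /\ forall k, (k < n.+1)%N -> (N k <= n)%N ->
    exists2 j, (k <= j)%N & Q j n x by move=> n; exact: step.
exists x; split=> [n|k]; first by case: (Hx n).
exists (maxn k (N k)) => // n /=; rewrite geq_max => /andP[kn Nn].
by case: (Hx n) => _; apply.
Qed.

End analysis.

(** * Gamma-convergence *)

Section gamma_limit.
Context {R : realType}.
Local Notation leb := (@lebesgue_measure R).
Variables (J1 J2 : R -> \bar R) (c gamma l u0 u1 : R).
Variables (k1 k2 r p : nat -> nat) (t : nat -> nat -> nat).
Let phi1 z := (J1 z + c%:E)%E.
Let phi2 z := (J2 z + c%:E)%E.
Let F z := (J0ss J1 J2 z + (c + c)%:E)%E.
Hypothesis c_gt0 : 0 < c.
Hypothesis gamma_gt0 : 0 < gamma.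
Hypothesis phi1_ge0 : forall z, (0 <= phi1 z)%E.
Hypothesis phi2_ge0 : forall z, (0 <= phi2 z)%E.
Hypothesis F_ge0 : forall z, (0 <= F z)%E.
Hypothesis F_convex : econvex F.
Hypothesis F_lsc : lower_semicontinuous F.
Hypothesis F_le : forall z, (F z <= phi1 z + phi2 z)%E.
Hypothesis phi1_superlinear : forall M : R, 0 < M ->
  exists2 Z : R, 0 <= Z & forall z, z <= - Z -> ((M * `|z|)%:E <= phi1 z)%E.
Hypothesis F_min : forall z, F z = F (Num.min z gamma).
Hypothesis F_eq : forall z, z <= gamma -> F z = (phi1 z + phi2 z)%E.
Hypothesis phi_bounded : forall z0, (F z0 < +oo)%E ->
  exists C : R, forall z, z0 <= z -> (phi1 z <= C%:E)%E /\ (phi2 z <= C%:E)%E.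
Hypothesis F_pos : forall z, 0 < z -> (F z < +oo)%E.
Hypothesis l_gt0 : 0 < l.
Hypothesis u0_gt0 : 0 < u0.
Hypothesis u1_gt0 : 0 < u1.
Hypothesis K_k12 : condK R k1 k2.
Hypothesis atoms_t : atoms r t.
Hypothesis p_cvg : (fun n => lam R n * (p n)%:R) @ \oo --> (0 : R).
Hypothesis t_gap : forall n i, (i < r n)%N -> (t n i.+1 - t n i <= p n)%N.

Let D : set R := `[0, 1]%classic.
Let mD : measurable (D : set (measurableTypeR R)). Proof. exact: measurable_itv. Qed.
Let H n := Hhat J1 J2 l u0 u1 n (k1 n) (k2 n) (r n) (t n).

Let measurable_F g : measurable_fun (D : set (measurableTypeR R)) g ->
  measurable_fun (D : set (measurableTypeR R)) (F \o g).
Proof.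
move=> mg; apply: (@measurableT_comp _ _ _ _ _ _ F) => //.
exact: lower_semicontinuous_measurable.
Qed.

Let c2_ge0 : 0 <= c + c. Proof. by rewrite addr_ge0// ltW. Qed.

Let integral_F g : measurable_fun (D : set (measurableTypeR R)) g ->
  (\int[leb]_(x in D) F (g x) = \int[leb]_(x in D) J0ss J1 J2 (g x) + (c + c)%:E)%E.
Proof.
move=> mg; apply: (@integral_addcst R (fun x => J0ss J1 J2 (g x)) (c + c) c2_ge0 (measurable_F mg)) => x.
exact: F_ge0.
Qed.

Let mBV u g : BVl_Dsnonneg l u g -> measurable_fun (D : set (measurableTypeR R)) g.
Proof. by case=> /integrableP[/measurable_EFinP]. Qed.

(** If the inequality failed, infinitely many energies would lie below some [L < Hlim]. Along a
    subsequence of these that converges fast enough to converge almost everywhere, the compactness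
    result yields a density of energy at most [L]. *)
Lemma Gamma_liminf (u : R -> R) (us : nat -> R -> R) : L1 u -> (forall n, L1 (us n)) ->
  L1_cvg us u -> (Hlim J1 J2 l u <= limn_einf (fun n => H n (us n)))%E.
Proof.
move=> iu ius us_u; rewrite leNgt; apply/negP => /lt_ereal_between[L Llow Lhigh].
have freq N : exists2 n, (N <= n)%N & (H n (us n) < L%:E)%E.
  apply: contrapT => no; move: Llow; rewrite ltNge => /negP; apply.
  apply: near_limn_einf_ge; exists N => // n /= Nn; rewrite leNgt; apply/negP => h.
  by apply: no; exists n.
have [k12n [k1oo [k2oo [k1_cvg k2_cvg]]]] := K_k12.
have good k : exists nv : nat * (R -> R), [/\ (k <= nv.1)%N,
    [/\ (0 < k1 nv.1)%N, (k1 nv.1 < k2 nv.1)%N & (k2 nv.1 < nv.1 - 2)%N],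
    [/\ in_A_T nv.1 (r nv.1) (t nv.1) nv.2, BC nv.1 l u0 u1 nv.2 &
      {ae leb, forall x, `]0, 1[%classic x -> nv.2 x = us nv.1 x}],
    (QCenergy phi1 phi2 nv.1 (k1 nv.1) (k2 nv.1) nv.2 <= (L + (c + c))%:E)%E &
    (\int[leb]_(x in D) (`|us nv.1 x - u x|)%:E <= (1 / (2 ^ k.+1)%:R)%:E)%E].
  have e0 : 0 < 1 / (2 ^ k.+1)%:R :> R by rewrite divr_gt0// ltr0n expn_gt0.
  have [N1 _ HN1] := k12n; have [N2 _ HN2] := cvge0_near_lt us_u e0.
  have [n] := freq (maxn k (maxn N1 N2)); rewrite !geq_max => /and3P[kn N1n N2n].
  move=> /ereal_inf_lt[_ [v [vA [vB vae]] <-] vL].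
  have [k10 [k12 k2n]] := HN1 n N1n.
  exists (n, v); split => //; last exact: ltW (HN2 n N2n).
  have n0 : (0 < n)%N by case: (n) k2n.
  rewrite QCenergy_shift//; last by rewrite ltnW// (leq_trans k2n)// leq_subr.
  rewrite [leRHS]EFinD; apply: leeD; first exact: ltW.
  by rewrite lee_fin gerBl mulr_ge0 ?ltW// invr_gt0 ltr0n.
have [nv Hnv] := choice good; pose N k := (nv k).1; pose v k := (nv k).2.
have kN k : (k <= N k)%N by case: (Hnv k).
have N0 k : (0 < N k)%N by case: (Hnv k) => _ [_ _]; rewrite -/(N k); case: (N k).
have kk k : [/\ (0 < k1 (N k))%N, (k1 (N k) < k2 (N k))%N & (k2 (N k) < N k)%N].
  by case: (Hnv k) => _ [? ? k2n] _ _ _; split => //; exact: leq_trans k2n (leq_subr _ _).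
have vA k : in_A_T (N k) (r (N k)) (t (N k)) (v k) by case: (Hnv k) => _ _ [].
have vBC k : BC (N k) l u0 u1 (v k) by case: (Hnv k) => _ _ [].
have vQ k : (QCenergy phi1 phi2 (N k) (k1 (N k)) (k2 (N k)) (v k) <= (L + (c + c))%:E)%E.
  by case: (Hnv k).
have v0 k : v k 0 = 0 by case: (vBC k).
have tt k := atoms_t (N k).
pose s k := cell_slope (N k) (v k).
have [] := @liminf_core_density R phi1 phi2 F (L + (c + c)) l N (k1 \o N) (k2 \o N) s u
  phi1_ge0 F_ge0 F_convex F_lsc F_le phi1_superlinear N0.
- by move=> k; apply: QCenergy_bound1 (vQ k).
- by move=> k; apply: QCenergy_bound2 (vQ k) _ => //; case: (kk k) => _ _ /ltnW.
(* The layer ends one cell after [k1]; as [k1] is positive, [k1 + 1 <= 2 * k1]. *)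
- move=> e e0.
  have := near_subsequence kN (near_mul_le 2 k1_cvg e0); apply: filterS => k.
  apply: le_trans; have [k10 _ _] := kk k.
  rewrite /= [leRHS](_ : _ = (2 * (k1 (N k))%:R) * lam R (N k)); last by ring.
  apply: ler_wpM2r; first by rewrite invr_ge0.
  by rewrite -natrM ler_nat mul2n -addnn -addn1 leq_add2l.
(* Likewise [N k - (k2 (N k) - 1)] exceeds [N k - k2 (N k)] by one, which is at most twice the
   latter since [k2 (N k) < N k]. *)
- move=> e e0.
  have := near_subsequence kN (near_mul_le 2 k2_cvg e0); apply: filterS => k.
  have [k10 k12 k2N] := kk k => h; rewrite lerBlDr -lerBlDl; apply: le_trans h.
  have k20 : (0 < k2 (N k))%N by exact: leq_ltn_trans k12.
  have -> : 1 - (k2 (N k)).-1%:R * lam R (N k) = (N k - (k2 (N k)).-1)%:R * lam R (N k).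
    rewrite natrB; last by rewrite (leq_trans (leq_pred _))// ltnW.
    by rewrite mulrBl {2}/lam mulfV// gt_eqF// ltr0n.
  rewrite [leRHS](_ : _ = (2 * (N k - k2 (N k))%:R) * lam R (N k)); last by ring.
  apply: ler_wpM2r; first by rewrite invr_ge0.
  rewrite -natrM ler_nat mul2n -addnn -subn1 subnA//; last exact: ltnW.
  by rewrite leq_add2l subn_gt0.
- by move=> k; have [_ _ k2N] := kk k; rewrite (leq_trans (leq_pred _))// ltnW.
- move=> k; have [_ [_ [_ vl]]] := vBC k.
  rewrite -vl -(sum_cell_slope (N0 k) (v0 k)); apply: eq_bigr => i _.
  by congr (_ * _); rewrite -natr1; ring.
- have ae1 : {ae leb, forall x, forall k, `]0, 1[%classic x -> v k x = us (N k) x}.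
    by apply: ae_foralln => k; case: (Hnv k) => _ _ [].
  have ae2 : {ae leb, forall x, D x -> us (N k) x @[k --> \oo] --> u x}.
    apply: ae_cvg_fast => [k||k].
    + by case/integrableP: (ius (N k)) => /measurable_EFinP.
    + by case/integrableP: iu => /measurable_EFinP.
    + by case: (Hnv k).
  apply: (ae_imply2 ae1 ae2) => x vx ux x01.
  have Dx : D x by rewrite /D/= in_itv/=; case/andP: x01 => *; rewrite !ltW.
  have -> : (fun k => pl (fun i => i%:R * lam R (N k)) (s k) (N k) x) = (fun k => us (N k) x).
    apply/funext => k; have [t0 [tr _]] := tt k.
    by rewrite -(in_A_T_pl (N0 k) t0 tr (vA k) (v0 k) x01) vx//= in_itv.
  exact: ux.
move=> g [BV _ Fg]; move: Lhigh; rewrite ltNge => /negP; apply.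
apply: (@le_trans _ _ (\int[leb]_(x in D) J0ss J1 J2 (g x))%E).
  by apply: ereal_inf_lbound; exists g.
rewrite -(leeD2rE _ _ (_ : (c + c)%:E \is a fin_num))//.
by rewrite -integral_F; [rewrite -EFinD|exact: mBV BV].
Qed.

Lemma Gamma_limsup (u : R -> R) : L1 u -> exists us : nat -> R -> R,
  (forall n, L1 (us n)) /\ L1_cvg us u /\
  (limn_esup (fun n => H n (us n)) <= Hlim J1 J2 l u)%E.
Proof.
(* This excludes the value [-oo]. For the value [+oo] the constant sequence works, and a finite
   value [h] is approached by densities of nearly optimal energy. *)
move=> iu; have Hge : ((- (c + c))%:E <= Hlim J1 J2 l u)%E.
  apply: le_ereal_inf_tmp => _ [g BV <-].
  rewrite -(leeD2rE _ _ (_ : (c + c)%:E \is a fin_num))//.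
  rewrite -integral_F; last exact: mBV BV.
  by rewrite -EFinD addNr; exact: integral_ge0.
case HE : (Hlim J1 J2 l u) => [h||]; last by rewrite HE in Hge.
  2:{ exists (fun=> u); split=> //; split; last by rewrite leey.
      rewrite /L1_cvg; under eq_fun do under eq_integral do rewrite subrr normr0.
      by under eq_fun do rewrite integral0; exact: cvg_cst. }
pose Q k n (v : R -> R) := [/\ in_A_T n (r n) (t n) v, BC n l u0 u1 v, L1 v,
  (\int[leb]_(x in D) (`|v x - u x|)%:E <= (k.+1%:R^-1)%:E)%E &
  (QCenergy phi1 phi2 n (k1 n) (k2 n) v <= (h + (c + c) + 2 * k.+1%:R^-1)%:E)%E].
have Qnear k : \forall n \near \oo, exists v, Q k n v.
  have e0 : 0 < k.+1%:R^-1 :> R by rewrite invr_gt0.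
  have : (Hlim J1 J2 l u < (h + k.+1%:R^-1)%:E)%E by rewrite HE lte_fin ltrDl.
  move=> /ereal_inf_lt[_ [g BV <-] gh].
  have FE : (\int[leb]_(x in D) F (g x) <= (h + (c + c) + k.+1%:R^-1)%:E)%E.
    rewrite integral_F; last exact: mBV BV.
    rewrite [leRHS](_ : _ = ((h + k.+1%:R^-1)%:E + (c + c)%:E)%E); last by rewrite -EFinD addrAC.
    by apply: leeD => //; exact: ltW.
  have := recovery_step phi1_ge0 phi2_ge0 F_ge0 F_convex F_lsc F_min F_pos F_eq phi_bounded
    gamma_gt0 l_gt0 u0_gt0 u1_gt0 K_k12 atoms_t p_cvg t_gap iu BV FE e0.
  apply: filterS => n [v [? ? ? ? Qv]]; exists v; split => //.
  apply: (le_trans Qv); rewrite lee_fin.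
  by rewrite [leRHS](_ : _ = h + (c + c) + k.+1%:R^-1 + k.+1%:R^-1)//; move: (k.+1%:R^-1) => q; ring.
have [us [ius Qus]] := @diagonal_selection _ (@L1 R) Q u iu
  (fun k n v (q : Q k n v) => let: And5 _ _ i _ _ := q in i) Qnear.
have inv_small e : 0 < e -> exists k : nat, forall j, (k <= j)%N -> j.+1%:R^-1 <= e :> R.
  move=> e0; exists (Num.truncn e^-1) => j kj.
  rewrite -[leRHS]invrK lef_pV2 ?posrE ?invr_gt0//.
  apply: ltW; apply: (lt_le_trans (truncnS_gt _)); by rewrite ler_nat.
exists us; split => //; split.
  rewrite /L1_cvg; apply: cvge0_near_le => [n|e e0]; first exact: integral_ge0.
  have [k ke] := inv_small e e0; have := Qus k; apply: filterS => n [j kj [_ _ _ + _]].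
  by move=> /le_trans; apply; rewrite lee_fin ke.
apply/lee_addgt0Pr => e e0; apply: near_limn_esup_le.
have e2 : 0 < e / 2 by rewrite divr_gt0.
have [k ke] := inv_small (e / 4) (divr_gt0 e0 (ltr0n _ 4)).
have [k12n [_ [_ [k1_cvg _]]]] := K_k12.
(* Undoing the shift leaves the defect [c * lam], which is at most [c * (lam * k1)] because
   [k1 >= 1], and this tends to 0. *)
have ce := near_mul_le c k1_cvg e2.
have Qk := Qus k.
near=> n.
have [k10 [k12 k2n]] : (0 < k1 n)%N /\ (k1 n < k2 n)%N /\ (k2 n < n - 2)%N by near: n.
have cn : c * (lam R n * (k1 n)%:R) <= e / 2 by near: n.
have [j kj [vA vB _ _ vQ]] : exists2 j, (k <= j)%N & Q j n (us n) by near: n.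
have n0 : (0 < n)%N by case: (n) k2n.
apply: (@le_trans _ _ (QCenergy J1 J2 n (k1 n) (k2 n) (us n))).
  by apply: ereal_inf_lbound; exists (us n) => //; split => //; split => //; apply: aeW.
rewrite -(leeD2rE _ _ (_ : (c + c - c * lam R n)%:E \is a fin_num))// -QCenergy_shift//.
  apply: (le_trans vQ); rewrite -!EFinD lee_fin.
  have : c * lam R n <= c * (lam R n * (k1 n)%:R).
    by rewrite ler_pM2l// ler_peMr ?ler1n// invr_ge0.
  by have := ke j kj; move: (j.+1%:R^-1) => q; lra.
by rewrite ltnW// (leq_trans k2n)// leq_subr.
Unshelve. all: by end_near. Qed.

End gamma_limit.

Unset Implicit Arguments.

Theorem theorem3p1 (R : realType) (J1 J2 : R -> \bar R) :
  (forall z, (-oo < J1 z)%E) -> (forall z, (-oo < J2 z)%E) ->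
  LJ1 J1 J2 -> LJ2 J1 J2 -> LJ3 J1 J2 -> LJ4 J1 J2 ->
  forall l u0 u1 : R, 0 < l -> 0 < u0 -> 0 < u1 ->
  forall k1 k2 : nat -> nat, condK R k1 k2 ->
  forall (r : nat -> nat) (t : nat -> nat -> nat), atoms r t ->
  (exists p : nat -> nat,
     (fun n => lam R n * (p n)%:R) @ \oo --> (0 : R) /\
     forall n i, (i < r n)%N -> (t n i.+1 - t n i <= p n)%N) ->
  Gamma_L1 (fun n => Hhat J1 J2 l u0 u1 n (k1 n) (k2 n) (r n) (t n)) (Hlim J1 J2 l).
Proof.
move=> J1N _ _ lj2 lj3 lj4 l u0 u1 l0 u00 u10 k1 k2 K12 r t tA [p [p0 pt]].
have [c [gamma [c0 gamma0 []]]] := potentials_facts J1N lj2 lj3 lj4.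
move=> facts F_convex F_lsc F_le [superlin F_min F_eq bounded F_pos].
have phi1_ge0 z := (facts z).1.
have phi2_ge0 z := (facts z).2.1.
have F_ge0 z := (facts z).2.2.
split=> [u us iu ius us_u|u iu].
  exact: (Gamma_liminf l u0 u1 c0 phi1_ge0 phi2_ge0 F_ge0 F_convex F_lsc F_le superlin
    K12 tA iu ius us_u).
exact: (Gamma_limsup c0 gamma0 phi1_ge0 phi2_ge0 F_ge0 F_convex F_lsc F_min F_eq bounded
  F_pos l0 u00 u10 K12 tA p0 pt iu).
Qed.
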